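(* Let $d\geq 2$, and let $q$ be a nonhyperbolic quadratic polynomial on $\mathbb{R}^d$, that is, $$q(x)=\sum_{j=1}^d a_j^2x_j^2+\sum_{j=1}^d b_jx_j+c,$$ where $a_1,\dots,a_d,b_1,\dots,b_d,c$ are real numbers and at least one $a_j\neq 0$. Set $\beta=1$ if $b_j\neq 0$ for some $j$, and $\beta=0$ if $b_1=\cdots=b_d=0$. If $f$ is an entire function on $\mathbb{C}^d$ of order $\rho<1-\beta/2$, then there exists a harmonic entire function $h$ of order at most $\rho$ such that $h(x)=f(x)$ for all $x\in\{q=0\}$.
   Context: The set $\{q=0\}$ denotes the zero set $\{x\in\mathbb{R}^d : q(x)=0\}$ of the real polynomial $q$ (a nonhyperbolic quadratic hypersurface). An entire function is a holomorphic function $f:\mathbb{C}^d\to\mathbb{C}$. Its order is the infimum of all $\tau\geq 0$ for which there is a constant $A>0$ with $|f(z)|\leq A e^{|z|^\tau}$ for all $z\in\mathbb{C}^d$, where $|z|$ is the Euclidean norm (for nonconstant $f$ this equals $\limsup_{r\to\infty}\frac{\log\log M(r)}{\log r}$ with $M(r)=\max_{|z|\le r}|f(z)|$). An entire function $h$ is harmonic if $\Delta h=\sum_{j=1}^d \frac{\partial^2 h}{\partial x_j^2}=0$. Equivalently, its restriction to $\mathbb{R}^d$ is a (complex-valued) harmonic function. *)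

(* Defs.v *)
From HB Require Import structures.
From mathcomp Require Import all_boot all_order all_algebra.
From mathcomp Require Import all_classical all_reals all_analysis.
From mathcomp Require Import complex.
Set Implicit Arguments.
Unset Strict Implicit.
Unset Printing Implicit Defensive.
Import Order.TTheory GRing.Theory Num.Theory.
Import numFieldNormedType.Exports.

Local Open Scope classical_set_scope.
Local Open Scope ring_scope.
Local Open Scope complex_scope.

(* The field of complex numbers as a normed module over itself, with its usual
   topology.  Hence [differentiable] below, for functions from 'rV[R[i]]_d to
   R[i], is Frechet differentiability over the complex numbers. *)
#[warning="-redundant-canonical-projection"]
HB.instance Definition _ (R : realType) := NormedModule.copy R[i] R[i]^o.

Definition entire (R : realType) (d : nat) (f : 'rV[R[i]]_d -> R[i]) : Prop :=
  forall z : 'rV[R[i]]_d, differentiable f z.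

(* The library norm on 'rV is the max norm; growth is measured with the
   Euclidean one.  Normc.normc is the modulus as an element of R. *)
Definition euclid_norm (R : realType) (d : nat) (z : 'rV[R[i]]_d) : R :=
  Num.sqrt (\sum_(j < d) Normc.normc (z 0 j) ^+ 2).

(* The value is +oo when no exponent tau is admissible. *)
Definition entire_order (R : realType) (d : nat) (f : 'rV[R[i]]_d -> R[i]) : \bar R :=
  ereal_inf [set tau%:E | tau in [set tau : R | 0 <= tau /\
    exists2 A : R, 0 < A & forall z : 'rV[R[i]]_d,
      Normc.normc (f z) <= A * expR (euclid_norm z `^ tau)]].

Definition partial (R : realType) (d : nat) (j : 'I_d)
    (f : 'rV[R[i]]_d -> R[i]) : 'rV[R[i]]_d -> R[i] :=
  'D_(delta_mx 0 j) f.

Definition laplacian (R : realType) (d : nat) (f : 'rV[R[i]]_d -> R[i])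
    (z : 'rV[R[i]]_d) : R[i] :=
  \sum_(j < d) partial j (partial j f) z.

(* Meant for entire f: the derivatives in the Laplacian then exist, and are not
   the default value of the total operator 'D. *)
Definition harmonic_fun (R : realType) (d : nat) (f : 'rV[R[i]]_d -> R[i]) : Prop :=
  forall z : 'rV[R[i]]_d, laplacian f z = 0.

Definition quadratic (R : realType) (d : nat) (a b : 'rV[R]_d) (c : R)
    (x : 'rV[R]_d) : R :=
  \sum_(j < d) a 0 j ^+ 2 * x 0 j ^+ 2 + \sum_(j < d) b 0 j * x 0 j + c.

Definition real_point (R : realType) (d : nat) (x : 'rV[R]_d) : 'rV[R[i]]_d :=
  \row_(j < d) (x 0 j)%:C.

(* Main.v *)
From HB Require Import structures.
From mathcomp Require Import all_boot all_order all_algebra.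
From mathcomp Require Import complex.
From mathcomp Require Import ring lra zify.
From mathcomp Require ssrcomplements mpoly.

(** On the quadric [q = 0] every monomial agrees with a harmonic polynomial, and
    the function sought is the Taylor series of [f] with each monomial replaced
    by such a substitute.

    Write [q = P + L + c] with [P = sum a_j^2 x_j^2] and [L] linear.  A form [f]
    of degree [k] splits as [f = h + P g] with [h] harmonic, and on the quadric
    [P g = - L g - c g], which has lower degree; iterating yields a harmonic [H]
    such that [f - H] is a multiple of [q] ([harmonic_decomposition]).  What has
    to be controlled is the size of [H].  The norm that does it is the Gaussian
    one, [E (p^2)] for the standard normal law: a harmonic form is orthogonal to
    all polynomials of lower degree ([gauss_harmonic_orth]), and multiplication
    by a variable changes the norm in degree [k] at most by factors of order
    [sqrt k], from above and from below ([gauss_mulX_le], [gauss_mulX_ge]).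
    Hence [|g| <= C k |f|] ([harmonic_split]).  A form of degree [k] and norm [B]
    has coefficients of size about [B / sqrt k!], so a linear step [f -> L g]
    costs [k^2]: a factor [k] for [g], [sqrt k] for [L] and [sqrt k] for the
    factorial.  A constant step [f -> c g] also costs [k^2], but lowers the
    degree by two.  Altogether the substitute of a monomial of degree [k] is at
    most [(D max (r, k^e))^k] on the polydisc of radius [r], with [e = 2] in
    general and [e = 1] if [L = 0] ([harmonic_substitute]).

    If [|f(z)| <= A exp (|z|^tau)], Cauchy's estimate for the Taylor coefficients
    at a radius proportional to [max (r, k^e)] bounds the terms of degree [k] by
    a constant times [exp (kappa r^tau) 4^-k exp (kappa k^(e tau) - k)]
    ([growth_bound]).  The last factor is bounded precisely because
    [e tau < 1], that is, [tau < 1 - beta / 2].  So the series converges, its sum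
    is entire and harmonic, and its growth in [r] is that of
    [exp (kappa r^tau)], which is the bound on the order.

    The complex analysis behind this, from Frechet differentiability to the
    Taylor expansion in several variables, uses finite sums in place of contour
    integrals.  Goursat's bisection applied to trapezoidal sums ([goursat])
    shows that the polynomials interpolating a holomorphic function at the roots
    of unity of order [2 ^ K] converge to it ([interpolation_cvg]).  Power series
    with uniformly bounded coefficients are closed under pointwise limits
    ([power_series_closed]); this gives the expansion in one variable and,
    applied to coefficient functions, in several ([taylor_expansion]). *)

Set Implicit Arguments.
Unset Strict Implicit.
Unset Printing Implicit Defensive.
Import Order.TTheory GRing.Theory Num.Theory.
Local Open Scope ring_scope.
Local Open Scope complex_scope.

(** * The modulus of a complex number *)

Notation modc := Normc.normc.

Section Modulus.
Variable R : rcfType.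
Implicit Types (x y z : R[i]).

Lemma normr_modc z : `|z| = (modc z)%:C.
Proof. by rewrite normc_def; case: z. Qed.

Lemma modc_ge0 z : 0 <= modc z.
Proof. by case: z => a b; exact: sqrtr_ge0. Qed.

Lemma modcD x y : modc (x + y) <= modc x + modc y.
Proof. exact: le_normcD. Qed.

Lemma modcN x : modc (- x) = modc x.
Proof. exact: normcN. Qed.

Lemma modcB x y : modc (x - y) <= modc x + modc y.
Proof. by rewrite -(modcN y) modcD. Qed.

Lemma modcBC x y : modc (x - y) = modc (y - x).
Proof. by rewrite -modcN opprB. Qed.

Lemma modcM x y : modc (x * y) = modc x * modc y.
Proof. exact: Normc.normcM. Qed.

Lemma modcV x : modc (x^-1) = (modc x)^-1.
Proof. exact: Normc.normcV. Qed.

Lemma modc0 : modc (0 : R[i]) = 0.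
Proof. exact: Normc.normc0. Qed.

Lemma modc1 : modc (1 : R[i]) = 1.
Proof. exact: Normc.normc1. Qed.

Lemma modc_eq0 x : (modc x == 0) = (x == 0).
Proof.
by apply/eqP/eqP => [/Normc.eq0_normc //|->]; exact: modc0.
Qed.

Lemma modc_gt0 x : (0 < modc x) = (x != 0).
Proof. by rewrite lt_neqAle modc_ge0 andbT eq_sym modc_eq0. Qed.

Lemma modcX x n : modc (x ^+ n) = modc x ^+ n.
Proof. by elim: n => [|n IH]; rewrite ?expr0 ?modc1 // !exprS modcM IH. Qed.

Lemma modc_real (r : R) : modc r%:C = `|r|.
Proof. by rewrite /= expr0n addr0 sqrtr_sqr. Qed.

Lemma modc_nat n : modc (n%:R : R[i]) = n%:R.
Proof.
have -> : (n%:R : R[i]) = (n%:R)%:C by rewrite rmorph_nat.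
by rewrite modc_real ger0_norm.
Qed.

Lemma modc_sum (I : Type) (s : seq I) (P : pred I) (F : I -> R[i]) :
  modc (\sum_(i <- s | P i) F i) <= \sum_(i <- s | P i) modc (F i).
Proof.
elim/big_ind2: _ => [|x1 x2 y1 y2 h1 h2|//]; first by rewrite modc0.
by apply: le_trans (modcD _ _) _; exact: lerD.
Qed.

Lemma modc_triangle x y z : modc (x - z) <= modc (x - y) + modc (y - z).
Proof. by rewrite -(subrKA y x) modcD. Qed.

Lemma modc_sub_ge x y : modc x - modc y <= modc (x - y).
Proof. by rewrite lerBlDr -{1}(subrK y x) modcD. Qed.

Lemma Re_le_modc z : `|complex.Re z| <= modc z.
Proof.
case: z => a b /=; rewrite -sqrtr_sqr ler_wsqrtr //.
by rewrite lerDl sqr_ge0.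
Qed.

Lemma Im_le_modc z : `|complex.Im z| <= modc z.
Proof.
case: z => a b /=; rewrite -sqrtr_sqr ler_wsqrtr //.
by rewrite lerDr sqr_ge0.
Qed.

Lemma modc_le_ReIm z : modc z <= `|complex.Re z| + `|complex.Im z|.
Proof.
case: z => a b /=; rewrite -[leRHS]ger0_norm ?addr_ge0 // -[leRHS]sqrtr_sqr ler_wsqrtr //.
rewrite sqrrD !real_normK ?num_real // lerD2r lerDl.
by rewrite mulrn_wge0 // mulr_ge0.
Qed.

End Modulus.

Module RealPolynomials.
Import ssrcomplements mpoly.
Import Order.TTheory GRing.Theory Num.Theory.

(** * The Gaussian functional on polynomials *)

Lemma multinom_peel n k (m : 'X_{1..n}) : mdeg m = k.+1 ->
  exists i m', m = (U_(i) + m')%MM /\ mdeg m' = k.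
Proof.
move=> Ed; have [i mi] : exists i, m i != 0%N.
  apply/existsP; rewrite -negb_forall; apply: contra_eqN Ed => /forallP m0.
  rewrite mdegE big1 // => i _; exact/eqP.
have Em : m = (U_(i) + (m - U_(i)))%MM by rewrite addmC submK // lep1mP.
exists i, (m - U_(i))%MM; split=> //.
by move: Ed; rewrite {1}Em mdegD mdeg1 add1n => -[].
Qed.

Section Gauss.
Variables (n : nat) (R : rcfType).
Implicit Types (p q f g h : {mpoly R[n]}) (i j : 'I_n) (m : 'X_{1..n}).

Lemma msize_le_coeff p k :
  (forall m, (k <= mdeg m)%N -> p@_m = 0) -> (msize p <= k)%N.
Proof.
move=> H; rewrite msizeE; apply/bigmax_leqP_seq => m mp _.
rewrite ltnNge; apply/negP => /H p0; move: mp.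
by rewrite mcoeff_msupp p0 eqxx.
Qed.

Lemma mcoeff_msize p k m : (msize p <= k)%N -> (k <= mdeg m)%N -> p@_m = 0.
Proof. by move=> pk km; apply: memN_msupp_eq0; apply: msize_mdeg_ge; exact: leq_trans km. Qed.

Lemma msize_mderiv p i k : (msize p <= k.+1)%N -> (msize (mderiv i p) <= k)%N.
Proof.
move=> pk; apply: msize_le_coeff => m km.
by rewrite mcoeff_deriv (mcoeff_msize pk) ?mul0rn// mdegD mdeg1 addn1.
Qed.

Lemma msize_mulX p i k : (msize p <= k)%N -> (msize ('X_i * p) <= k.+1)%N.
Proof.
move=> pk; rewrite msizeE; apply/bigmax_leqP_seq => m.
move=> /msuppM_le/allpairsP[[m1 m2] /= [+ m2p ->]] _.
rewrite msuppX inE => /eqP ->; rewrite mdegD mdeg1 add1n ltnS.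
by apply: leq_trans pk; apply: msize_mdeg_lt.
Qed.

Lemma mderivXp p i j :
  mderiv j ('X_i * p) = (i == j)%:R *: p + 'X_i * mderiv j p.
Proof.
rewrite mderivM mderivX mnm1E; case: (i =P j) => [->|]; last by rewrite !scale0r mul0r.
rewrite (_ : (U_(j) - U_(j))%MM = 0%MM) ?mpolyX0 ?scale1r ?mul1r //.
by apply/mnmP => k; rewrite mnmBE subnn mnm0E.
Qed.

(** The moments of the standard normal law. *)
Fixpoint normal_moment (k : nat) : nat :=
  match k with 0 => 1 | 1 => 0 | k'.+2 => k'.+1 * normal_moment k' end.

Definition gauss p : R :=
  \sum_(m <- msupp p) p@_m * (\prod_i normal_moment (m i))%:R.

Lemma gaussE p k : (msize p <= k)%N ->
  gauss p = \sum_(m : 'X_{1..n < k}) p@_m * (\prod_i normal_moment (m i))%:R.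
Proof.
move=> le_pk; rewrite /gauss (big_mksub ('X_{1..n < k})) ?msupp_uniq //=; last first.
  by move=> x /msize_mdeg_lt /leq_trans; apply.
by rewrite big_rmcond //= => j /memN_msupp_eq0 ->; rewrite mul0r.
Qed.

Fact gauss_is_linear : scalar gauss.
Proof.
move=> c p q; pose k := maxn (msize (c *: p + q)) (maxn (msize p) (msize q)).
rewrite !(@gaussE _ k) ?leq_max ?leqnn ?orbT // mulr_sumr -big_split /=.
by apply: eq_bigr => m _; rewrite mcoeffD mcoeffZ mulrDl mulrA.
Qed.
HB.instance Definition _ := GRing.isLinear.Build R {mpoly R[n]} R _ gauss gauss_is_linear.

Lemma gaussZ c p : gauss (c *: p) = c * gauss p.
Proof. exact: linearZ_LR. Qed.

Lemma gaussX m : gauss 'X_[m] = (\prod_i normal_moment (m i))%:R.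
Proof. by rewrite /gauss msuppX big_seq1 mcoeffX eqxx mul1r. Qed.

Lemma gauss1 : gauss 1 = 1.
Proof. by rewrite -mpolyX0 gaussX big1 // => i _; rewrite mnm0E. Qed.

(** Integration by parts against the normal density. *)
Lemma gauss_stein i p : gauss ('X_i * p) = gauss (mderiv i p).
Proof.
rewrite [p]mpolyE mulr_sumr (linear_sum (mderiv i)) !(linear_sum gauss) /=; apply: eq_bigr => m _.
rewrite -scalerAr mderivZ !gaussZ -mpolyXD gaussX mderivX gaussZ gaussX; congr (_ * _).
rewrite -natrM; congr (_%:R).
rewrite (bigD1 i) //= mnmDE mnm1E eqxx add1n.
under eq_bigr => k ki do rewrite mnmDE mnm1E eq_sym (negbTE ki) add0n.
case Em: (m i) => [|a] /=; first by rewrite mul0n.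
rewrite [in RHS](bigD1 i) //= mnmBE mnm1E eqxx Em subn1 /= mulnA.
by congr (_ * _)%N; apply: eq_bigr => k ki; rewrite mnmBE mnm1E eq_sym (negbTE ki) subn0.
Qed.

(** Up to the factor [k!], the pairing of the components of [p] and [q] in the
    [k]-th Wiener chaos.  The sum is over ordered [k]-tuples of directions rather
    than over multi-indices, so that no multinomial weight is needed. *)
Fixpoint chaos (k : nat) p q : R :=
  if k is k'.+1 then \sum_i chaos k' (mderiv i p) (mderiv i q)
  else gauss p * gauss q.

Lemma chaosDl k p1 p2 q : chaos k (p1 + p2) q = chaos k p1 q + chaos k p2 q.
Proof.
elim: k p1 p2 q => [|k IH] p1 p2 q /=; first by rewrite linearD mulrDl.
by rewrite -big_split; apply: eq_bigr => i _; rewrite /= linearD IH.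
Qed.

Lemma chaosZl k c p q : chaos k (c *: p) q = c * chaos k p q.
Proof.
elim: k p q => [|k IH] p q /=; first by rewrite gaussZ mulrA.
by rewrite mulr_sumr; apply: eq_bigr => i _; rewrite /= linearZ IH.
Qed.

Lemma chaos0l k q : chaos k 0 q = 0.
Proof. by rewrite -(scale0r (0 : {mpoly R[n]})) chaosZl mul0r. Qed.

Lemma chaos_ge0 k p : 0 <= chaos k p p.
Proof.
elim: k p => [|k IH] p /=; first by rewrite -expr2 sqr_ge0.
by apply: sumr_ge0.
Qed.

Lemma chaos_msize k p q : (msize p <= k)%N -> chaos k p q = 0.
Proof.
elim: k p q => [|k IH] p q /=.
  by rewrite leqn0 msize_poly_eq0 => /eqP ->; rewrite linear0 mul0r.
by move=> pk; apply: big1 => i _; apply: IH; exact: msize_mderiv.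
Qed.

(** Stein's identity at level [k]: each of the [k] differentiations can also hit
    the new factor, and these contributions are equal by symmetry. *)
Lemma chaosX k i p q :
  chaos k ('X_i * p) q = chaos k (mderiv i p) q + k%:R * chaos k.-1 p (mderiv i q).
Proof.
elim: k p q => [|k IH] p q /=; first by rewrite gauss_stein mul0r addr0.
under eq_bigr => j _ do rewrite mderivXp chaosDl chaosZl IH.
rewrite !big_split /=.
have -> : \sum_j (i == j)%:R * chaos k p (mderiv j q) = chaos k p (mderiv i q).
  rewrite (bigD1 i) //= eqxx mul1r big1 ?addr0 // => j ji.
  by rewrite eq_sym (negbTE ji) mul0r.
rewrite addrC -addrA; congr (_ + _).
  by apply: eq_bigr => j _; rewrite mderiv_comm.
case: k {IH} => [|k]; first by rewrite big1 ?add0r ?mul1r // => j _; rewrite mul0r.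
rewrite -mulr_sumr /= (eq_bigr (fun j => chaos k (mderiv j p) (mderiv j (mderiv i q)))).
  by rewrite [in RHS]mulrSr mulrDl mul1r.
by move=> j _; rewrite mderiv_comm.
Qed.

(** Hermite expansion.  By linearity [p] is a monomial, and peeling off one
    variable turns both sides into the same sum of two terms: the left one by
    [gauss_stein] and Leibniz' rule, the right one by [chaosX]. *)
Theorem gauss_parseval N p q : (msize p <= N)%N ->
  gauss (p * q) = \sum_(k < N) chaos k p q / (k`!)%:R.
Proof.
move=> pN; rewrite {1}[p]mpolyE.
have -> : \sum_(k < N) chaos k p q / (k`!)%:R =
   \sum_(m <- msupp p) p@_m * \sum_(k < N) chaos k 'X_[m] q / (k`!)%:R.
  under [RHS]eq_bigr => m _ do rewrite mulr_sumr.
  rewrite exchange_big /=; apply: eq_bigr => k _.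
  rewrite {1}[p]mpolyE.
  elim: (msupp p) => [|m s IHs]; first by rewrite !big_nil chaos0l mul0r.
  by rewrite !big_cons chaosDl chaosZl mulrDl IHs mulrA.
rewrite mulr_suml linear_sum /= !big_seq; apply: eq_bigr => m mp.
rewrite -scalerAl gaussZ; congr (_ * _).
have {mp pN} : (mdeg m < N)%N by apply: leq_trans pN; exact: msize_mdeg_lt.
move Ed : (mdeg m) => d; elim/ltn_ind: d => d IHd in m N q Ed *.
case: d IHd Ed => [|d] IHd Ed dN.
  case: N dN => // N _.
  move/eqP: Ed; rewrite mdeg_eq0 => /eqP ->; rewrite mpolyX0 mul1r.
  rewrite big_ord_recl [chaos _ _ _]/= fact0 divr1 gauss1 mul1r big1 ?addr0 // => k _.
  by rewrite lift0 chaos_msize ?mul0r // msize1.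
have [i [m' [Em dm']]] := multinom_peel Ed.
rewrite Em mpolyXD -mulrA gauss_stein mderivM linearD /=.
case: N dN => // N dN.
have sX : (msize ('X_[m'] : {mpoly R[n]}) <= d.+1)%N by rewrite msizeX dm'.
have -> : gauss (mderiv i 'X_[m'] * q) =
    \sum_(k < N.+1) chaos k (mderiv i 'X_[m']) q / (k`!)%:R.
  rewrite mderivX -scalerAl gaussZ.
  have [m'0|m'i] := eqVneq (m' i) 0%N.
    rewrite m'0 mul0r big1 // => k _.
    by rewrite scale0r chaos0l mul0r.
  have dmm : (mdeg (m' - U_(i))).+1 = d.
    by rewrite -dm' -[in RHS](submK (m := U_(i)%MM) (m' := m')) ?lep1mP // mdegD mdeg1 addn1.
  rewrite (IHd (mdeg (m' - U_(i))) _ _ N.+1 q) //; first last.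
  - by apply: leq_trans dN; rewrite ltnS -dmm leqW.
  - by rewrite -dmm; exact: leqW.
  rewrite mulr_sumr; apply: eq_bigr => k _; rewrite chaosZl mulrA //.
rewrite (IHd d _ m' N (mderiv i q)) //.
rewrite [RHS](eq_bigr (fun k : 'I_N.+1 => chaos k (mderiv i 'X_[m']) q / (k`!)%:R +
   k%:R * chaos k.-1 'X_[m'] (mderiv i q) / (k`!)%:R)); last first.
  by move=> k _; rewrite chaosX mulrDl.
rewrite big_split /=; congr (_ + _).
rewrite [RHS]big_ord_recl !mul0r add0r; apply: eq_bigr => k _.
rewrite lift0 /= factS natrM invfM -[_%:R * _]mulrC -mulrA; congr (_ * _).
by rewrite mulrA divff ?mul1r // pnatr_eq0.
Qed.

End Gauss.

(** * Gaussian estimates *)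

Section GaussIneq.
Variables (n : nat) (R : rcfType).
Implicit Types (p q f g h : {mpoly R[n]}) (i j : 'I_n) (m : 'X_{1..n}).

Lemma gauss_sqr_ge0 p : 0 <= gauss (p * p).
Proof.
rewrite (gauss_parseval (N := msize p)) //; apply: sumr_ge0 => k _.
by rewrite divr_ge0 ?chaos_ge0.
Qed.

Lemma gauss_expand (a b : R) p q :
  gauss ((a *: p + b *: q) * (a *: p + b *: q)) =
  a ^+ 2 * gauss (p * p) + 2 * a * b * gauss (p * q) + b ^+ 2 * gauss (q * q).
Proof.
have -> : (a *: p + b *: q) * (a *: p + b *: q) =
   (a ^+ 2) *: (p * p) + (2 * a * b) *: (p * q) + (b ^+ 2) *: (q * q).
  by rewrite !expr2 -!mul_mpolyC !mpolyCM mpolyC_nat; ring.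
by rewrite !linearD /= !gaussZ.
Qed.

(** Cauchy-Schwarz with a weight, which makes cross terms absorbable. *)
Lemma gauss_cs (a : R) p q : 0 < a ->
  2 * `|gauss (p * q)| <= a * gauss (p * p) + a^-1 * gauss (q * q).
Proof.
move=> a0; have a1 : a != 0 by rewrite gt_eqF.
have H (e : R) : e ^+ 2 = 1 ->
    2 * (e * gauss (p * q)) <= a * gauss (p * p) + a^-1 * gauss (q * q).
  move=> e1; have := gauss_sqr_ge0 (a *: p + (- e) *: q).
  rewrite gauss_expand sqrrN e1 mul1r => H.
  have := mulr_ge0 (ltW (_ : 0 < a^-1)) H; rewrite invr_gt0 => /(_ a0).
  have -> : a^-1 * (a ^+ 2 * gauss (p * p) + 2 * a * - e * gauss (p * q) + gauss (q * q))
    = a * gauss (p * p) + a^-1 * gauss (q * q) - 2 * (e * gauss (p * q)) by field.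
  by rewrite subr_ge0.
case: (ger0P (gauss (p * q))) => _; first by rewrite -[X in 2 * X]mul1r H ?expr1n.
by rewrite -mulN1r H // sqrrN expr1n.
Qed.

(** A polynomial of degree at most [k] has Hermite levels [0, ..., k] only, and
    the sum of squared derivatives multiplies level [j] by [j]. *)
Lemma gauss_mderiv_sum_le p k : (msize p <= k.+1)%N ->
  \sum_i gauss (mderiv i p * mderiv i p) <= k%:R * gauss (p * p).
Proof.
move=> pk.
under eq_bigr => i _ do rewrite (gauss_parseval (N := k)) ?msize_mderiv //.
rewrite exchange_big /= (gauss_parseval (N := k.+1)) // big_ord_recl mulrDr.
rewrite -[X in X <= _]add0r lerD //.
  by rewrite fact0 divr1 mulr_ge0 // chaos_ge0.
rewrite mulr_sumr ler_sum // => j _; rewrite lift0 -mulr_suml.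
set C := \sum_i _; have C0 : 0 <= C / j`!%:R.
  by rewrite divr_ge0 // sumr_ge0 // => i _; exact: chaos_ge0.
have -> : k%:R * (chaos j.+1 p p / (j.+1)`!%:R) = (k%:R / j.+1%:R) * (C / j`!%:R).
  by rewrite factS natrM invfM [RHS]mulrACA mulrA.
by rewrite ler_peMl // ler_pdivlMr ?ltr0n // mul1r ler_nat.
Qed.

Lemma gauss_mderiv_le p i k : (msize p <= k.+1)%N ->
  gauss (mderiv i p * mderiv i p) <= k%:R * gauss (p * p).
Proof.
move=> /gauss_mderiv_sum_le; apply: le_trans.
by rewrite (bigD1 i) //= lerDl sumr_ge0 // => j _; exact: gauss_sqr_ge0.
Qed.

(** Stein's identity applied to [x_i g^2]: the cross term is what both the
    upper and the lower bound for multiplication by a variable control. *)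
Lemma gauss_mulX2 g i :
  gauss (('X_i * g) * ('X_i * g)) =
  gauss (g * g) + 2 * gauss ('X_i * g * mderiv i g).
Proof.
rewrite -mulrA gauss_stein !mderivM mderivX mnm1E eqxx.
rewrite (_ : (U_(i) - U_(i))%MM = 0%MM); last first.
  by apply/mnmP => k; rewrite mnmBE subnn mnm0E.
rewrite scale1r mpolyX0 mul1r !linearD /=.
rewrite (_ : mderiv i g * ('X_i * g) = 'X_i * g * mderiv i g); last by rewrite mulrC.
rewrite mulrDr linearD /= (_ : g * ('X_i * mderiv i g) = 'X_i * g * mderiv i g); last by ring.
by ring.
Qed.

(** With the weight [2 (k + 1)] the derivative part of the cross term in
    [gauss_mulX2] is at most half of the norm of [g] and can be absorbed. *)
Lemma gauss_mulX_ge g i k : (msize g <= k.+1)%N ->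
  gauss (g * g) <= (4 * k + 6)%:R * gauss (('X_i * g) * ('X_i * g)).
Proof.
move=> gk; have := gauss_mulX2 g i.
have := @gauss_cs (2 * k.+1%:R) ('X_i * g) (mderiv i g).
rewrite mulr_gt0 ?ltr0n // => /(_ isT); rewrite invfM.
have := gauss_mderiv_le i gk.
set X := gauss ('X_i * g * ('X_i * g)); set Y := gauss (g * g).
set Z := gauss ('X_i * g * mderiv i g); set D := gauss (mderiv i g * _) => DY cs XY.
have Y0 : 0 <= Y := gauss_sqr_ge0 g.
have D2 : k.+1%:R^-1 * D <= Y.
  rewrite mulrC ler_pdivrMr ?ltr0n //; apply: le_trans DY _.
  by rewrite mulrC ler_wpM2l // ler_nat.
have := ler_norm (- Z); rewrite normrN => ZZ.
rewrite -mulrA in cs.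
have k1 : k.+1%:R = k%:R + 1 :> R by rewrite mulrSr.
rewrite k1 in cs D2.
have : 0 <= gauss ('X_i * g * ('X_i * g)) := gauss_sqr_ge0 _; rewrite -/X => X0.
rewrite natrD natrM; set K : R := k%:R in cs D2 *.
have cs' : 2 * `|Z| <= 2 * (K * X) + 2 * X + 2^-1 * Y.
  apply: le_trans cs _; rewrite -!mulrA -mulrDr.
  by lra.
by lra.
Qed.

(** Now the weight is [1 / 2], so that the absorbed part is half of the left hand
    side. *)
Lemma gauss_mulX_le g i k : (msize g <= k.+1)%N ->
  gauss (('X_i * g) * ('X_i * g)) <= (4 * k + 2)%:R * gauss (g * g).
Proof.
move=> gk; have := gauss_mulX2 g i.
have := @gauss_cs (1 / 2) ('X_i * g) (mderiv i g).
have -> : (1 / 2 : R)^-1 = 2 by field.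
have -> : 0 < 1 / 2 :> R by lra.
move=> /(_ isT).
have := gauss_mderiv_le i gk.
set X := gauss ('X_i * g * ('X_i * g)); set Y := gauss (g * g).
set Z := gauss ('X_i * g * mderiv i g); set D := gauss (mderiv i g * _) => DY cs XY.
have := ler_norm Z; rewrite natrD natrM.
lra.
Qed.

Definition laplace p : {mpoly R[n]} := \sum_i mderiv i (mderiv i p).

Fact laplace_is_linear : linear laplace.
Proof.
move=> c p q; rewrite /laplace scaler_sumr -big_split /=.
by apply: eq_bigr => i _; rewrite !linearP.
Qed.
HB.instance Definition _ :=
  GRing.isLinear.Build R {mpoly R[n]} {mpoly R[n]} _ laplace laplace_is_linear.

Lemma laplace_mderiv i p : laplace (mderiv i p) = mderiv i (laplace p).
Proof.
rewrite /laplace linear_sum /=; apply: eq_bigr => j _.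
by rewrite (mderiv_comm i j) mderiv_comm.
Qed.

Lemma dhomog_msize_le p k : p \is k.-homog for [measure of mdeg] -> (msize p <= k.+1)%N.
Proof.
move=> /dhomogP pk; rewrite msizeE; apply/bigmax_leqP_seq => m mp _.
by rewrite ltnS (pk m mp).
Qed.

Lemma dhomog_mderiv p k i : p \is k.+1.-homog -> mderiv i p \is k.-homog.
Proof.
move=> pk; apply/dhomogP => m; rewrite mcoeff_msupp mcoeff_deriv => H.
have /(dhomog_mf pk) : (m + U_(i))%MM \in msupp p.
  by rewrite mcoeff_msupp; apply: contraNneq H => ->; rewrite mul0rn.
by rewrite /= mdegD mdeg1 addn1 => -[].
Qed.

Lemma dhomog_laplace p k : p \is k.+2.-homog -> laplace p \is k.-homog.
Proof. by move=> pk; apply: rpred_sum => i _; do 2!apply: dhomog_mderiv. Qed.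

Lemma dhomog_euler p k : p \is k.-homog -> \sum_i 'X_i * mderiv i p = k%:R *: p.
Proof.
move=> /dhomogP pk; rewrite [in RHS](mpolyE p) scaler_sumr.
under eq_bigr => i _ do rewrite {1}(mpolyE p) linear_sum mulr_sumr.
rewrite exchange_big /= !big_seq; apply: eq_bigr => m mp.
rewrite -(pk m mp) /= mdegE natr_sum scaler_suml; apply: eq_bigr => i _.
rewrite mderivZ mderivX -!scalerAr.
have [->|mi] := eqVneq (m i) 0%N; first by rewrite !scale0r scaler0.
by rewrite -mpolyXD addmC submK ?lep1mP // !scalerA mulrC.
Qed.

(** Euler's formula and Stein's identity reduce the pairing to pairings of first
    derivatives, which are of the same kind one degree lower; the terms where
    [h] is differentiated twice add up to its Laplacian. *)
Lemma gauss_harmonic_orth k h g : h \is k.-homog -> laplace h = 0 ->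
  (msize g <= k)%N -> gauss (h * g) = 0.
Proof.
elim: k h g => [|k IH] h g hk h0 gk.
  by move: gk; rewrite leqn0 msize_poly_eq0 => /eqP ->; rewrite mulr0 linear0.
have : k.+1%:R * gauss (h * g) = 0.
  rewrite -gaussZ scalerAl -(dhomog_euler hk) mulr_suml linear_sum /=.
  under eq_bigr => i _ do rewrite -mulrA gauss_stein mderivM linearD /=.
  rewrite big_split /= -linear_sum -mulr_suml -/(laplace h) h0 mul0r linear0 add0r.
  apply: big1 => i _; apply: IH; first exact: dhomog_mderiv.
    by rewrite laplace_mderiv h0 linear0.
  exact: msize_mderiv.
by move/eqP; rewrite mulf_eq0 pnatr_eq0 /= => /eqP.
Qed.

(** Dominates the modulus of [p] on the polydisc of radius [r]; unlike a supremum
    it is read off the coefficients, and derivatives do not increase it by more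
    than a change of radius. *)
Definition majorant (r : R) p : R := \sum_(m <- msupp p) `|p@_m| * r ^+ mdeg m.

Lemma majorantE r p k : (msize p <= k)%N ->
  majorant r p = \sum_(m : 'X_{1..n < k}) `|p@_m| * r ^+ mdeg m.
Proof.
move=> le_pk; rewrite /majorant (big_mksub ('X_{1..n < k})) ?msupp_uniq //=; last first.
  by move=> x /msize_mdeg_lt /leq_trans; apply.
by rewrite big_rmcond //= => j /memN_msupp_eq0 ->; rewrite normr0 mul0r.
Qed.

Lemma majorant_ge0 r p : 0 <= r -> 0 <= majorant r p.
Proof. by move=> r0; apply: sumr_ge0 => m _; rewrite mulr_ge0 // exprn_ge0. Qed.

Lemma majorantD r p q : 0 <= r -> majorant r (p + q) <= majorant r p + majorant r q.
Proof.
move=> r0; pose k := maxn (msize (p + q)) (maxn (msize p) (msize q)).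
rewrite !(@majorantE _ _ k) ?leq_max ?leqnn ?orbT // -big_split /=.
apply: ler_sum => m _; rewrite mcoeffD -mulrDl ler_wpM2r ?exprn_ge0 //.
exact: ler_normD.
Qed.

Lemma majorantZ r c p : majorant r (c *: p) = `|c| * majorant r p.
Proof.
pose k := maxn (msize (c *: p)) (msize p).
rewrite !(@majorantE _ _ k) ?leq_max ?leqnn ?orbT // mulr_sumr.
by apply: eq_bigr => m _; rewrite mcoeffZ normrM mulrA.
Qed.

Lemma majorant0 r : majorant r 0 = 0.
Proof. by rewrite -(scale0r 0) majorantZ normr0 mul0r. Qed.

Lemma majorantX r m : majorant r 'X_[m] = r ^+ mdeg m.
Proof. by rewrite /majorant msuppX big_seq1 mcoeffX eqxx normr1 mul1r. Qed.

Lemma majorant_sum r (I : Type) (s : seq I) (F : I -> {mpoly R[n]}) : 0 <= r ->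
  majorant r (\sum_(x <- s) F x) <= \sum_(x <- s) majorant r (F x).
Proof.
move=> r0; elim: s => [|x s IH]; first by rewrite !big_nil majorant0.
by rewrite !big_cons (le_trans (majorantD _ _ r0)) // lerD2l.
Qed.

Lemma majorant_mulX r i p : 0 <= r -> majorant r ('X_i * p) <= r * majorant r p.
Proof.
move=> r0; rewrite {1}[p]mpolyE mulr_sumr; apply: le_trans (majorant_sum _ _ r0) _.
rewrite /majorant mulr_sumr; apply: ler_sum => m _.
rewrite -scalerAr -/(majorant r _) majorantZ -mpolyXD majorantX mdegD mdeg1 add1n exprS.
by rewrite mulrCA.
Qed.

Lemma majorant_homog r p k : p \is k.-homog -> majorant r p = r ^+ k * majorant 1 p.
Proof.
move=> /dhomogP pk; rewrite /majorant mulr_sumr !big_seq; apply: eq_bigr => m mp.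
by rewrite (pk m mp) expr1n mulr1 mulrC.
Qed.

Lemma sqr_sum_le (F : 'I_n -> R) : (\sum_i F i) ^+ 2 <= n%:R * \sum_i F i ^+ 2.
Proof.
have : 0 <= \sum_i \sum_j (F i - F j) ^+ 2.
  by do 2!apply: sumr_ge0 => ? _; exact: sqr_ge0.
set S := \sum_i F i; set Q := \sum_i F i ^+ 2.
have E i : \sum_j (F i - F j) ^+ 2 = n%:R * F i ^+ 2 - 2 * S * F i + Q.
  rewrite (eq_bigr (fun j => F i ^+ 2 - 2 * F i * F j + F j ^+ 2)); last first.
    by move=> j _; ring.
  by rewrite big_split sumrB /= sumr_const card_ord -mulr_sumr -mulr_natl -/S -/Q; ring.
rewrite (eq_bigr _ (fun i _ => E i)) big_split sumrB /= -!mulr_sumr -/S -/Q.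
rewrite sumr_const card_ord -[Q *+ n]mulr_natl.
have -> : n%:R * Q - 2 * S * S + n%:R * Q = 2 * (n%:R * Q) - 2 * S ^+ 2 by ring.
by lra.
Qed.

(** At level [k] a form of degree [k] contributes its derivatives of order [k],
    which are constants; Euler's formula, applied [k] times, bounds the sum of
    the coefficients by them. *)
Lemma majorant_chaos p k : p \is k.-homog ->
  (majorant 1 p * k`!%:R) ^+ 2 <= n%:R ^+ k * chaos k p p.
Proof.
elim: k p => [|k IH] p pk.
  have sp : (msize p <= 1)%N := dhomog_msize_le pk.
  rewrite (msize1_polyC sp) expr0 mul1r /= fact0 mulr1.
  rewrite -[_%:MP]mulr1 mul_mpolyC majorantZ -mpolyX0 majorantX expr1n mulr1.
  by rewrite gaussZ mpolyX0 gauss1 mulr1 real_normK ?num_real.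
rewrite factS natrM mulrA.
have H : majorant 1 p * k.+1%:R <= \sum_i majorant 1 (mderiv i p).
  rewrite mulrC -[k.+1%:R]ger0_norm // -majorantZ -(dhomog_euler pk).
  apply: le_trans (majorant_sum _ _ ler01) _; apply: ler_sum => i _.
  by rewrite (le_trans (majorant_mulX _ _ ler01)) // mul1r.
have H2 : (majorant 1 p * k.+1%:R * k`!%:R) ^+ 2 <=
    (\sum_i majorant 1 (mderiv i p) * k`!%:R) ^+ 2.
  rewrite ler_sqr ?nnegrE ?mulr_ge0 ?majorant_ge0 //.
    by rewrite -mulr_suml ler_wpM2r.
  by apply: sumr_ge0 => i _; rewrite mulr_ge0 ?majorant_ge0.
apply: le_trans H2 _; apply: le_trans (sqr_sum_le _) _.
rewrite exprS -mulrA ler_wpM2l // mulr_sumr /= ler_sum // => i _.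
by apply: IH; exact: dhomog_mderiv.
Qed.

(** The top level is one of the nonnegative terms of the Hermite expansion. *)
Lemma majorant_gauss p k : p \is k.-homog ->
  majorant 1 p ^+ 2 * k`!%:R <= n%:R ^+ k * gauss (p * p).
Proof.
move=> pk; have := majorant_chaos pk; rewrite exprMn expr2 mulrA.
have k0 : 0 < k`!%:R :> R by rewrite ltr0n fact_gt0.
rewrite -ler_pdivlMr // => H; apply: le_trans H _; rewrite -mulrA ler_wpM2l ?exprn_ge0 //.
rewrite (gauss_parseval (N := k.+1)) ?dhomog_msize_le // big_ord_recr /= lerDr.
by apply: sumr_ge0 => i _; rewrite divr_ge0 ?chaos_ge0.
Qed.

Lemma gauss_eq0 p k : p \is k.-homog -> gauss (p * p) <= 0 -> p = 0.
Proof.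
move=> pk p0; have : majorant 1 p ^+ 2 * k`!%:R <= 0.
  apply: le_trans (majorant_gauss pk) _; rewrite mulr_ge0_le0 ?exprn_ge0 //.
rewrite pmulr_lle0 ?ltr0n ?fact_gt0 // => H.
have M0 : majorant 1 p = 0.
  by apply/eqP; rewrite -sqrf_eq0 eq_le H sqr_ge0.
apply/mpolyP => m; rewrite mcoeff0; case: (boolP (m \in msupp p)) => [mp|/memN_msupp_eq0 //].
have : \sum_(m <- msupp p) `|p@_m| * 1 ^+ mdeg m == 0 by rewrite -/(majorant 1 p) M0.
rewrite psumr_eq0 => [/allP /(_ m mp)|i _]; last by rewrite expr1n mulr1.
by rewrite expr1n mulr1 normr_eq0 /= => /eqP.
Qed.

End GaussIneq.

(** * Splitting off a harmonic form *)

Section GaussNorm.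
Variables (n : nat) (R : rcfType).
Implicit Types (p q f g h : {mpoly R[n]}) (i j : 'I_n) (m : 'X_{1..n}).

Definition gnorm p : R := Num.sqrt (gauss (p * p)).

Lemma gnorm_ge0 p : 0 <= gnorm p. Proof. exact: sqrtr_ge0. Qed.

Lemma sqr_gnorm p : gnorm p ^+ 2 = gauss (p * p).
Proof. by rewrite sqr_sqrtr // gauss_sqr_ge0. Qed.

Lemma le_of_sqr (x y : R) : 0 <= y -> x ^+ 2 <= y ^+ 2 -> x <= y.
Proof.
move=> y0 xy; case: (lerP 0 x) => x0; last by apply: le_trans y0; exact: ltW.
by rewrite -ler_sqr.
Qed.

Lemma gnormZ c p : gnorm (c *: p) = `|c| * gnorm p.
Proof.
apply/eqP; rewrite -(@eqrXn2 _ 2) ?mulr_ge0 ?gnorm_ge0 // exprMn !sqr_gnorm.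
by rewrite -scalerAl -scalerAr !gaussZ mulrA real_normK ?num_real // expr2.
Qed.


Lemma gauss_add_le p q :
  gauss ((p + q) * (p + q)) <= 2 * gauss (p * p) + 2 * gauss (q * q).
Proof.
have := gauss_expand 1 1 p q; rewrite !scale1r => ->.
have := gauss_expand 1 (-1) p q; rewrite scale1r scaleN1r => H.
have := gauss_sqr_ge0 (p - q); rewrite H sqrrN expr1n; lra.
Qed.

Lemma gauss_sum_le (F : 'I_n -> {mpoly R[n]}) :
  gauss ((\sum_i F i) * (\sum_i F i)) <= n%:R * \sum_i gauss (F i * F i).
Proof.
have : 0 <= \sum_i \sum_j gauss ((F i - F j) * (F i - F j)).
  by do 2!apply: sumr_ge0 => ? _; exact: gauss_sqr_ge0.
set S := \sum_i F i; set Q := \sum_i gauss (F i * F i).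
have E i : \sum_j gauss ((F i - F j) * (F i - F j)) =
    n%:R * gauss (F i * F i) - 2 * gauss (S * F i) + Q.
  rewrite (eq_bigr (fun j => gauss (F i * F i) - 2 * gauss (F j * F i) + gauss (F j * F j))).
    rewrite big_split sumrB /= sumr_const card_ord -mulr_sumr -[_ *+ n]mulr_natl -/Q.
    by rewrite -(linear_sum (@gauss n R)) -mulr_suml -/S.
  move=> j _; have -> : (F i - F j) * (F i - F j) = F i * F i - 2%:R *: (F j * F i) + F j * F j.
    by rewrite -mul_mpolyC mpolyC_nat; ring.
  by rewrite linearD linearB /= gaussZ.
rewrite (eq_bigr _ (fun i _ => E i)) big_split sumrB /= -!mulr_sumr -/Q.
rewrite -(linear_sum (@gauss n R)) -mulr_sumr -/S sumr_const card_ord -[Q *+ n]mulr_natl.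
lra.
Qed.

Lemma majorant_gnorm p k (B : R) : p \is k.-homog -> 0 <= B -> gnorm p <= B ->
  majorant 1 p * Num.sqrt k`!%:R <= n%:R ^+ k * B.
Proof.
move=> pk B0 pB; apply: le_of_sqr; first by rewrite mulr_ge0 // exprn_ge0.
rewrite exprMn sqr_sqrtr // (le_trans (majorant_gauss pk)) // -sqr_gnorm exprMn.
apply: ler_pM; rewrite ?exprn_ge0 ?gnorm_ge0 //; last by rewrite lerXn2r ?nnegrE ?gnorm_ge0.
case: n => [|n']; first by case: k pk => [|k] _; rewrite ?expr1n // !exprS !mul0r.
by rewrite expr2 ler_peMr ?exprn_ge0 // exprn_ege1 // ler1n.
Qed.

Definition sumsq (a : 'I_n -> R) : {mpoly R[n]} :=
  \sum_i a i ^+ 2 *: ('X_i * 'X_i).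

Lemma dhomog_sumsq a : sumsq a \is 2.-homog.
Proof.
apply: rpred_sum => i _; apply: rpredZ; rewrite -[2%N]/(1 + 1)%N.
by apply: dhomogM; rewrite dhomogX /= mdeg1.
Qed.

(** One nonzero [a i] suffices: the other terms are nonnegative.  This is where
    nonhyperbolicity of the quadratic enters. *)
Lemma gauss_sumsq_ge a i g :
  a i ^+ 2 * gauss (('X_i * g) * ('X_i * g)) <= gauss (sumsq a * g * g).
Proof.
have -> : gauss (sumsq a * g * g) =
   \sum_j a j ^+ 2 * gauss (('X_j * g) * ('X_j * g)).
  rewrite /sumsq !mulr_suml linear_sum /=; apply: eq_bigr => j _.
  by rewrite -gaussZ -!scalerAl; congr (gauss (_ *: _)); ring.
rewrite (bigD1 i) //= lerDl; apply: sumr_ge0 => j _.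
by rewrite mulr_ge0 ?sqr_ge0 ?gauss_sqr_ge0.
Qed.

Lemma gauss_mul_linear_le (b : 'I_n -> R) g k : (msize g <= k.+1)%N ->
  gauss (((\sum_i b i *: 'X_i) * g) * ((\sum_i b i *: 'X_i) * g)) <=
   (n%:R * \sum_i b i ^+ 2) * (4 * k + 2)%:R * gauss (g * g).
Proof.
move=> gk; rewrite mulr_suml; apply: le_trans (gauss_sum_le _) _.
rewrite -!mulrA ler_wpM2l // mulr_suml ler_sum // => i _.
rewrite -!scalerAl -scalerAr !gaussZ mulrA -expr2 ler_wpM2l ?sqr_ge0 //.
exact: gauss_mulX_le.
Qed.

Lemma gauss_mul_sumsq_le (a : 'I_n -> R) g k : (msize g <= k.+1)%N ->
  gauss ((sumsq a * g) * (sumsq a * g)) <=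
   (n%:R * \sum_i a i ^+ 4) * ((4 * k + 6)%:R * (4 * k + 2)%:R) * gauss (g * g).
Proof.
move=> gk; rewrite mulr_suml; apply: le_trans (gauss_sum_le _) _.
rewrite -[leRHS]mulrA -[leRHS]mulrA ler_wpM2l // mulr_suml ler_sum // => i _.
rewrite -!scalerAl -scalerAr !gaussZ [leLHS]mulrA -exprD ler_wpM2l //.
  by rewrite (exprM _ 2 2) sqr_ge0.
rewrite -(mulrA 'X_i 'X_i g); apply: le_trans (@gauss_mulX_le _ _ _ i k.+1 _) _.
  exact: msize_mulX.
rewrite (_ : 4 * k.+1 + 2 = 4 * k + 6)%N; last by lia.
by rewrite -[leRHS]mulrA ler_wpM2l // gauss_mulX_le.
Qed.

End GaussNorm.

(** The forms of degree [k] are a finite dimensional space. *)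
Lemma homog_inj_surj (n : nat) (R : rcfType)
    (phi : {linear {mpoly R[n.+1]} -> {mpoly R[n.+1]}}) k :
  (forall g, g \is k.-homog -> phi g \is k.-homog) ->
  (forall g, g \is k.-homog -> phi g = 0 -> g = 0) ->
  forall f, f \is k.-homog -> exists2 g, g \is k.-homog & phi g = f.
Proof.
move=> phik phi0 f fk.
pose psi (g : dhomog n.+1 R k) : dhomog n.+1 R k := DHomog (phik _ (dhomog_is_dhomog g)).
have psi_lin : linear psi by move=> c u v; apply: val_inj; rewrite /= linearP.
pose M := GRing.isLinear.Build R _ _ _ psi psi_lin.
pose Psi : {linear dhomog n.+1 R k -> dhomog n.+1 R k} := HB.pack psi M.
have ker0 : lker (linfun Psi) == 0%VS.
  apply/lker0P => u v; rewrite !lfunE /= => /eqP; rewrite -subr_eq0 -(linearB Psi) => /eqP uv.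
  apply/eqP; rewrite -subr_eq0; apply/eqP/val_inj => /=.
  by apply: (phi0 (val (u - v))); [exact: dhomog_is_dhomog | exact: (congr1 val uv)].
have /memv_imgP[g _ gf] : DHomog fk \in limg (linfun Psi).
  by rewrite lker0_limgf // memvf.
exists (val g); first exact: dhomog_is_dhomog.
by move: gf; rewrite lfunE => /(congr1 val) /= ->.
Qed.

(** Fischer's decomposition.  With [P = sumsq a], the map [g -> laplace (P * g)]
    is injective on forms of degree [k]: if [P * g] is harmonic then it is
    orthogonal to [g], and the pairing of [P * g] with [g] controls the norm of
    [g].  So it is onto, and [laplace f] is attained.  For the resulting [g] the
    same pairing equals that of [f] with [g], whence the bound. *)
Lemma harmonic_split (n : nat) (R : rcfType) (a : 'I_n.+1 -> R) i0 : a i0 != 0 ->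
  exists2 C : R, 0 <= C & forall k (f : {mpoly R[n.+1]}), f \is k.+2.-homog ->
    exists g, [/\ g \is k.-homog, laplace (f - sumsq a * g) = 0 &
      gauss (g * g) <= C * k.+2%:R ^+ 2 * gauss (f * f)].
Proof.
move=> a0; have a20 : 0 < a i0 ^+ 2 by rewrite exprn_even_gt0.
exists ((4 / a i0 ^+ 2) ^+ 2) => [|k f fk]; first exact: sqr_ge0.
have sqk (g : {mpoly R[n.+1]}) : g \is k.-homog -> sumsq a * g \is k.+2.-homog.
  by move=> gk; rewrite -add2n dhomogM // dhomog_sumsq.
have posit (g : {mpoly R[n.+1]}) : g \is k.-homog ->
    gauss (g * g) <= (4 * k + 6)%:R / a i0 ^+ 2 * gauss (sumsq a * g * g).
  move=> gk; apply: le_trans (gauss_mulX_ge i0 (dhomog_msize_le gk)) _.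
  rewrite -[leRHS]mulrA ler_wpM2l // [leRHS]mulrC ler_pdivlMr // [leLHS]mulrC.
  exact: gauss_sumsq_ge.
pose phi (g : {mpoly R[n.+1]}) := laplace (sumsq a * g).
have phi_lin : linear phi.
  by move=> c u v; rewrite /phi mulrDr -scalerAr linearP.
pose M := GRing.isLinear.Build R _ _ _ phi phi_lin.
pose Phi : {linear {mpoly R[n.+1]} -> {mpoly R[n.+1]}} := HB.pack phi M.
have [g gk gf] : exists2 g, g \is k.-homog & Phi g = laplace f.
  apply: homog_inj_surj; last exact: dhomog_laplace.
    by move=> g gk; apply/dhomog_laplace/sqk.
  move=> g gk /= g0; apply: (gauss_eq0 gk); apply: le_trans (posit g gk) _.
  rewrite (gauss_harmonic_orth (sqk g gk)) ?mulr0 //.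
  by apply: leq_trans (dhomog_msize_le gk) _.
exists g; split=> //; first by rewrite linearB /=; apply/eqP; rewrite subr_eq0 -gf.
have hk : f - sumsq a * g \is k.+2.-homog by rewrite rpredB // sqk.
have h0 : laplace (f - sumsq a * g) = 0.
  by rewrite linearB /=; apply/eqP; rewrite subr_eq0 -gf.
(* [f - P g] is harmonic of degree higher than [g], hence orthogonal to it *)
have fg : gauss (sumsq a * g * g) = gauss (f * g).
  have := gauss_harmonic_orth hk h0 (leq_trans (dhomog_msize_le gk) (leqnSn _)).
  by rewrite mulrBl linearB /= => /eqP; rewrite subr_eq0 => /eqP.
have := posit g gk; rewrite fg; move ET : (_ / a i0 ^+ 2) => T H.
have T0 : 0 < T by rewrite -ET divr_gt0 // ltr0n addn_gt0 orbT.
have := gauss_cs f g T0 => cs.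
have : gauss (g * g) <= T ^+ 2 * gauss (f * f).
  have := ler_norm (gauss (f * g)) => H2.
  have H3 : T * (2 * gauss (f * g)) <= T * (T * gauss (f * f) + T^-1 * gauss (g * g)).
    by rewrite ler_pM2l //; lra.
  have : T * (T * gauss (f * f) + T^-1 * gauss (g * g)) = T ^+ 2 * gauss (f * f) + gauss (g * g).
    by rewrite mulrDr !(mulrA T) divff ?mul1r ?gt_eqF // expr2.
  lra.
move=> /le_trans; apply; rewrite ler_wpM2r ?gauss_sqr_ge0 // -exprMn.
have aV0 : 0 <= 4 / a i0 ^+ 2 * k.+2%:R by rewrite mulr_ge0 // divr_ge0 // ltW.
rewrite lerXn2r ?nnegrE ?(ltW T0) //.
by rewrite -ET mulrAC ler_pM2r ?invr_gt0 // -natrM ler_nat; lia.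
Qed.

(** * Harmonic substitutes of monomials *)

Definition mquadratic (n : nat) (R : rcfType) (a b : 'I_n -> R) (c : R) : {mpoly R[n]} :=
  sumsq a + \sum_i b i *: 'X_i + c%:MP.

Lemma ge1_expr_id (R : rcfType) (x : R) k : 1 <= x -> (0 < k)%N -> x <= x ^+ k.
Proof.
by case: k => // k x1 _; rewrite exprS ler_peMr ?exprn_ege1 // (le_trans ler01).
Qed.

(** Modulo the quadratic, [f = h + P g] equals [h - L g - c g] with [L] the linear
    part, so [H] is [h] minus the harmonic polynomials of the forms [L g] and
    [c g] of degrees [k - 1] and [k - 2].  The weight [sqrt k!] turns the drop of
    degree into a factor [sqrt k], respectively [sqrt (k (k - 1))]; together with
    [|g| <= C k |f|] and the cost [sqrt k] of multiplying by [L], both lower order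
    parts cost [k ^ 2].  The part [L g] gains one factor [D S], which has to beat
    [k ^ 2], hence [e = 2]; the part [c g] gains two, for which [S >= k] is
    enough. *)
Lemma harmonic_decomposition (n : nat) (R : rcfType)
    (a b : 'I_n.+1 -> R) (c : R) (e : nat) :
  (exists i, a i != 0) -> e = 2 \/ (e = 1 /\ forall i, b i = 0) ->
  exists2 D : R, 1 <= D & forall k (f : {mpoly R[n.+1]}), f \is k.-homog ->
    exists H, [/\ laplace H = 0, exists Q, f - H = mquadratic a b c * Q &
      forall r S : R, 0 <= r -> r <= S -> 1 <= S -> (k ^ e)%:R <= S ->
        majorant r H * Num.sqrt k`!%:R <= gnorm f * (D * S) ^+ k].
Proof.
move=> [i0 a0] be; have [C C0 split] := harmonic_split a0.
have [C2 EC2] : exists x : R, x = n.+1%:R * \sum_i a i ^+ 4 by eexists.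
have [C1 EC1] : exists x : R, x = n.+1%:R * \sum_i b i ^+ 2 by eexists.
have C20 : 0 <= C2.
  by rewrite EC2 mulr_ge0 // sumr_ge0 // => i _; rewrite (exprM _ 2 2) sqr_ge0.
have C10 : 0 <= C1 by rewrite EC1 mulr_ge0 // sumr_ge0 // => i _; exact: sqr_ge0.
have [K1 EK1] : exists x : R, x = 2 + 32 * C2 * C by eexists.
have [K2 EK2] : exists x : R, x = 1 + 4 * C1 * C by eexists.
have [K3 EK3] : exists x : R, x = `|c| * (1 + C) by eexists.
have K10 : 2 <= K1 by rewrite EK1 lerDl !mulr_ge0.
have K20 : 1 <= K2 by rewrite EK2 lerDl !mulr_ge0.
have K30 : 0 <= K3 by rewrite EK3 mulr_ge0 // addr_ge0.
have [N EN] : exists x : R, x = n.+1%:R by eexists.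
have K1p : 0 <= K1 by apply: le_trans K10.
have K2p : 0 <= K2 by apply: le_trans K20.
have N1 : 1 <= N by rewrite EN ler1n.
have NK1 : 1 <= N * K1 by rewrite mulr_ege1 //; lra.
(* [D] is chosen so that [h], [H1] and [H2] each get a third of the bound *)
have [D ED] : exists x : R, x = 12 * (N * K1) + 3 * K2 + 3 * K3 by eexists.
have D1 : 1 <= D by rewrite ED; lra.
exists D => // k; elim/ltn_ind: k => k IH f fk.
have N0 : 0 <= N by lra.
have K2D : 3 * K2 <= D by rewrite ED; lra.
have K3D : 3 * K3 <= D by rewrite ED; lra.
have DN : 4 * N * (3 * K1) <= D by rewrite ED; lra.
have F0 := gnorm_ge0 f.
case: k => [|[|m]] in IH fk *.
- exists f; split; first by rewrite /laplace big1 // => i _; rewrite [f]msize1_polyC ?dhomog_msize_le // !mderivC.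
    by exists 0; rewrite subrr mulr0.
  move=> r S r0 rS S1 _; have := majorant_gnorm fk F0 (lexx _).
  by rewrite [majorant r _](majorant_homog _ fk) !expr0 !mul1r mulr1.
- exists f; split.
  + rewrite /laplace big1 // => i _.
    have /msize1_polyC -> : (msize (mderiv i f) <= 1)%N.
      by apply/msize_mderiv/dhomog_msize_le.
    by rewrite mderivC.
  + by exists 0; rewrite subrr mulr0.
  move=> r S r0 rS S1 _; have := majorant_gnorm fk F0 (lexx _).
  rewrite [majorant r _](majorant_homog _ fk) -mulrA => H.
  apply: le_trans (ler_wpM2l (exprn_ge0 _ r0) H) _.
  rewrite !expr1 -EN [leRHS]mulrC mulrA ler_wpM2r // [leLHS]mulrC ler_pM //.
  have : N <= N * K1 by rewrite ler_peMr //; lra.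
  by rewrite ED; lra.
have [g [gk h0 gle]] := split m f fk.
have [h Eh] : exists h, h = f - sumsq a * g by eexists.
rewrite -Eh in h0.
have [k Ek] : exists x : R, x = m.+2%:R by eexists.
rewrite -Ek in gle.
have k1 : 1 <= k by rewrite Ek ler1n.
have hk : h \is m.+2.-homog.
  by rewrite Eh rpredB // -add2n dhomogM // dhomog_sumsq.
have gm := dhomog_msize_le gk.
set g1 := (\sum_i b i *: 'X_i) * g.
have g1k : g1 \is m.+1.-homog.
  rewrite -[m.+1]add1n dhomogM // rpred_sum // => i _.
  by rewrite rpredZ // dhomogX /= mdeg1.
set g2 := c *: g.
have g2k : g2 \is m.-homog by rewrite rpredZ.
have [H1 [H10 [Q1 HQ1] H1le]] := IH m.+1 (ltnSn _) g1 g1k.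
have [H2 [H20 [Q2 HQ2] H2le]] := IH m (leqnSn _) g2 g2k.
exists (h - H1 - H2); split.
- by rewrite !linearB /= h0 H10 H20 !subr0.
- exists (g - Q1 - Q2); rewrite !mulrBr -HQ1 -HQ2 Eh /g1 /g2 /mquadratic.
  by rewrite -mul_mpolyC; ring.
move=> r S r0 rS S1 kS.
have S0 : 0 <= S := le_trans ler01 S1.
have D0 : 0 <= D := le_trans ler01 D1.
have k0 : 0 <= k := le_trans ler01 k1.
have K11 : 1 <= K1 by apply: le_trans K10; rewrite ler1n.
have X0 : 0 <= D * S by rewrite mulr_ge0.
have e0 : (0 < e)%N by case: be => [->|[->]].
have kS' : k <= S.
  by apply: le_trans kS; rewrite Ek ler_nat -[X in (X <= _)%N]expn1 leq_exp2l.
have mS (j : nat) : (j <= m.+2)%N -> (j ^ e)%:R <= S.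
  by move=> jm; apply: le_trans kS; rewrite ler_nat leq_exp2r.
have F2 : gauss (f * f) = gnorm f ^+ 2 by rewrite sqr_gnorm.
have sqm (j : nat) : Num.sqrt (j.+1`!%:R : R) = Num.sqrt j.+1%:R * Num.sqrt j`!%:R.
  by rewrite factS natrM sqrtrM.
have sq0 (j : nat) : 0 <= Num.sqrt (j%:R : R) by exact: sqrtr_ge0.
have part_h : majorant r h * Num.sqrt m.+2`!%:R <= gnorm f * (D * S) ^+ m.+2 / 3.
  have hle : gnorm h <= K1 * k ^+ 2 * gnorm f.
    apply: le_of_sqr; first by rewrite !mulr_ge0 // exprn_ge0.
    rewrite sqr_gnorm; apply: (@le_trans _ _ (2 * gauss (f * f) + 2 * gauss (sumsq a * g * (sumsq a * g)))).
      by have := gauss_add_le f (- (sumsq a * g)); rewrite mulrNN Eh.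
    have := gauss_mul_sumsq_le a gm; rewrite -EC2 => le2.
    have le3 : (4 * m + 6)%:R * (4 * m + 2)%:R <= 16 * k ^+ 2 :> R.
      have -> : 16 * k ^+ 2 = (4 * m.+2)%:R * (4 * m.+2)%:R by rewrite natrM -Ek; ring.
      by rewrite ler_pM // ler_nat; clear; lia.
    have le4 : gauss (sumsq a * g * (sumsq a * g)) <= C2 * (16 * k ^+ 2) * (C * k ^+ 2 * gauss (f * f)).
      apply: le_trans le2 _; apply: ler_pM => //.
      - by rewrite !mulr_ge0.
      - exact: gauss_sqr_ge0.
      - by rewrite ler_wpM2l.
    have le5 : 1 <= k ^+ 2 * k ^+ 2 by rewrite -exprD exprn_ege1.
    have := gauss_sqr_ge0 f => f0.
    have -> : (K1 * k ^+ 2 * gnorm f) ^+ 2 = K1 ^+ 2 * (k ^+ 2 * k ^+ 2 * gauss (f * f)).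
      by rewrite F2; ring.
    have fle : gauss (f * f) <= k ^+ 2 * k ^+ 2 * gauss (f * f) by rewrite ler_peMl.
    apply: (@le_trans _ _ (K1 * (k ^+ 2 * k ^+ 2 * gauss (f * f)))).
      rewrite EK1; move: le4; set U := k ^+ 2 * k ^+ 2 * gauss (f * f) in fle *.
      have -> : C2 * (16 * k ^+ 2) * (C * k ^+ 2 * gauss (f * f)) = 16 * C2 * C * U.
        by rewrite /U; ring.
      move: U fle => U fle {}le4; clear - le4 fle; lra.
    rewrite ler_wpM2r //; first by rewrite !mulr_ge0 // exprn_ge0.
    by rewrite expr2 ler_peMl.
  have Bge : 0 <= K1 * k ^+ 2 * gnorm f by rewrite !mulr_ge0 // exprn_ge0.
  have H := majorant_gnorm hk Bge hle; rewrite -EN in H.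
  rewrite [majorant r _](majorant_homog _ hk) -[leLHS]mulrA.
  apply: le_trans (ler_wpM2l (exprn_ge0 _ r0) H) _.
  have k4 : k ^+ 2 <= 4 ^+ m.+2.
    rewrite Ek -!natrX ler_nat (_ : 4 ^ m.+2 = (2 ^ m.+2) ^ 2)%N; last by rewrite -expnM mulnC expnM.
    by rewrite leq_exp2r // ltnW // ltn_expl.
  have DD : 4 ^+ m.+2 * N ^+ m.+2 * (3 * K1) <= D ^+ m.+2.
    apply: (@le_trans _ _ ((4 * N * (3 * K1)) ^+ m.+2)).
      rewrite [leRHS]exprMn [(4 * N) ^+ _]exprMn; apply: ler_wpM2l.
        by apply: mulr_ge0; apply: exprn_ge0.
      by rewrite ge1_expr_id //; clear - K11; lra.
    by rewrite lerXn2r ?nnegrE // !mulr_ge0.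
  rewrite [(D * S) ^+ _]exprMn [leLHS]mulrA; move: (gnorm f) F0 => G G0.
  have -> : r ^+ m.+2 * N ^+ m.+2 * (K1 * k ^+ 2 * G) =
     (k ^+ 2 * N ^+ m.+2 * (3 * K1)) * r ^+ m.+2 * (G / 3) by field.
  rewrite [leRHS](_ : _ = D ^+ m.+2 * S ^+ m.+2 * (G / 3)); last by ring.
  rewrite ler_wpM2r ?divr_ge0 //.
  apply: ler_pM; [|exact: exprn_ge0| |by rewrite lerXn2r].
    by apply: mulr_ge0; [apply: mulr_ge0; apply: exprn_ge0|apply: mulr_ge0].
  apply: le_trans DD; apply: ler_wpM2r; first exact: mulr_ge0.
  by apply: ler_wpM2r => //; apply: exprn_ge0.
have part_1 : majorant r H1 * Num.sqrt m.+2`!%:R <= gnorm f * (D * S) ^+ m.+2 / 3.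
  have le1 : gnorm g1 * Num.sqrt k <= K2 * S * gnorm f.
    have bS : b =1 (fun=> 0) \/ k ^+ 2 <= S.
      case: be => [e2|[_ b0]]; [right|by left].
      by apply: le_trans kS; rewrite Ek e2 natrX.
    case: bS => [b0|kS2].
      rewrite /g1 big1 => [|i _]; last by rewrite b0 scale0r.
      by rewrite mul0r /gnorm mul0r linear0 sqrtr0 mul0r !mulr_ge0.
    apply: (@le_trans _ _ (K2 * k ^+ 2 * gnorm f)); last first.
      by rewrite ler_wpM2r // ler_wpM2l.
    apply: le_of_sqr; first by rewrite !mulr_ge0 // exprn_ge0.
    rewrite exprMn sqr_gnorm sqr_sqrtr //.
    have := gauss_mul_linear_le b gm; rewrite -/g1 -EC1 => le2.
    have le3 : (4 * m + 2)%:R <= 4 * k by rewrite Ek -natrM ler_nat; clear; lia.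
    have le4 : gauss (g1 * g1) <= C1 * (4 * k) * (C * k ^+ 2 * gauss (f * f)).
      apply: le_trans le2 _; apply: ler_pM => //.
      - by rewrite !mulr_ge0.
      - exact: gauss_sqr_ge0.
      - by rewrite ler_wpM2l.
    have -> : (K2 * k ^+ 2 * gnorm f) ^+ 2 = K2 ^+ 2 * (k ^+ 2 * k ^+ 2 * gauss (f * f)).
      by rewrite F2; ring.
    have := gauss_sqr_ge0 f => f0.
    apply: (@le_trans _ _ (4 * C1 * C * (k ^+ 2 * k ^+ 2 * gauss (f * f)))).
      have -> : 4 * C1 * C * (k ^+ 2 * k ^+ 2 * gauss (f * f)) =
         C1 * (4 * k) * (C * k ^+ 2 * gauss (f * f)) * k by ring.
      by rewrite ler_wpM2r.
    rewrite ler_wpM2r //; first by rewrite !mulr_ge0 // exprn_ge0.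
    apply: (@le_trans _ _ K2); first by rewrite EK2 lerDr.
    by rewrite expr2 ler_peMl.
  have := H1le r S r0 rS S1 (mS _ (leqnSn _)) => le2.
  rewrite sqm mulrCA.
  apply: le_trans (ler_wpM2l (sq0 _) le2) _.
  
  rewrite mulrA -Ek [Num.sqrt k * _]mulrC.
  apply: (@le_trans _ _ (K2 * S * gnorm f * (D * S) ^+ m.+1)).
    by rewrite ler_wpM2r // exprn_ge0.
  rewrite [leRHS](_ : _ = (D * S) * gnorm f * (D * S) ^+ m.+1 / 3); last by rewrite exprS; ring.
  rewrite ler_pdivlMr // mulrC !mulrA ler_wpM2r ?exprn_ge0 // ler_wpM2r // ler_wpM2r //.
have part_2 : majorant r H2 * Num.sqrt m.+2`!%:R <= gnorm f * (D * S) ^+ m.+2 / 3.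
  have le1 : gnorm g2 <= K3 * k * gnorm f.
    rewrite gnormZ EK3 -!mulrA ler_wpM2l //.
    apply: le_of_sqr; first by rewrite !mulr_ge0 // addr_ge0.
    rewrite sqr_gnorm; apply: le_trans gle _; rewrite F2.
    have -> : ((1 + C) * (k * gnorm f)) ^+ 2 = (1 + C) ^+ 2 * k ^+ 2 * gnorm f ^+ 2 by ring.
    do 2!(rewrite ler_wpM2r ?sqr_ge0 //).
    by rewrite sqrrD expr1n mul1r -mulr_natl; have := sqr_ge0 C; clear - C0; lra.
  have := H2le r S r0 rS S1 (mS _ (ltnW (leqnSn _))) => le2.
  have le3 : Num.sqrt m.+2%:R * Num.sqrt m.+1%:R <= k.
    apply: le_of_sqr => //.
    rewrite exprMn !sqr_sqrtr // -Ek expr2 ler_wpM2l //.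
    by rewrite Ek ler_nat.
  have sk0 : 0 <= Num.sqrt m.+2%:R * Num.sqrt m.+1%:R :> R by rewrite mulr_ge0.
  have M0 : 0 <= majorant r H2 * Num.sqrt m`!%:R by rewrite mulr_ge0 ?majorant_ge0.
  have -> : majorant r H2 * Num.sqrt m.+2`!%:R =
    (Num.sqrt m.+2%:R * Num.sqrt m.+1%:R) * (majorant r H2 * Num.sqrt m`!%:R).
    by rewrite !sqm; ring.
  have X0m := exprn_ge0 m X0.
  apply: le_trans (ler_pM sk0 M0 le3 le2) _.
  apply: (@le_trans _ _ (k * (K3 * k * gnorm f * (D * S) ^+ m))).
    by rewrite ler_wpM2l // ler_wpM2r.
  have -> : k * (K3 * k * gnorm f * (D * S) ^+ m) = K3 * (k * k) * (gnorm f * (D * S) ^+ m) by ring.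
  have -> : gnorm f * (D * S) ^+ m.+2 / 3 = D * D / 3 * (S * S) * (gnorm f * (D * S) ^+ m).
    by rewrite !exprS; ring.
  apply: ler_wpM2r; first by rewrite mulr_ge0.
  apply: ler_pM => //; [exact: mulr_ge0| |exact: ler_pM].
  rewrite ler_pdivlMr // mulrC; apply: le_trans K3D _.
  by rewrite ler_peMl.
have majN p : majorant r (- p) = majorant r p.
  by rewrite -scaleN1r majorantZ normrN1 mul1r.
have sq2 := sq0 m.+2`!.
apply: (@le_trans _ _ ((majorant r h + majorant r H1 + majorant r H2) * Num.sqrt m.+2`!%:R)).
  apply: ler_wpM2r => //.
  apply: le_trans (majorantD _ _ r0) _; rewrite majN lerD2r.
  by apply: le_trans (majorantD _ _ r0) _; rewrite majN.
rewrite !mulrDl; clear - part_h part_1 part_2; lra.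
Qed.

(** Each variable costs at most [4 (d + 1)] by [gauss_mulX_le]. *)
Lemma gauss_monomial_le (n : nat) (R : rcfType) (m : 'X_{1..n}) :
  gauss ('X_[m] * 'X_[m] : {mpoly R[n]}) <= 4 ^+ mdeg m * (mdeg m)`!%:R.
Proof.
move Ed : (mdeg m) => d; elim: d m Ed => [|d IHd] m Ed.
  by move/eqP: Ed; rewrite mdeg_eq0 => /eqP ->; rewrite mpolyX0 mulr1 gauss1 mulr1.
have [i [m' [Em dm']]] := multinom_peel Ed.
rewrite Em mpolyXD; apply: le_trans (@gauss_mulX_le _ _ _ i d _) _.
  by rewrite msizeX dm'.
apply: le_trans (ler_wpM2l (ler0n _ _) (IHd _ dm')) _.
have -> : 4 ^+ d.+1 * d.+1`!%:R = (4 * d.+1%:R) * 4 ^+ d * d`!%:R :> R.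
  by rewrite exprS factS natrM; ring.
rewrite mulrA.
apply: ler_wpM2r => //; apply: ler_wpM2r; first exact: exprn_ge0.
by rewrite -natrM ler_nat; clear; lia.
Qed.

(** The factorial of the monomial's norm cancels the weight [sqrt k!] in
    [harmonic_decomposition]; only a power of [2] is left. *)
Lemma harmonic_monomial (n : nat) (R : rcfType)
    (a b : 'I_n.+1 -> R) (c : R) (e : nat) :
  (exists i, a i != 0) -> e = 2 \/ (e = 1 /\ forall i, b i = 0) ->
  exists2 D : R, 1 <= D & forall m : 'X_{1..n.+1},
    exists H : {mpoly R[n.+1]},
      [/\ laplace H = 0, exists Q, 'X_[m] - H = mquadratic a b c * Q &
      forall r S : R, 0 <= r -> r <= S -> 1 <= S -> (mdeg m ^ e)%:R <= S ->
        majorant r H <= (D * S) ^+ mdeg m].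
Proof.
move=> a0 be; have [D D1 dec] := harmonic_decomposition c a0 be.
exists (2 * D) => [|m]; first by lra.
have Xm : ('X_[m] : {mpoly R[n.+1]}) \is (mdeg m).-homog by rewrite dhomogX.
have [H [H0 HQ Hle]] := dec _ _ Xm; exists H; split=> // r S r0 rS S1 mS.
have s0 : 0 < Num.sqrt ((mdeg m)`!%:R : R) by rewrite sqrtr_gt0 ltr0n fact_gt0.
rewrite -(ler_pM2r s0); apply: le_trans (Hle r S r0 rS S1 mS) _.
rewrite -(mulrA 2) [(2 * _) ^+ _]exprMn [leRHS]mulrAC ler_wpM2r ?exprn_ge0 //.
  by rewrite mulr_ge0 // (le_trans ler01).
apply: le_of_sqr; first by rewrite mulr_ge0 ?exprn_ge0 // ltW.
rewrite sqr_gnorm exprMn sqr_sqrtr //; apply: le_trans (gauss_monomial_le _ _) _.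
by rewrite -exprM mulnC exprM (_ : 2 ^+ 2 = 4 :> R) // -natrX.
Qed.

(** * Values of real polynomials at complex points *)

Section Evaluation.
Variables (n : nat) (R : rcfType).
Implicit Types (p q : {mpoly R[n]}) (i j : 'I_n) (m : 'X_{1..n}) (z w : 'I_n -> R[i]).

Definition ceval z p : R[i] := mmap (real_complex R) z p.

Lemma cevalD z p q : ceval z (p + q) = ceval z p + ceval z q.
Proof. exact: mmapD. Qed.

Lemma cevalB z p q : ceval z (p - q) = ceval z p - ceval z q.
Proof. exact: mmapB. Qed.

Lemma ceval0 z : ceval z 0 = 0.
Proof. exact: mmap0. Qed.

Lemma cevalZ z (c : R) p : ceval z (c *: p) = c%:C * ceval z p.
Proof. exact: mmapZ. Qed.

Lemma cevalM z p q : ceval z (p * q) = ceval z p * ceval z q.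
Proof. by rewrite /ceval; case: (mmap_is_multiplicative z (real_complex R)) => ->. Qed.

Lemma cevalC z (c : R) : ceval z c%:MP = c%:C.
Proof. exact: mmapC. Qed.

Lemma cevalX z m : ceval z 'X_[m] = \prod_i z i ^+ m i.
Proof. exact: mmapX. Qed.

Lemma cevalXU z i : ceval z 'X_i = z i.
Proof. by rewrite /ceval mmapX mmap1U. Qed.

Lemma ceval_sum z (I : Type) (s : seq I) (F : I -> {mpoly R[n]}) :
  ceval z (\sum_(x <- s) F x) = \sum_(x <- s) ceval z (F x).
Proof.
by elim: s => [|x s IH]; rewrite ?big_nil ?ceval0 // !big_cons cevalD IH.
Qed.

(** The differential of [p] at [z] applied to [w]. *)
Definition cdiffl z w p : R[i] := \sum_j w j * ceval z (mderiv j p).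

Definition cremainder z w p : R[i] :=
  ceval (fun j => z j + w j) p - ceval z p - cdiffl z w p.

Lemma cdifflD z w p q : cdiffl z w (p + q) = cdiffl z w p + cdiffl z w q.
Proof.
by rewrite /cdiffl -big_split; apply: eq_bigr => j _; rewrite mderivD cevalD mulrDr.
Qed.

Lemma cdifflZ z w c p : cdiffl z w (c *: p) = c%:C * cdiffl z w p.
Proof.
by rewrite /cdiffl mulr_sumr; apply: eq_bigr => j _; rewrite mderivZ cevalZ mulrCA.
Qed.

Lemma cremainderD z w p q : cremainder z w (p + q) = cremainder z w p + cremainder z w q.
Proof. by rewrite /cremainder !cevalD cdifflD; ring. Qed.

Lemma cremainderZ z w c p : cremainder z w (c *: p) = c%:C * cremainder z w p.
Proof. by rewrite /cremainder !cevalZ cdifflZ; ring. Qed.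

Lemma cdifflXM z w i p :
  cdiffl z w ('X_i * p) = w i * ceval z p + z i * cdiffl z w p.
Proof.
rewrite /cdiffl mulr_sumr.
under eq_bigr => j _ do rewrite mderivXp cevalD cevalM cevalXU cevalZ mulrDr.
rewrite big_split /=; congr (_ + _); last by apply: eq_bigr => j _; rewrite mulrCA.
rewrite (bigD1 i) //= eqxx mul1r big1 ?addr0 // => j ji.
by rewrite eq_sym (negbTE ji) mul0r mulr0.
Qed.

Lemma cremainderXM z w i p :
  cremainder z w ('X_i * p) = (z i + w i) * cremainder z w p + w i * cdiffl z w p.
Proof. by rewrite /cremainder !cevalM !cevalXU cdifflXM; ring. Qed.

(** Expanding a monomial of degree [k] at [z + w], the number [2 ^ k - k - 1] in
    the remainder counts the ways to pick [w] in at least two of the [k]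
    factors. *)
Lemma monomial_estimates z w m (r e : R) : 0 < r -> 0 <= e -> e <= 1 ->
  (forall j, modc (z j) <= r) -> (forall j, modc (w j) <= e * r) ->
  [/\ modc (ceval z 'X_[m]) <= r ^+ mdeg m,
      modc (cdiffl z w 'X_[m]) <= (mdeg m)%:R * (e * r ^+ mdeg m) &
      modc (cremainder z w 'X_[m]) <=
        (2 ^+ mdeg m - (mdeg m)%:R - 1) * (e ^+ 2 * r ^+ mdeg m)].
Proof.
move=> r0 e0 e1 zr wr; have rg := ltW r0.
move Ed : (mdeg m) => k; elim: k m Ed => [|k IH] m Ed.
  have -> : m = 0%MM by apply/eqP; rewrite -mdeg_eq0 Ed.
  have d0 : cdiffl z w 'X_[0%MM] = 0.
    by rewrite /cdiffl big1 // => j _; rewrite mpolyX0 (mderivC _ 1) ceval0 mulr0.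
  split; rewrite ?d0 ?modc0 ?mul0r //.
    by rewrite cevalX big1 ?modc1 // => i _; rewrite mnm0E.
  rewrite /cremainder d0 subr0 !cevalX !big1 ?subrr ?modc0 ?subr0 ?expr0 ?subrr ?mul0r //.
    by move=> i _; rewrite mnm0E.
  by move=> i _; rewrite mnm0E.
have [i [m' [Em dm']]] := multinom_peel Ed.
have [a b c] := IH _ dm'.
have er0 : 0 <= e * r by rewrite mulr_ge0.
rewrite Em mpolyXD cevalM cevalXU cdifflXM cremainderXM; split.
- by rewrite modcM exprS ler_pM ?modc_ge0.
- apply: le_trans (modcD _ _) _; rewrite !modcM.
  have -> : k.+1%:R * (e * r ^+ k.+1) = (e * r) * r ^+ k + r * (k%:R * (e * r ^+ k)).
    by rewrite exprS -[k.+1]addn1 natrD; ring.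
  by apply: lerD; apply: ler_pM; rewrite ?modc_ge0.
apply: le_trans (modcD _ _) _; rewrite !modcM.
have -> : (2 ^+ k.+1 - k.+1%:R - 1) * (e ^+ 2 * r ^+ k.+1) =
   (r + r) * ((2 ^+ k - k%:R - 1) * (e ^+ 2 * r ^+ k)) + (e * r) * (k%:R * (e * r ^+ k)).
  by rewrite !exprS -[k.+1]addn1 natrD; ring.
apply: lerD; apply: ler_pM; rewrite ?modc_ge0 //.
by apply: le_trans (modcD _ _) (lerD _ _) => //; apply: le_trans (wr i) _; rewrite ler_piMl.
Qed.

Lemma ceval_le z p (r : R) : 0 < r -> (forall j, modc (z j) <= r) ->
  modc (ceval z p) <= majorant r p.
Proof.
move=> r0 zr; rewrite {1}[p]mpolyE ceval_sum; apply: le_trans (modc_sum _ _ _) _.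
apply: ler_sum => m _; rewrite cevalZ modcM modc_real ler_wpM2l //.
have w0 j : modc ((fun=> 0 : R[i]) j) <= 0 * r by rewrite modc0 mul0r.
by have [] := monomial_estimates m r0 (lexx 0) ler01 zr w0.
Qed.

Lemma cremainder_le z w p (r e : R) : 0 < r -> 0 <= e -> e <= 1 ->
  (forall j, modc (z j) <= r) -> (forall j, modc (w j) <= e * r) ->
  modc (cremainder z w p) <= e ^+ 2 * majorant (2 * r) p.
Proof.
move=> r0 e0 e1 zr wr; rewrite {1}[p]mpolyE.
have -> : cremainder z w (\sum_(m <- msupp p) p@_m *: 'X_[m]) =
    \sum_(m <- msupp p) (p@_m)%:C * cremainder z w 'X_[m].
  elim: (msupp p) => [|m s IHs]; last by rewrite !big_cons cremainderD cremainderZ IHs.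
  rewrite !big_nil /cremainder !ceval0 /cdiffl big1 ?subrr // => j _.
  by rewrite mderiv0 ceval0 mulr0.
apply: le_trans (modc_sum _ _ _) _; rewrite /majorant mulr_sumr; apply: ler_sum => m _.
rewrite modcM modc_real mulrCA ler_wpM2l //.
have [_ _ H] := monomial_estimates m r0 e0 e1 zr wr; apply: le_trans H _.
rewrite mulrC -mulrA ler_wpM2l ?sqr_ge0 // exprMn mulrC ler_wpM2r ?exprn_ge0 ?(ltW r0) //.
by have := ler0n R (mdeg m); lra.
Qed.

Lemma majorant_mderiv j p (r : R) : 1 <= r -> majorant r (mderiv j p) <= majorant (2 * r) p.
Proof.
move=> r1; have r0 : 0 <= r by apply: le_trans r1.
apply: le_trans (majorant_sum _ _ r0) _; apply: ler_sum => m _.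
rewrite majorantZ majorantX normrM mulrC mulrA [`|p@_m| * _]mulrC.
rewrite [leLHS](_ : _ = `|p@_m| * (`|(m j)%:R| * r ^+ mdeg (m - U_(j))%MM)); last by ring.
rewrite [leRHS]mulrC ler_wpM2l // exprMn ler_pM ?exprn_ge0 //.
  rewrite ger0_norm // -natrX ler_nat.
  apply: leq_trans (ltnW (ltn_expl _ (ltnSn 1))) _.
  by rewrite leq_exp2l // mdegE (bigD1 j) //= leq_addr.
by rewrite ler_weXn2l // mdegB.
Qed.

Definition harmonic_poly p := laplace p = 0.

Lemma ceval_harmonic z p : harmonic_poly p ->
  \sum_j ceval z (mderiv j (mderiv j p)) = 0.
Proof. by move=> p0; rewrite -ceval_sum -/(laplace p) p0 ceval0. Qed.

End Evaluation.

(** A polynomial that differs from a monomial by a multiple of the quadratic takes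
    the values of the monomial on the quadric. *)
Lemma harmonic_substitute (n : nat) (R : rcfType)
    (a b : 'I_n.+1 -> R) (c : R) (e : nat) :
  (exists i, a i != 0) -> e = 2 \/ (e = 1 /\ forall i, b i = 0) ->
  exists2 D : R, 1 <= D & forall m : 'I_n.+1 -> nat,
    exists H : {mpoly R[n.+1]},
      [/\ harmonic_poly H,
      forall x : 'I_n.+1 -> R,
        \sum_i a i ^+ 2 * x i ^+ 2 + \sum_i b i * x i + c = 0 ->
        ceval (fun i => (x i)%:C) H = \prod_i (x i)%:C ^+ m i &
      forall r S : R, 0 <= r -> r <= S -> 1 <= S -> ((\sum_i m i) ^ e)%:R <= S ->
        majorant r H <= (D * S) ^+ (\sum_i m i)].
Proof.
move=> a0 be; have [D D1 dec] := harmonic_monomial c a0 be.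
exists D => // m; pose mm : 'X_{1..n.+1} := [multinom m i | i < n.+1].
have dm : mdeg mm = (\sum_i m i)%N by rewrite mdegE; apply: eq_bigr => i _; rewrite mnmE.
have [H [H0 [Q HQ] Hle]] := dec mm; exists H; split=> //; last by rewrite -dm.
move=> x qx.
have := congr1 (ceval (fun i => (x i)%:C)) HQ; rewrite cevalB cevalM cevalX.
have -> : ceval (fun i => (x i)%:C) (mquadratic a b c) = 0.
  rewrite /mquadratic /sumsq !cevalD !ceval_sum cevalC.
  rewrite (eq_bigr (fun i => (a i ^+ 2 * x i ^+ 2)%:C)) => [|i _]; last first.
    by rewrite cevalZ cevalM cevalXU -expr2 -rmorphXn -rmorphM.
  rewrite [X in _ + X + _](eq_bigr (fun i => (b i * x i)%:C)) => [|i _]; last first.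
    by rewrite cevalZ cevalXU -rmorphM.
  by rewrite -!rmorph_sum -!rmorphD qx.
rewrite mul0r => /eqP; rewrite subr_eq0 => /eqP <-.
by apply: eq_bigr => i _; rewrite mnmE.
Qed.

End RealPolynomials.

Require Import Defs.
From mathcomp Require Import all_classical all_reals all_analysis.
Import RealPolynomials.
Import Order.TTheory GRing.Theory Num.Theory.
Import numFieldNormedType.Exports.

Local Open Scope classical_set_scope.
Local Open Scope ring_scope.
Local Open Scope complex_scope.

(** * Limits of complex sequences *)

Section ComplexLimits.
Variable R : realType.
Implicit Types (u v : nat -> R[i]) (l x y : R[i]) (e : R).

Definition clim u l := forall e, 0 < e ->
  exists N, forall n, (N <= n)%N -> modc (u n - l) <= e.

Lemma clim_cst l : clim (fun=> l) l.
Proof. by move=> e e0; exists 0%N => n _; rewrite subrr modc0 ltW. Qed.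

Lemma clim_unique u l l' : clim u l -> clim u l' -> l = l'.
Proof.
move=> ul ul'; apply/eqP; rewrite -subr_eq0 -modc_eq0; apply/negPn/negP => H.
have {}H : 0 < modc (l - l') by rewrite lt_neqAle modc_ge0 andbT eq_sym.
have [N HN] := ul (modc (l - l') / 4) (divr_gt0 H (ltr0n R 4)).
have [M HM] := ul' (modc (l - l') / 4) (divr_gt0 H (ltr0n R 4)).
have := HN _ (leq_maxl N M); have := HM _ (leq_maxr N M).
have := modc_triangle l (u (maxn N M)) l'; rewrite (modcBC l (u _)); lra.
Qed.

Lemma clim_eventually u v l (N0 : nat) :
  (forall n, (N0 <= n)%N -> u n = v n) -> clim u l -> clim v l.
Proof.
move=> uv ul e e0; have [N HN] := ul e e0; exists (maxn N0 N) => n.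
by rewrite geq_max => /andP[n0 nN]; rewrite -uv // HN.
Qed.

Lemma climD u v l l' : clim u l -> clim v l' -> clim (fun n => u n + v n) (l + l').
Proof.
move=> ul vl e e0; have e20 : 0 < e / 2 by rewrite divr_gt0.
have [N HN] := ul _ e20; have [M HM] := vl _ e20.
exists (maxn N M) => n; rewrite geq_max => /andP[/HN h1 /HM h2].
by rewrite opprD addrACA (le_trans (modcD _ _)) // (splitr e) lerD.
Qed.

Lemma climZ (a : R[i]) u l : clim u l -> clim (fun n => a * u n) (a * l).
Proof.
move=> ul e e0; have a0 : 0 < modc a + 1 by rewrite ltr_wpDl ?modc_ge0.
have [N HN] := ul _ (divr_gt0 e0 a0); exists N => n /HN h.
rewrite -mulrBr modcM; apply: (@le_trans _ _ ((modc a + 1) * (e / (modc a + 1)))).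
  by rewrite ler_pM ?modc_ge0 // lerDl.
by rewrite mulrC divfK // gt_eqF.
Qed.

Lemma climN u l : clim u l -> clim (fun n => - u n) (- l).
Proof.
by move=> ul e e0; have [N HN] := ul e e0; exists N => n /HN; rewrite -modcN opprB opprK addrC.
Qed.

Lemma climB u v l l' : clim u l -> clim v l' -> clim (fun n => u n - v n) (l - l').
Proof. by move=> ul vl; apply: climD => //; exact: climN. Qed.

Lemma clim_sum (I : Type) (s : seq I) (F : I -> nat -> R[i]) (L : I -> R[i]) :
  (forall i, clim (F i) (L i)) ->
  clim (fun n => \sum_(i <- s) F i n) (\sum_(i <- s) L i).
Proof.
move=> FL; elim: s => [|i s IH].
  by rewrite big_nil; apply: (clim_eventually (N0 := 0)) (clim_cst 0) => n _; rewrite big_nil.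
rewrite big_cons; apply: (clim_eventually (N0 := 0)) (climD (FL i) IH) => n _.
by rewrite big_cons.
Qed.

Lemma clim_le u l (B : R) (N0 : nat) :
  (forall n, (N0 <= n)%N -> modc (u n) <= B) -> clim u l -> modc l <= B.
Proof.
move=> uB ul; apply/ler_addgt0Pr => e e0; have [N HN] := ul e e0.
have := HN _ (leq_maxr N0 N); have := uB _ (leq_maxl N0 N).
have := modc_sub_ge l (u (maxn N0 N)); rewrite modcBC; lra.
Qed.

Lemma clim_squeeze u l (B : nat -> R) :
  (forall e, 0 < e -> exists N, forall n, (N <= n)%N -> B n <= e) ->
  (forall n, modc (u n - l) <= B n) -> clim u l.
Proof.
move=> B0 uB e e0; have [N HN] := B0 e e0; exists N => n /HN; exact: le_trans.
Qed.

Lemma cauchy_clim u :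
  (forall e, 0 < e -> exists N, forall m n, (N <= m)%N -> (N <= n)%N -> modc (u m - u n) <= e) ->
  exists l, clim u l.
Proof.
move=> uc.
have real_cauchy (w : nat -> R) : (forall m n, `|w m - w n| <= modc (u m - u n)) ->
    exists t : R, forall e, 0 < e -> exists N, forall n, (N <= n)%N -> `|w n - t| <= e.
  move=> wu; have /cvg_ex[t wl] : cvgn w.
    apply/cauchy_cvgP/cauchy_ballP => e e0; near_simpl.
    have [N HN] := uc _ (divr_gt0 e0 (ltr0n R 2)).
    near=> m n; rewrite /ball /=; apply: (le_lt_trans (wu _ _)).
    apply: (@le_lt_trans _ _ (e / 2)); last by rewrite ltr_pdivrMr // mulr2n mulrDr mulr1 ltrDl.
    by apply: HN; [near: m|near: n]; exact: nbhs_infty_ge.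
  exists t => e e0; have /cvgrPdist_le /(_ e e0) [N _ HN] := wl.
  by exists N => n /HN; rewrite distrC.
have [m n|a Ha] := real_cauchy (fun n => complex.Re (u n)).
  by rewrite -raddfB; exact: Re_le_modc.
have [m n|b Hb] := real_cauchy (fun n => complex.Im (u n)).
  by rewrite -raddfB; exact: Im_le_modc.
exists (a +i* b) => e e0; have e20 := divr_gt0 e0 (ltr0n R 2).
have [N HN] := Ha _ e20; have [M HM] := Hb _ e20.
exists (maxn N M) => n; rewrite geq_max => /andP[/HN h1 /HM h2].
rewrite (splitr e); apply: le_trans (modc_le_ReIm _) (lerD _ _).
  by case: (u n) h1.
by case: (u n) h2.
Unshelve. all: by end_near. Qed.

End ComplexLimits.

(** * Goursat's lemma for discrete contour sums *)

Section Goursat.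
Variable R : realType.
Implicit Types (g G : R[i] -> R[i]).

Definition cdiff g (z : R[i]) := exists l : R[i], forall e : R, 0 < e ->
  exists2 dl : R, 0 < dl &
    forall h, modc h <= dl -> modc (g (z + h) - g z - l * h) <= e * modc h.

(** The quotient rule at [z], away from the point [a] where the slope is
    singular. *)
Lemma cdiff_slope g (a z : R[i]) : z != a -> cdiff g z ->
  cdiff (fun x => (g x - g a) / (x - a)) z.
Proof.
move=> za [l gl]; pose u := z - a; pose B := g z - g a.
have u0 : u != 0 by rewrite subr_eq0.
have mu0 : 0 < modc u by rewrite modc_gt0.
exists (l / u - B / u ^+ 2) => e e0.
pose K := 2 * modc l / modc u ^+ 2 + 2 * modc B / modc u ^+ 3.
have K0 : 0 <= K by rewrite addr_ge0 // divr_ge0 ?exprn_ge0 ?mulr_ge0 ?modc_ge0.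
have e1 : 0 < e * modc u / 4 by rewrite divr_gt0 // mulr_gt0.
have [d1 d10 gd] := gl _ e1.
have K1 : 0 < 2 * (K + 1) by rewrite mulr_gt0 // ltr_wpDl.
exists (Num.min d1 (Num.min (modc u / 2) (e / (2 * (K + 1))))).
  by rewrite !lt_min d10 !divr_gt0.
move=> h; rewrite !le_min => /andP[/gd hd /andP[hu he]].
have uh : modc u / 2 <= modc (u + h).
  have := modc_sub_ge u (- h); rewrite opprK modcN.
  by apply: le_trans; lra.
have uh1 : 0 < modc (u + h) by apply: lt_le_trans uh; rewrite divr_gt0.
have uh0 : u + h != 0 by rewrite -modc_gt0.
set D := g (z + h) - g z - l * h in hd.
have E : (g (z + h) - g a) / (z + h - a) - (g z - g a) / (z - a) - (l / u - B / u ^+ 2) * h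
   = D / (u + h) - l * h ^+ 2 / (u * (u + h)) + B * h ^+ 2 / (u ^+ 2 * (u + h)).
  have -> : g (z + h) - g a = B + l * h + D by rewrite /D /B; ring.
  have -> : z + h - a = u + h by rewrite /u; ring.
  rewrite -/u -/B; field; exact/andP.
rewrite E; apply: le_trans (modcD _ _) _.
have inv : (modc (u + h))^-1 <= 2 / modc u.
  by rewrite -[2 / _]invrK lef_pV2 ?posrE ?invr_gt0 ?divr_gt0 // invf_div.
have h0 := modc_ge0 h; have l0 := modc_ge0 l; have B0 := modc_ge0 B.
have t1 : modc (D / (u + h)) <= e / 2 * modc h.
  rewrite modcM modcV; apply: (@le_trans _ _ (e * modc u / 4 * modc h * (2 / modc u))).
    by rewrite ler_pM ?modc_ge0 // invr_ge0 ltW.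
  by rewrite le_eqVlt; apply/orP; left; apply/eqP; field; rewrite gt_eqF.
have t2 : modc (l * h ^+ 2 / (u * (u + h))) <= 2 * modc l / modc u ^+ 2 * modc h ^+ 2.
  rewrite modcM (modcM l) modcX modcV (modcM u).
  have -> : 2 * modc l / modc u ^+ 2 * modc h ^+ 2 = modc l * modc h ^+ 2 * ((modc u)^-1 * (2 / modc u)).
    by field; rewrite gt_eqF.
  by rewrite invfM ler_wpM2l ?mulr_ge0 ?exprn_ge0 // ler_wpM2l ?invr_ge0 ?modc_ge0.
have t3 : modc (B * h ^+ 2 / (u ^+ 2 * (u + h))) <= 2 * modc B / modc u ^+ 3 * modc h ^+ 2.
  rewrite modcM (modcM B) modcX modcV (modcM (u ^+ 2)) modcX.
  have -> : 2 * modc B / modc u ^+ 3 * modc h ^+ 2 = modc B * modc h ^+ 2 * ((modc u ^+ 2)^-1 * (2 / modc u)).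
    by field; rewrite gt_eqF.
  by rewrite invfM ler_wpM2l ?mulr_ge0 ?exprn_ge0 // ler_wpM2l ?invr_ge0 ?exprn_ge0 ?modc_ge0.
have t4 : K * modc h ^+ 2 <= e / 2 * modc h.
  rewrite expr2 mulrA ler_wpM2r //.
  apply: (@le_trans _ _ ((K + 1) * (e / (2 * (K + 1))))).
    by rewrite ler_pM // lerDl.
  rewrite le_eqVlt; apply/orP; left; apply/eqP; field.
  by rewrite gt_eqF // ltr_wpDl.
have -> : e * modc h = e / 2 * modc h + e / 2 * modc h by field.
rewrite -addrA in E *.
apply: (@le_trans _ _ (modc (D / (u + h)) + modc (l * h ^+ 2 / (u * (u + h))) +
    modc (B * h ^+ 2 / (u ^+ 2 * (u + h))))).
  by rewrite lerD2r modcB.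
have : K * modc h ^+ 2 = 2 * modc l / modc u ^+ 2 * modc h ^+ 2 + 2 * modc B / modc u ^+ 3 * modc h ^+ 2.
  by rewrite /K mulrDl.
clear - t1 t2 t3 t4; lra.
Qed.

(** Trapezoidal Stieltjes sum of [G dz] along the first [N] edges of a polygonal
    path.  It is exact for affine [G], so the only analytic input is how far
    [G] is from affine. *)
Definition path_sum G (gam : nat -> R[i]) (N : nat) : R[i] :=
  \sum_(i < N) (G (gam i) + G (gam i.+1)) / 2 * (gam i.+1 - gam i).

Lemma path_sumD G gam N M :
  path_sum G gam (N + M) = path_sum G gam N + path_sum G (fun i => gam (N + i)%N) M.
Proof.
rewrite /path_sum big_split_ord /=; congr (_ + _).
by apply: eq_bigr => i _; rewrite addnS.
Qed.

Lemma eq_path_sum G gam gam' N : gam =1 gam' -> path_sum G gam N = path_sum G gam' N.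
Proof. by move=> E; apply: eq_bigr => i _; rewrite !E. Qed.

Definition affine_primitive (A l p z : R[i]) := A * z + l * (z - p) ^+ 2 / 2.

Lemma path_sum_near_affine G gam N (p A l : R[i]) (e k : R) :
  0 <= e ->
  (forall i, (i <= N)%N -> modc (G (gam i) - (A + l * (gam i - p))) <= e) ->
  (forall i, (i < N)%N -> modc (gam i.+1 - gam i) <= k) ->
  modc (path_sum G gam N -
    (affine_primitive A l p (gam N) - affine_primitive A l p (gam 0))) <= N%:R * (e * k).
Proof.
move=> e0 Ge gk; pose W := affine_primitive A l p; rewrite -!/(W _).
have -> : W (gam N) - W (gam 0%N) = \sum_(i < N) (W (gam i.+1) - W (gam i)).
  by rewrite -(big_mkord predT (fun i => W (gam i.+1) - W (gam i))) telescope_sumr.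
rewrite -sumrB; apply: le_trans (modc_sum _ _ _) _.
rewrite -[N in leRHS]card_ord -sum1_card natr_sum mulr_suml; apply: ler_sum => i _.
rewrite mul1r.
set E := fun j => G (gam j) - (A + l * (gam j - p)) in Ge *.
have -> : (G (gam i) + G (gam i.+1)) / 2 * (gam i.+1 - gam i) - (W (gam i.+1) - W (gam i))
   = (E i + E i.+1) / 2 * (gam i.+1 - gam i).
  by rewrite /E /W /affine_primitive; field.
rewrite modcM; apply: ler_pM; [exact: modc_ge0|exact: modc_ge0| |exact: gk].
rewrite modcM modcV modc_nat.
rewrite ler_pdivrMr // mulr_natr mulr2n; apply: le_trans (modcD _ _) (lerD _ _); apply: Ge => //.
exact: ltnW.
Qed.

Lemma path_sum_le G gam N (e k : R) : 0 <= e ->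
  (forall i, (i <= N)%N -> modc (G (gam i)) <= e) ->
  (forall i, (i < N)%N -> modc (gam i.+1 - gam i) <= k) ->
  modc (path_sum G gam N) <= N%:R * (e * k).
Proof.
move=> e0 Ge gk; have := @path_sum_near_affine G gam N 0 0 0 e k e0.
rewrite /affine_primitive !mul0r addr0 !subr0; apply=> // i iN.
by rewrite mul0r addr0 subr0 Ge.
Qed.

(** Boundary sum over the image of an axis-parallel square with lower left
    corner [(x, y)], whose sides are divided into [N] steps of length [h]. *)
Definition square_sum G (Phi : R -> R -> R[i]) (x y h : R) (N : nat) : R[i] :=
  path_sum G (fun i => Phi (x + i%:R * h) y) N
  + path_sum G (fun i => Phi (x + N%:R * h) (y + i%:R * h)) N
  - path_sum G (fun i => Phi (x + i%:R * h) (y + N%:R * h)) N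
  - path_sum G (fun i => Phi x (y + i%:R * h)) N.

Lemma square_sum_split G Phi x y h N :
  square_sum G Phi x y h (N + N) =
  square_sum G Phi x y h N + square_sum G Phi (x + N%:R * h) y h N
  + square_sum G Phi x (y + N%:R * h) h N
  + square_sum G Phi (x + N%:R * h) (y + N%:R * h) h N.
Proof.
rewrite /square_sum !path_sumD natrD mulrDl !addrA.
have E t (i : nat) : t + (N + i)%:R * h = t + N%:R * h + i%:R * h.
  by rewrite natrD mulrDl addrA.
have Ex F : (fun i : nat => Phi (x + (N + i)%:R * h) F) = (fun i => Phi (x + N%:R * h + i%:R * h) F).
  by apply/funext => i; rewrite E.
have Ey F : (fun i : nat => Phi F (y + (N + i)%:R * h)) = (fun i => Phi F (y + N%:R * h + i%:R * h)).
  by apply/funext => i; rewrite E.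
rewrite !Ex !Ey; ring.
Qed.

Section Square.
Variables (G : R[i] -> R[i]) (Phi : R -> R -> R[i]) (L : R).
Hypothesis L0 : 0 <= L.
Hypothesis PhiL : forall x y x' y', 0 <= x <= 1 -> 0 <= y <= 1 -> 0 <= x' <= 1 -> 0 <= y' <= 1 ->
  modc (Phi x y - Phi x' y') <= L * (`|x - x'| + `|y - y'|).
Hypothesis Gdiff : forall x y, 0 <= x <= 1 -> 0 <= y <= 1 -> cdiff G (Phi x y).

Let len (n : nat) : R := 2^-1 ^+ n.

Let len_gt0 n : 0 < len n. Proof. by rewrite exprn_gt0 // invr_gt0. Qed.

Let lenS n : len n = len n.+1 + len n.+1.
Proof. by rewrite /len exprS; field. Qed.

(* The square with corner [p] and side [2 ^ - n] has a boundary sum that exceeds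
   [eta] times the area for arbitrarily fine subdivisions. *)
Let bad (eta : R) (n : nat) (p : R * R) :=
  [/\ 0 <= p.1, p.1 + len n <= 1, 0 <= p.2, p.2 + len n <= 1 &
  forall K0, exists2 K, (K0 <= K)%N &
    eta * len n ^+ 2 < modc (square_sum G Phi p.1 p.2 (len (n + K)) (2 ^ K))].

Let len_mesh n K : (2 ^ K)%:R * len (n + K) = len n.
Proof.
rewrite natrX /len exprD mulrCA -exprMn.
by rewrite mulfV ?expr1n ?mulr1 // pnatr_eq0.
Qed.

(* The boundary sum is additive over the four quarters, so one of them is bad. *)
Let bad_refine eta n p : bad eta n p ->
  exists q : R * R, bad eta n.+1 q /\
   (p.1 <= q.1 /\ q.1 + len n.+1 <= p.1 + len n /\ p.2 <= q.2 /\ q.2 + len n.+1 <= p.2 + len n).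
Proof.
case: p => x y [/= x0 x1 y0 y1 H]; apply: contrapT => noq.
have l1 := lenS n; have l2 := len_gt0 n.+1.
have good x' y' : (x' = x \/ x' = x + len n.+1) -> (y' = y \/ y' = y + len n.+1) ->
    exists K0, forall K, (K0 <= K)%N ->
     modc (square_sum G Phi x' y' (len (n.+1 + K)) (2 ^ K)) <= eta * len n.+1 ^+ 2.
  move=> hx hy; apply: contrapT => H'; apply: noq; exists (x', y'); split; last first.
    by rewrite /=; case: hx => ->; case: hy => ->; lra.
  split; rewrite /=; try by case: hx => ->; lra.
  - by case: hy => ->; lra.
  - by case: hy => ->; lra.
  move=> K0; apply: contrapT => HK; apply: H'; exists K0 => K KK.
  by rewrite leNgt; apply/negP => lt; apply: HK; exists K.
have [K1 H1] := good x y (or_introl erefl) (or_introl erefl).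
have [K2 H2] := good _ y (or_intror erefl) (or_introl erefl).
have [K3 H3] := good x _ (or_introl erefl) (or_intror erefl).
have [K4 H4] := good _ _ (or_intror erefl) (or_intror erefl).
have [[//|K] KK] := H (maxn (maxn K1 K2) (maxn K3 K4)).+1.
move: KK; rewrite ltnS !geq_max => /andP[/andP[/H1 h1 /H2 h2] /andP[/H3 h3 /H4 h4]].
rewrite expnS mul2n -addnn square_sum_split -addSnnS len_mesh ltNge => /negP; apply.
apply: le_trans (modcD _ _) _; apply: le_trans (lerD (modcD _ _) (lexx _)) _.
apply: le_trans (lerD (lerD (modcD _ _) (lexx _)) (lexx _)) _.
have -> : eta * len n ^+ 2 = eta * len n.+1 ^+ 2 + eta * len n.+1 ^+ 2 + eta * len n.+1 ^+ 2 + eta * len n.+1 ^+ 2.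
  by rewrite l1; ring.
by rewrite !lerD.
Qed.

Let bad_point eta p0 : bad eta 0 p0 -> exists f : nat -> R * R, exists p : R * R,
  forall n, [/\ bad eta n (f n), (f n).1 <= p.1 <= (f n).1 + len n & (f n).2 <= p.2 <= (f n).2 + len n].
Proof.
move=> b0.
pose step n (p : {p | bad eta n p}) : {p | bad eta n.+1 p} :=
  let q := cid (bad_refine (proj2_sig p)) in exist _ (proj1_sig q) (proj1 (proj2_sig q)).
pose F := fix F n : {p | bad eta n p} := if n is n'.+1 then step n' (F n') else exist _ p0 b0.
pose f n := proj1_sig (F n).
have fS n : (f n).1 <= (f n.+1).1 /\ (f n.+1).1 + len n.+1 <= (f n).1 + len n /\
    (f n).2 <= (f n.+1).2 /\ (f n.+1).2 + len n.+1 <= (f n).2 + len n.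
  by rewrite /f /= /step /=; exact: (proj2 (proj2_sig (cid (bad_refine (proj2_sig (F n)))))).
have nest (w : nat -> R) : (forall n, w n <= w n.+1) -> (forall n, w n.+1 + len n.+1 <= w n + len n) ->
    exists t, forall n, w n <= t <= w n + len n.
  move=> w1 w2.
  have mono n m : (n <= m)%N -> w n <= w m.
    move=> /subnK <-; elim: (m - n)%N => [//|k IH]; rewrite addSn.
    exact: le_trans IH (w1 _).
  have mono2 n m : (n <= m)%N -> w m + len m <= w n + len n.
    move=> /subnK <-; elim: (m - n)%N => [//|k IH]; rewrite addSn.
    exact: le_trans (w2 _) IH.
  have wub n m : w m <= w n + len n.
    apply: le_trans (mono _ _ (leq_maxl m n)) _.
    apply: le_trans (mono2 _ _ (leq_maxr m n)).
    by rewrite lerDl ltW.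
  exists (sup (range w)) => n; apply/andP; split.
    apply: ub_le_sup; last by exists n.
    by exists (w 0%N + len 0) => _ [m _ <-]; exact: wub.
  apply: ge_sup; first by exists (w 0%N); exists 0%N.
  by move=> _ [m _ <-]; exact: wub.
have [t1 T1] := nest (fun n => (f n).1) (fun n => (fS n).1) (fun n => (fS n).2.1).
have [t2 T2] := nest (fun n => (f n).2) (fun n => (fS n).2.2.1) (fun n => (fS n).2.2.2).
exists f, (t1, t2) => n; split; [exact: (proj2_sig (F n))|exact: T1|exact: T2].
Qed.

(** Goursat's lemma for a homotopy: by bisection a persistently large boundary
    sum would concentrate at a point, where differentiability makes the sum over
    a square of side [l] of smaller order than [l ^ 2]. *)
Lemma goursat (eta : R) : 0 < eta -> exists K0, forall K, (K0 <= K)%N ->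
  modc (square_sum G Phi 0 0 (2^-1 ^+ K) (2 ^ K)) <= eta.
Proof.
move=> eta0; apply: contrapT => H.
have b0 : bad eta 0 (0, 0).
  split; rewrite /= /len ?expr0 ?add0r // => K0; apply: contrapT => H'; apply: H; exists K0 => K KK.
  rewrite leNgt; apply/negP => lt; apply: H'; exists K => //.
  by rewrite expr1n mulr1.
have [f [[x y] fp]] := bad_point b0.
have len0 : len 0 = 1 by rewrite /len expr0.
have [[/= a1 a2 a3 a4 _]] := fp 0%N; rewrite len0 /= => /andP[x0 x1] /andP[y0 y1].
rewrite len0 in a2 a4.
have X : 0 <= x <= 1 by lra.
have Y : 0 <= y <= 1 by lra.
have [l Gl] := Gdiff X Y.
pose e := eta / (8 * L ^+ 2 + 1).
have den : 0 < 8 * L ^+ 2 + 1 by rewrite ltr_wpDl // mulr_ge0 // sqr_ge0.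
have e0 : 0 < e by rewrite divr_gt0.
have [dl dl0 Gdl] := Gl e e0.
have [n nd] : exists n, 2 * L * len n <= dl.
  have [n Hn] : exists n, (2 * L / dl) < n%:R.
    exists (Num.trunc (2 * L / dl)).+1.
    by have := truncnS_gt (2 * L / dl); rewrite ?num_real.
  exists n; rewrite /len exprVn ler_pdivrMr ?exprn_gt0 // [leRHS]mulrC -ler_pdivrMr // -natrX.
  by apply: ltW; apply: lt_le_trans Hn _; rewrite ler_nat ltnW // ltn_expl.
have [[b1 b2 b3 b4 big] /andP[xa xb] /andP[ya yb]] := fp n.
move: (f n) b1 b2 b3 b4 big xa xb ya yb => [u v] /= u0 u1 v0 v1 big ux xu vy yv.
have [K _] := big 0%N; rewrite ltNge => /negP; apply.
have inx s : u <= s <= u + len n -> 0 <= s <= 1.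
  by case/andP => s1 s2; rewrite (le_trans u0 s1) (le_trans s2 u1).
have iny t : v <= t <= v + len n -> 0 <= t <= 1.
  by case/andP => s1 s2; rewrite (le_trans v0 s1) (le_trans s2 v1).
have Gnear s t : u <= s <= u + len n -> v <= t <= v + len n ->
    modc (G (Phi s t) - (G (Phi x y) + l * (Phi s t - Phi x y))) <= e * (2 * L * len n).
  move=> st tt.
  have S1 := inx s st; have T1 := iny t tt.
  have D : modc (Phi s t - Phi x y) <= 2 * L * len n.
    apply: le_trans (PhiL S1 T1 X Y) _.
    rewrite -mulrA mulrCA ler_wpM2l // mulr_natl mulr2n lerD //.
      by rewrite ler_norml; lra.
    by rewrite ler_norml; lra.
  have := Gdl (Phi s t - Phi x y) (le_trans D nd).
  rewrite (addrC (Phi x y)) subrK opprD addrA => /le_trans; apply.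
  by rewrite ler_wpM2l // ltW.
have h0 := len_gt0 (n + K).
have mesh := len_mesh n K.
move: h0 mesh; move: (len (n + K)) (2 ^ K)%N => h N h0 mesh.
have inside (i : nat) : (i <= N)%N -> 0 <= i%:R * h <= len n.
  move=> iN; apply/andP; split; first by rewrite mulr_ge0 // ltW.
  by rewrite -mesh ler_pM2r // ler_nat.
have W0 := len_gt0 n.
have eg := ltW e0; have Wg := ltW W0.
have E0 : 0 <= e * (2 * L * len n).
  by apply: mulr_ge0 => //; apply: mulr_ge0 => //; apply: mulr_ge0.
pose W := affine_primitive (G (Phi x y)) l (Phi x y).
have edge (gx gy : nat -> R) : (forall i, (i <= N)%N -> u <= gx i <= u + len n) ->
    (forall i, (i <= N)%N -> v <= gy i <= v + len n) ->
    (forall i, (i < N)%N -> `|gx i.+1 - gx i| + `|gy i.+1 - gy i| <= h) ->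
    modc (path_sum G (fun i => Phi (gx i) (gy i)) N -
       (W (Phi (gx N) (gy N)) - W (Phi (gx 0%N) (gy 0%N))))
      <= 2 * e * L ^+ 2 * len n ^+ 2.
  move=> Gx Gy Gh.
  have -> : 2 * e * L ^+ 2 * len n ^+ 2 = N%:R * ((e * (2 * L * len n)) * (L * h)).
    by rewrite [len n ^+ 2]expr2 -{1}mesh; ring.
  apply: (@path_sum_near_affine G (fun i => Phi (gx i) (gy i)) N _ _ l) => // i iN.
    by apply: Gnear; [exact: Gx|exact: Gy].
  have xi := inx _ (Gx i (ltnW iN)); have xi1 := inx _ (Gx i.+1 iN).
  have yi := iny _ (Gy i (ltnW iN)); have yi1 := iny _ (Gy i.+1 iN).
  apply: le_trans (PhiL xi1 yi1 xi yi) _.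
  by rewrite ler_wpM2l // Gh.
have runx i : (i <= N)%N -> u <= u + i%:R * h <= u + len n.
  by move=> /inside/andP[p1 p2]; rewrite lerDl p1 lerD2l.
have runy i : (i <= N)%N -> v <= v + i%:R * h <= v + len n.
  by move=> /inside/andP[p1 p2]; rewrite lerDl p1 lerD2l.
have step w i : `|w + i.+1%:R * h - (w + i%:R * h)| = h.
  by rewrite -[i.+1]addn1 natrD (_ : _ - _ = h) ?gtr0_norm //; ring.
have ul : u <= u + len n by rewrite lerDl.
have vl : v <= v + len n by rewrite lerDl.
have e1 := edge (fun i => u + i%:R * h) (fun=> v) runx (fun _ _ => introT andP (conj (lexx v) vl)).
have e2 := edge (fun=> u + N%:R * h) (fun i => v + i%:R * h) (fun _ _ => runx N (leqnn N)) runy.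
have e3 := edge (fun i => u + i%:R * h) (fun=> v + N%:R * h) runx (fun _ _ => runy N (leqnn N)).
have e4 := edge (fun=> u) (fun i => v + i%:R * h) (fun _ _ => introT andP (conj (lexx u) ul)) runy.
have {}e1 := e1 (fun i _ => ltac:(by rewrite step subrr normr0 addr0)).
have {}e2 := e2 (fun i _ => ltac:(by rewrite step subrr normr0 add0r)).
have {}e3 := e3 (fun i _ => ltac:(by rewrite step subrr normr0 addr0)).
have {}e4 := e4 (fun i _ => ltac:(by rewrite step subrr normr0 add0r)).
move: e1 e2 e3 e4; rewrite /= !mul0r !addr0 /square_sum.
move: (W _) (W _) (W _) (W _) => W1 W2 W3 W4.
set P1 := path_sum _ _ _; set P2 := path_sum _ _ _; set P3 := path_sum _ _ _; set P4 := path_sum _ _ _.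
move=> e1 e2 e3 e4.
have -> : P1 + P2 - P3 - P4 = (P1 - (W4 - W3)) + (P2 - (W2 - W4)) - (P3 - (W2 - W1)) - (P4 - (W1 - W3)).
  by ring.
apply: le_trans (modcB _ _) _; apply: le_trans (lerD (modcB _ _) (lexx _)) _.
apply: le_trans (lerD (lerD (modcD _ _) (lexx _)) (lexx _)) _.
apply: le_trans (lerD (lerD (lerD e1 e2) e3) e4) _.
have -> : 2 * e * L ^+ 2 * len n ^+ 2 + 2 * e * L ^+ 2 * len n ^+ 2 +
    2 * e * L ^+ 2 * len n ^+ 2 + 2 * e * L ^+ 2 * len n ^+ 2 = e * (8 * L ^+ 2) * len n ^+ 2 by ring.
apply: ler_wpM2r; first exact: sqr_ge0.
by rewrite /e mulrAC ler_pdivrMr // ler_pM2l // lerDl.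
Qed.

End Square.
End Goursat.

(** * Roots of unity and circles *)

Section Circle.
Variable R : realType.

Definition cis (t : R) : R[i] := cos t +i* sin t.

Lemma cisD s t : cis (s + t) = cis s * cis t.
Proof. by rewrite /cis cosD sinD; apply/eqP; rewrite eq_complex /= eqxx addrC eqxx. Qed.

Lemma cis0 : cis 0 = 1.
Proof. by rewrite /cis cos0 sin0. Qed.

Lemma cisMn n t : cis (n%:R * t) = cis t ^+ n.
Proof.
elim: n => [|n IH]; first by rewrite mul0r cis0 expr0.
by rewrite exprS -IH -cisD mulrSr mulrDl mul1r addrC.
Qed.

Lemma modc_cis t : modc (cis t) = 1.
Proof. by rewrite /cis /= cos2Dsin2 sqrtr1. Qed.

Lemma cis_neq0 t : cis t != 0.
Proof. by rewrite -modc_gt0 modc_cis. Qed.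

Lemma lip1_of_derive (f df : R -> R) : (forall x : R, is_derive x (1 : R) f (df x)) ->
  (forall x, `|df x| <= 1) -> forall s t, `|f s - f t| <= `|s - t|.
Proof.
move=> fd df1 s t; wlog st : s t / s <= t => [H|].
  by case/orP: (le_total s t) => [/H //|/H]; rewrite distrC (distrC t).
have [|c _ E] := @MVT_segment R f df s t st (fun x _ => fd x).
  apply: continuous_subspaceT => x.
  by apply/differentiable_continuous/derivable1_diffP; case: (fd x).
by rewrite distrC E normrM (distrC s) ler_piMl.
Qed.

Lemma cis_lip s t : modc (cis s - cis t) <= 2 * `|s - t|.
Proof.
apply: le_trans (modc_le_ReIm _) _; rewrite /cis /= mulr_natl mulr2n; apply: lerD.
  apply: (@lip1_of_derive cos (fun x => - sin x)) => x; rewrite normrN ler_norml.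
  by rewrite sin_geN1 sin_le1.
apply: (@lip1_of_derive sin cos) => x; rewrite ler_norml.
by rewrite cos_geN1 cos_le1.
Qed.

(** Only orders [2 ^ K] occur, to match the bisections of [goursat]. *)
Definition unit_root (K : nat) : R[i] := cis (2 * pi * 2^-1 ^+ K).

Lemma unit_root_pow2 K : unit_root K ^+ (2 ^ K) = 1.
Proof.
rewrite -cisMn mulrCA natrX -exprMn mulfV ?expr1n ?mulr1 ?pnatr_eq0 //.
by rewrite /cis mulr_natl cos2pi sin2pi.
Qed.

Lemma unit_rootS K : unit_root K.+1 ^+ 2 = unit_root K.
Proof. by rewrite -cisMn /unit_root exprS; congr cis; field. Qed.

Lemma unit_root_half K : unit_root K.+1 ^+ (2 ^ K) = -1.
Proof.
rewrite -cisMn natrX exprS mulrCA.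
have -> : 2 ^+ K * (2^-1 * 2^-1 ^+ K) = 2^-1 :> R.
  by rewrite mulrCA -exprMn mulfV ?expr1n ?mulr1 // pnatr_eq0.
have -> : 2 * pi * 2^-1 = pi :> R by field.
by rewrite /cis cospi sinpi; apply/eqP; rewrite eq_complex /= oppr0 !eqxx.
Qed.

Lemma modc_unit_root K : modc (unit_root K) = 1. Proof. exact: modc_cis. Qed.

Lemma unit_root_neq0 K : unit_root K != 0. Proof. exact: cis_neq0. Qed.

Lemma unit_root_expr_neq1 K k : ~~ (2 ^ K %| k)%N -> unit_root K ^+ k != 1.
Proof.
elim: K k => [|K IH] k; first by rewrite expn0 dvd1n.
case ok : (odd k) => ndv; last first.
  have Ek : k = (k./2 * 2)%N by rewrite muln2 -[LHS]odd_double_half ok.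
  rewrite Ek mulnC exprM unit_rootS; apply: IH.
  by apply: contra ndv => dv; rewrite Ek expnS mulnC dvdn_mul.
apply/eqP => wk; have : (unit_root K.+1 ^+ k) ^+ (2 ^ K) = -1.
  by rewrite exprAC unit_root_half -signr_odd ok.
by rewrite wk expr1n => /eqP; rewrite -subr_eq0 opprK -[1 + 1]/(2%:R) pnatr_eq0.
Qed.

Lemma unit_root_sum0 K k : ~~ (2 ^ K %| k)%N ->
  \sum_(i < 2 ^ K) (unit_root K ^+ k) ^+ i = 0.
Proof.
move=> ndv; have /eqP := subrX1 (unit_root K ^+ k) (2 ^ K).
rewrite exprAC unit_root_pow2 expr1n subrr eq_sym mulf_eq0 subr_eq0.
by rewrite (negbTE (unit_root_expr_neq1 ndv)) => /eqP.
Qed.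

(** The factor in [path_sum_circle] does not degenerate: [2 ^ K] chords of this
    length lead from [1] to [-1]. *)
Lemma unit_root_chord K : 8 <= modc (unit_root K.+2 - (unit_root K.+2)^-1) * (2 ^ K.+2)%:R.
Proof.
set w := unit_root K.+2; have w0 : w != 0 := unit_root_neq0 _.
have -> : modc (w - w^-1) = modc (w ^+ 2 - 1).
  have -> : w ^+ 2 - 1 = w * (w - w^-1) by rewrite mulrBr divff // expr2.
  by rewrite modcM modc_unit_root mul1r.
have := subrX1 (unit_root K.+1) (2 ^ K); rewrite unit_root_half => E.
have : modc (-1 - 1 : R[i]) = 2.
  have -> : -1 - 1 = - (2%:R) :> R[i] by rewrite -opprD.
  by rewrite modcN modc_nat.
rewrite E modcM => E2.
have : modc (\sum_(i < 2 ^ K) unit_root K.+1 ^+ i) <= (2 ^ K)%:R.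
  apply: le_trans (modc_sum _ _ _) _.
  under eq_bigr do rewrite modcX modc_unit_root expr1n.
  by rewrite sumr_const card_ord.
have Ew : w ^+ 2 = unit_root K.+1 := unit_rootS K.+1.
rewrite Ew => le; rewrite !expnS mulnA natrM mulrCA.
have -> : 8 = (2 * 2)%:R * 2 :> R by rewrite -natrM.
by rewrite ler_wpM2l // -E2 ler_wpM2l ?modc_ge0.
Qed.

Definition node (s : R) (K i : nat) : R[i] := s%:C * unit_root K ^+ i.

Lemma modc_node s K i : 0 <= s -> modc (node s K i) = s.
Proof. by move=> s0; rewrite modcM modc_real modcX modc_unit_root expr1n mulr1 ger0_norm. Qed.

Lemma node_neq0 s K i : 0 < s -> node s K i != 0.
Proof. by move=> s0; rewrite -modc_gt0 modc_node // ltW. Qed.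

Lemma node_pow2 s K i : node s K i ^+ (2 ^ K) = s%:C ^+ (2 ^ K).
Proof. by rewrite exprMn exprAC unit_root_pow2 expr1n mulr1. Qed.

(** Summation by parts around the circle: each node collects half of the two
    adjacent edges, that is, half of [w - w^-1] times itself. *)
Lemma path_sum_circle (G : R[i] -> R[i]) s K :
  path_sum G (node s K) (2 ^ K) =
  (unit_root K - (unit_root K)^-1) / 2 * \sum_(i < 2 ^ K) G (node s K i) * node s K i.
Proof.
set w := unit_root K; have w0 : w != 0 := unit_root_neq0 K.
pose F i := G (node s K i) * node s K i.
have FN : F (2 ^ K)%N = F 0%N by rewrite /F /node unit_root_pow2 expr0.
have cyc : \sum_(i < 2 ^ K) F i.+1 = \sum_(i < 2 ^ K) F i.
  apply: (addrI (F 0%N)); rewrite -[LHS](big_ord_recl _ (fun i => F i)) big_ord_recr /= FN addrC //.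
rewrite /path_sum (eq_bigr (fun i : 'I_(2 ^ K) => (w - 1) / 2 * F i + (1 - w^-1) / 2 * F i.+1)); last first.
  move=> i _; rewrite /F.
  have E : node s K i.+1 = w * node s K i by rewrite /node exprS mulrCA.
  by rewrite E; field.
by rewrite big_split /= -!mulr_sumr cyc -mulrDl; congr (_ * _); field.
Qed.

End Circle.

(** * Cauchy's formula by interpolation at roots of unity *)

Section CauchyInterpolation.
Variable R : realType.
Implicit Types (g : R[i] -> R[i]) (a : R[i]) (s : R).

(** The homotopy [a + t (z - a)] shrinks the circle to [a] without crossing [a];
    by Goursat's lemma the sums over the circle and over a small copy of it
    agree in the limit, and the latter is small since the slope is bounded. *)
Lemma circle_slope_mean0 g a s : (forall z, cdiff g z) -> 0 < s -> modc a < s ->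
  clim (fun K => (2 ^ K)%:R^-1 * \sum_(i < 2 ^ K)
    (g (node s K i) - g a) / (node s K i - a) * node s K i) 0.
Proof.
move=> gd s0 as_ e e0; have s_ge := ltW s0.
pose G z := (g z - g a) / (z - a).
have [l gl] := gd a; have [d0 d00 gd0] := gl 1 ltr01.
pose B := modc l + 1.
have B0 : 0 < B by rewrite ltr_wpDl ?modc_ge0.
have GB h : modc h <= d0 -> modc (G (a + h)) <= B.
  move=> hd; have [->|h0] := eqVneq h 0; first by rewrite /G addr0 !subrr mul0r modc0 ltW.
  have mh : 0 < modc h by rewrite modc_gt0.
  have -> : G (a + h) = (g (a + h) - g a - l * h) / h + l.
    by rewrite /G (addrC a h) addrK; field.
  rewrite /B [leRHS]addrC; apply: le_trans (modcD _ _) _; rewrite lerD2r modcM modcV.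
  by rewrite ler_pdivrMr // gd0.
pose z (y : R) := s%:C * cis (2 * pi * y).
have mz y : modc (z y) = s by rewrite modcM modc_real modc_cis mulr1 ger0_norm.
have za y : z y != a by apply: contraTneq as_ => <-; rewrite mz ltxx.
have mza y : modc (z y - a) <= 2 * s.
  by apply: le_trans (modcB _ _) _; rewrite mz mulr_natl mulr2n lerD2l ltW.
have pi0 : 0 < pi :> R := pi_gt0 R.
have zlip y y' : modc (z y - z y') <= 4 * pi * s * `|y - y'|.
  rewrite -mulrBr modcM modc_real ger0_norm //.
  apply: le_trans (ler_wpM2l s_ge (cis_lip _ _)) _.
  rewrite -mulrBr normrM gtr0_norm ?mulr_gt0 //.
  by rewrite le_eqVlt; apply/orP; left; apply/eqP; ring.
have [d [d_gt0 d1 dd0 dB]] : exists d : R, [/\ 0 < d, d <= 1, 2 * s * d <= d0 & B * d * (4 * pi * s) <= 2 * e].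
  have P0 : 0 < B * (4 * pi * s) by rewrite !mulr_gt0.
  exists (Num.min 1 (Num.min (d0 / (2 * s)) (2 * e / (B * (4 * pi * s))))).
  set d := Num.min _ _.
  have h1 : d <= 1 by rewrite ge_min lexx.
  have h2 : d <= d0 / (2 * s) by rewrite !ge_min lexx orbT.
  have h3 : d <= 2 * e / (B * (4 * pi * s)) by rewrite !ge_min lexx !orbT.
  split=> //; first by rewrite !lt_min ltr01 !divr_gt0 ?mulr_gt0.
    by move: h2; rewrite ler_pdivlMr ?mulr_gt0 // mulrC.
  by move: h3; rewrite ler_pdivlMr // mulrCA mulrA.
(* [x = 1] is the circle itself, [x = 0] its copy scaled by [d] around [a] *)
pose Phi (x y : R) := a + (d + (1 - d) * x)%:C * (z y - a).
have d_ge := ltW d_gt0.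
have wpos x : 0 <= x <= 1 -> 0 < d + (1 - d) * x <= 1.
  move=> /andP[x0 x1]; rewrite ltr_pwDl ?mulr_ge0 ?subr_ge0 //=.
  rewrite -lerBrDl; apply: ler_piMr => //; by rewrite subr_ge0.
pose L := 2 * s + 4 * pi * s.
have L0 : 0 <= L by rewrite addr_ge0 // !mulr_ge0 // ltW.
have PhiL x y x' y' : 0 <= x <= 1 -> 0 <= y <= 1 -> 0 <= x' <= 1 -> 0 <= y' <= 1 ->
  modc (Phi x y - Phi x' y') <= L * (`|x - x'| + `|y - y'|).
  move=> hx _ /wpos/andP[w0 w1] _.
  have -> : Phi x y - Phi x' y' = ((1 - d) * (x - x'))%:C * (z y - a) + (d + (1 - d) * x')%:C * (z y - z y').
    have -> : ((1 - d) * (x - x'))%:C = (d + (1 - d) * x)%:C - (d + (1 - d) * x')%:C.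
      by rewrite -rmorphB; congr (_%:C); ring.
    by rewrite /Phi; ring.
  apply: le_trans (modcD _ _) _; rewrite !modcM !modc_real normrM.
  have p1 : `|1 - d| * `|x - x'| * modc (z y - a) <= 2 * s * `|x - x'|.
    rewrite [leRHS]mulrC; apply: ler_pM => //; rewrite ?mulr_ge0 ?modc_ge0 //.
    by rewrite ler_piMl // ger0_norm ?subr_ge0 // gerBl.
  have p2 : `|d + (1 - d) * x'| * modc (z y - z y') <= 4 * pi * s * `|y - y'|.
    apply: le_trans (zlip y y'); rewrite ler_piMl ?modc_ge0 //.
    by rewrite gtr0_norm.
  apply: le_trans (lerD p1 p2) _.
  have q1 : 0 <= 2 * s * `|y - y'| by rewrite !mulr_ge0.
  have q2 : 0 <= 4 * pi * s * `|x - x'| by rewrite !mulr_ge0 // ltW.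
  have -> : L * (`|x - x'| + `|y - y'|) = 2 * s * `|x - x'| + 4 * pi * s * `|y - y'| +
     (2 * s * `|y - y'| + 4 * pi * s * `|x - x'|) by rewrite /L; ring.
  by rewrite lerDl addr_ge0.
have Gdiff x y : 0 <= x <= 1 -> 0 <= y <= 1 -> cdiff G (Phi x y).
  move=> /wpos/andP[w0 _] _; apply: cdiff_slope; last exact: gd.
  rewrite /Phi -subr_eq0 addrC addKr mulf_neq0 ?subr_eq0 //.
  by rewrite -modc_gt0 modc_real gtr0_norm.
have [K0 HK] := goursat L0 PhiL Gdiff (mulr_gt0 (ltr0n R 2) e0).
exists (maxn K0 2) => -[|[|K]]; rewrite geq_max ?andbF // => /andP[/HK {}HK _].
rewrite subr0; set N := (2 ^ K.+2)%N in HK *; set h := 2^-1 ^+ K.+2 in HK.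
have h0 : 0 < h by rewrite exprn_gt0 // invr_gt0.
have Nh : N%:R * h = 1.
  by rewrite /N /h natrX -exprMn mulfV ?expr1n // pnatr_eq0.
have z01 : z 1 = z 0.
  by rewrite /z mulr1 mulr0 cis0 mulr_natl /cis cos2pi sin2pi.
move: HK; rewrite /square_sum Nh !add0r.
(* the circle closes up, so the sides [y = 0] and [y = 1] cancel *)
have -> : path_sum G (fun i => Phi (0 + i%:R * h) 1) N = path_sum G (fun i => Phi (0 + i%:R * h) 0) N.
  by apply: eq_path_sum => i; rewrite /Phi z01.
rewrite [path_sum _ _ _ + _]addrC addrK.
have -> : path_sum G (fun i => Phi 1 (0 + i%:R * h)) N = path_sum G (node s K.+2) N.
  apply: eq_path_sum => i; rewrite /Phi mulr1 subrKC mul1r addrC subrK add0r.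
  by rewrite /z /node -cisMn /h; congr (_ * cis _); ring.
have small : modc (path_sum G (fun i => Phi 0 (0 + i%:R * h)) N) <= 2 * e.
  have -> : 2 * e = N%:R * (B * (2 * e / B * h)).
    have Bn0 : B != 0 by rewrite gt_eqF.
    have -> : N%:R * (B * (2 * e / B * h)) = (N%:R * h) * (2 * e) * (B / B) by ring.
    by rewrite Nh mul1r divff // mulr1.
  apply: path_sum_le => [|i _|i _]; first exact: ltW.
    apply: GB; rewrite mulr0 addr0 modcM modc_real ger0_norm //; apply: le_trans dd0.
    by rewrite mulrC ler_wpM2r.
  have -> : Phi 0 (0 + i.+1%:R * h) - Phi 0 (0 + i%:R * h) = d%:C * (z (i.+1%:R * h) - z (i%:R * h)).
    by rewrite /Phi mulr0 addr0 !add0r; ring.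
  rewrite modcM modc_real ger0_norm //.
  apply: le_trans (ler_wpM2l d_ge (zlip _ _)) _.
  rewrite -[i.+1]addn1 natrD -mulrBl addrC addKr mul1r gtr0_norm // mulrA ler_wpM2r ?(ltW h0) //.
  by rewrite ler_pdivlMr // mulrC mulrA.
move=> HK.
have {HK small} : modc (path_sum G (node s K.+2) N) <= 4 * e.
  have := modc_sub_ge (path_sum G (node s K.+2) N) (path_sum G (fun i => Phi 0 (0 + i%:R * h)) N).
  clear - HK small; lra.
rewrite path_sum_circle -/N modcM modcM modcV modc_nat => HK.
rewrite modcM modcV modc_nat.
have := @unit_root_chord R K; rewrite -/N => ch.
set S := \sum_(i < N) _; have S0 := modc_ge0 S.
have N0 : 0 < N%:R :> R by rewrite ltr0n expn_gt0.
rewrite mulrC ler_pdivrMr //.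
set W := modc (_ - _) in ch HK.
have W0 : 0 <= W := modc_ge0 _.
have : 8 * modc S <= N%:R * (8 * e).
  apply: (@le_trans _ _ (W * N%:R * modc S)); first by rewrite ler_wpM2r.
  rewrite mulrAC mulrC ler_wpM2l ?(ltW N0) //.
  move: HK; rewrite -/S mulrAC ler_pdivrMr //; lra.
lra.
Qed.

(** Discrete Fourier coefficients on the circle of radius [s]: the coefficients
    of the polynomial interpolating [g] at the [2 ^ K] nodes. *)
Definition dft g s K n : R[i] :=
  (2 ^ K)%:R^-1 * \sum_(i < 2 ^ K) g (node s K i) / node s K i ^+ n.

Lemma modc_dft_le g s K n (M : R) : 0 < s -> (forall z, modc z <= s -> modc (g z) <= M) ->
  modc (dft g s K n) * s ^+ n <= M.
Proof.
move=> s0 gM; rewrite modcM modcV modc_nat -ler_pdivlMr ?exprn_gt0 //.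
have N0 : 0 < (2 ^ K)%:R :> R by rewrite ltr0n expn_gt0.
rewrite ler_pdivrMl //.
apply: le_trans (modc_sum _ _ _) _.
rewrite -[(2 ^ K)%N in leRHS]card_ord -sum1_card natr_sum mulr_suml; apply: ler_sum => i _.
rewrite mul1r modcM modcV modcX modc_node ?(ltW s0) // ler_pM2r ?invr_gt0 ?exprn_gt0 //.
by apply: gM; rewrite modc_node // ltW.
Qed.

Lemma dft_const1 s K n : 0 < s -> (n < 2 ^ K)%N -> dft (fun=> 1) s K n = (n == 0)%:R.
Proof.
move=> s0 nK; rewrite /dft; have s1 : s%:C != 0 by rewrite -modc_gt0 modc_real gtr0_norm.
have N0 : (2 ^ K)%:R != 0 :> R[i] by rewrite pnatr_eq0 expn_eq0.
case: n nK => [|n] nK.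
  under eq_bigr do rewrite expr0 divr1.
  by rewrite sumr_const card_ord mulVf.
have E i : 1 / node s K i ^+ n.+1 = (s%:C ^+ n.+1)^-1 * (unit_root R K ^+ (2 ^ K - n.+1)) ^+ i.
  rewrite mul1r /node exprMn invfM; congr (_ * _).
  apply: (mulrI (x := unit_root R K ^+ i ^+ n.+1)); first by rewrite unitfE !expf_neq0 ?unit_root_neq0.
  rewrite mulfV ?expf_neq0 ?unit_root_neq0 //.
  by rewrite [unit_root R K ^+ i ^+ _]exprAC -exprMn -exprD subnKC ?(ltnW nK) // unit_root_pow2 expr1n.
under eq_bigr do rewrite E.
rewrite -mulr_sumr unit_root_sum0 ?mulr0 //.
by rewrite gtnNdvd ?subn_gt0 // ltn_subrL expn_gt0.
Qed.

(** The interpolating polynomial at [a] is [1 - (a / s) ^ (2 ^ K)] times the mean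
    of [g(z) z / (z - a)] over the nodes.  For [g = 1] it is [1], so its difference
    from [g a] is the same multiple of a mean of slopes, which tends to [0]. *)
Lemma interpolation_cvg g a s : (forall z, cdiff g z) -> 0 < s -> modc a < s ->
  clim (fun K => \sum_(n < 2 ^ K) dft g s K n * a ^+ n) (g a).
Proof.
move=> gd s0 as_.
have za K i : node s K i != a by apply: contraTneq as_ => <-; rewrite modc_node ?(ltW s0) // ltxx.
have s1 : s%:C != 0 by rewrite -modc_gt0 modc_real gtr0_norm.
pose Q K := (a / s%:C) ^+ (2 ^ K).
have Q2 K : modc (1 - Q K) <= 2.
  apply: le_trans (modcB _ _) _; rewrite modc1 /Q modcX modcM modcV modc_real gtr0_norm //.
  rewrite -[leRHS]/(1 + 1) lerD2l exprn_ile1 ?divr_ge0 ?modc_ge0 ?(ltW s0) //.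
  by rewrite ler_pdivrMr // mul1r ltW.
have sumE f K : \sum_(n < 2 ^ K) dft f s K n * a ^+ n =
    (1 - Q K) * ((2 ^ K)%:R^-1 * \sum_(i < 2 ^ K) f (node s K i) / (node s K i - a) * node s K i).
  rewrite /dft; under eq_bigr => n _ do rewrite -mulrA mulr_suml.
  rewrite -mulr_sumr exchange_big /= [RHS]mulrCA; congr (_ * _).
  rewrite mulr_sumr; apply: eq_bigr => i _.
  have z0 := node_neq0 K i s0; set z := node s K i in z0 *.
  have zaz : z - a != 0 by rewrite subr_eq0; exact: za.
  have -> : \sum_(n < 2 ^ K) f z / z ^+ n * a ^+ n = f z * \sum_(n < 2 ^ K) (a / z) ^+ n.
    by rewrite mulr_sumr; apply: eq_bigr => n _; rewrite expr_div_n -mulrA [_ * a ^+ n]mulrC.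
  have q1 : a / z - 1 != 0.
    by rewrite -(mulfV z0) -mulrBl mulf_neq0 ?invr_eq0 // -opprB oppr_eq0.
  have -> : \sum_(n < 2 ^ K) (a / z) ^+ n = (Q K - 1) / (a / z - 1).
    have -> : Q K = (a / z) ^+ (2 ^ K).
      by rewrite /Q !expr_div_n node_pow2.
    by rewrite subrX1 mulrAC divff // mul1r.
  by field; rewrite zaz z0 mulN1r -opprB oppr_eq0 zaz.
have E1 K : (1 - Q K) * ((2 ^ K)%:R^-1 * \sum_(i < 2 ^ K) 1 / (node s K i - a) * node s K i) = 1.
  rewrite -(sumE (fun=> 1)) -(prednK (n := 2 ^ K)) ?expn_gt0 // big_ord_recl big1 ?addr0.
    by rewrite dft_const1 ?expn_gt0 // mul1r expr0.
  move=> i _; rewrite dft_const1 ?mul0r //= /bump /= add1n.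
  by rewrite -[X in (_ < X)%N](prednK (n := 2 ^ K)) ?expn_gt0 // ltnS.
apply: (@clim_eventually R (fun K => (1 - Q K) * ((2 ^ K)%:R^-1 * \sum_(i < 2 ^ K)
    (g (node s K i) - g a) / (node s K i - a) * node s K i) + g a) _ _ 0).
  move=> K _; rewrite sumE.
  have -> : \sum_(i < 2 ^ K) g (node s K i) / (node s K i - a) * node s K i =
      \sum_(i < 2 ^ K) (g (node s K i) - g a) / (node s K i - a) * node s K i +
      g a * \sum_(i < 2 ^ K) 1 / (node s K i - a) * node s K i.
    by rewrite mulr_sumr -big_split; apply: eq_bigr => i _ /=; rewrite mul1r; ring.
  rewrite !mulrDr; congr (_ + _).
  by rewrite (mulrCA _ (g a)) (mulrCA _ (g a)) E1 mulr1.
rewrite -[X in clim _ X]add0r; apply: climD; last exact: clim_cst.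
move=> e e0; have [N HN] := circle_slope_mean0 gd s0 as_ (divr_gt0 e0 (ltr0n R 2)).
exists N => K /HN; rewrite !subr0 => H; rewrite modcM.
apply: le_trans (ler_pM (modc_ge0 _) (modc_ge0 _) (Q2 K) H) _.
by rewrite mulrC divfK.
Qed.

End CauchyInterpolation.

(** * Power series *)

Section PowerSeries.
Variable R : realType.
Implicit Types (g : R[i] -> R[i]) (c : nat -> R[i]) (a : R[i]) (s rho B : R).

Definition psum c N a : R[i] := \sum_(k < N) c k * a ^+ k.

(** The coefficient bound is part of the notion because, unlike convergence on a
    given disc, it passes to limits. *)
Definition power_series rho B c g :=
  (forall k, modc (c k) * rho ^+ k <= B) /\
  forall a, modc a < rho -> clim (fun N => psum c N a) (g a).

Lemma geometric_small (q C e : R) : 0 <= q -> q < 1 -> 0 < e ->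
  exists N0, forall N, (N0 <= N)%N -> C * q ^+ N <= e.
Proof.
move=> q0 q1 e0; have C1 : 0 < `|C| + 1 by rewrite ltr_wpDl.
have /cvgrPdist_le /(_ _ (divr_gt0 e0 C1)) [N0 _ H] : GRing.exp q @ \oo --> (0 : R).
  by apply: cvg_expr; rewrite ger0_norm.
exists N0 => N /H /=; rewrite sub0r normrN ger0_norm ?exprn_ge0 // => le.
apply: (@le_trans _ _ ((`|C| + 1) * q ^+ N)).
  rewrite ler_wpM2r ?exprn_ge0 // (le_trans (ler_norm C)) // lerDl //.
by rewrite mulrC -ler_pdivlMr.
Qed.

Lemma sum_half_powers (F : fieldType) K : 2 != 0 :> F ->
  \sum_(n < K) 2^-1 ^+ n = 2 * (1 - 2^-1 ^+ K) :> F.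
Proof.
move=> F2; elim: K => [|K IH]; first by rewrite big_ord0 expr0 subrr mulr0.
by rewrite big_ord_recr IH /= exprS; field.
Qed.

Lemma power_series_tail rho B c g q a N : power_series rho B c g -> 0 <= q -> q < 1 ->
  modc a < rho -> modc a <= q * rho -> modc (g a - psum c N a) <= B / (1 - q) * q ^+ N.
Proof.
move=> [cB cg] q0 q1 arho aq; have q10 : 0 < 1 - q by rewrite subr_gt0.
have term k : modc (c k * a ^+ k) <= B * q ^+ k.
  rewrite modcM modcX; apply: (@le_trans _ _ (modc (c k) * (q * rho) ^+ k)).
    rewrite ler_wpM2l ?modc_ge0 // lerXn2r // ?nnegrE ?modc_ge0 //.
    exact: le_trans (modc_ge0 _) aq.
  by rewrite exprMn mulrCA mulrC ler_wpM2r ?exprn_ge0.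
have part m : modc (psum c (N + m) a - psum c N a) <= B / (1 - q) * q ^+ N * (1 - q ^+ m).
  elim: m => [|m IH]; first by rewrite addn0 subrr modc0 expr0 subrr mulr0.
  rewrite addnS /psum big_ord_recr /= addrAC; apply: le_trans (modcD _ _) _.
  apply: le_trans (lerD IH (term _)) _.
  rewrite le_eqVlt; apply/orP; left; apply/eqP; rewrite exprD exprS; field.
  by rewrite gt_eqF.
have B0 : 0 <= B by apply: le_trans (cB 0%N); rewrite mulr_ge0 ?modc_ge0.
apply: (@clim_le R (fun M => psum c M a - psum c N a) _ _ N); last first.
  by apply: climB; [exact: cg|exact: clim_cst].
move=> M NM; rewrite -(subnKC NM); apply: le_trans (part _) _.
rewrite ler_piMr ?mulr_ge0 ?exprn_ge0 // ?invr_ge0 ?(ltW q10) //.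
by rewrite gerBl exprn_ge0.
Qed.

Lemma dft_sub g h s K k :
  dft (fun z => g z - h z) s K k = dft g s K k - dft h s K k.
Proof. by rewrite /dft -mulrBr -sumrB; congr (_ * _); apply: eq_bigr => i _; rewrite mulrBl. Qed.

Lemma dft_monomial s K j k : 0 < s -> (j < 2 ^ K)%N -> (k < 2 ^ K)%N ->
  dft (fun z => z ^+ j) s K k = (j == k)%:R.
Proof.
move=> s0 jK kK; case: (leqP j k) => jk.
  have -> : dft (fun z => z ^+ j) s K k = dft (fun=> 1) s K (k - j).
    congr (_ * _); apply: eq_bigr => i _.
    rewrite -{1}(subnKC jk) exprD invfM mulrA divff // expf_neq0 //.
    exact: node_neq0.
  rewrite dft_const1 ?(leq_ltn_trans (leq_subr _ _) kK) // subn_eq0.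
  by rewrite eqn_leq jk.
rewrite gtn_eqF // /dft (eq_bigr (fun i : 'I_(2 ^ K) => s%:C ^+ (j - k) * (unit_root R K ^+ (j - k)) ^+ i)).
  rewrite -mulr_sumr unit_root_sum0 ?mulr0 // gtnNdvd ?subn_gt0 //.
  exact: leq_ltn_trans (leq_subr _ _) jK.
move=> i _; rewrite -{1}(subnK (ltnW jk)) exprD mulfK ?expf_neq0 ?node_neq0 //.
by rewrite /node exprMn exprAC.
Qed.

Lemma dft_psum c s K k : 0 < s -> (k < 2 ^ K)%N ->
  dft (psum c (2 ^ K)) s K k = c k.
Proof.
move=> s0 kK.
have -> : dft (psum c (2 ^ K)) s K k = \sum_(j < 2 ^ K) c j * dft (fun z => z ^+ j) s K k.
  rewrite /dft /psum; under eq_bigr => i _ do rewrite mulr_suml.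
  rewrite exchange_big mulr_sumr; apply: eq_bigr => j _ /=.
  rewrite mulrCA; congr (_ * _); rewrite mulr_sumr.
  by apply: eq_bigr => i _; rewrite mulrA.
rewrite (bigD1 (Ordinal kK)) //= dft_monomial // eqxx mulr1 big1 ?addr0 // => j jk.
rewrite dft_monomial //; move: jk; rewrite -val_eqE /= => /negbTE ->.
by rewrite mulr0.
Qed.

Lemma dft_power_series rho B c g s K k : power_series rho B c g -> 0 < s -> s <= rho / 2 ->
  (k < 2 ^ K)%N -> modc (dft g s K k - c k) * s ^+ k <= B * 2 * (2^-1) ^+ (2 ^ K).
Proof.
move=> ps s0 srho kK.
rewrite -{1}(@dft_psum c s K k) // -dft_sub; apply: modc_dft_le => // z zs.
have half1 : (2^-1 : R) < 1 by lra.
have half0 : 0 <= (2^-1 : R) by lra.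
have := @power_series_tail rho B c g 2^-1 z (2 ^ K) ps half0 half1.
have -> : B / (1 - 2^-1) = B * 2 by field.
apply; [lra|].
by rewrite mulrC; exact: le_trans zs srho.
Qed.

(** Discrete coefficients of a polynomial of degree below the number of nodes are
    exact, and the tail of the series is geometrically small on the circle. *)
Lemma clim_dft rho B c g s k : power_series rho B c g -> 0 < s -> s <= rho / 2 ->
  clim (fun K => dft g s K k) (c k).
Proof.
move=> ps s0 srho e e0; have sk0 : 0 < s ^+ k by rewrite exprn_gt0.
have [|||N0 HN] := @geometric_small 2^-1 (B * 2) (e * s ^+ k); [lra|lra|exact: mulr_gt0|].
exists (maxn k N0) => K; rewrite geq_max => /andP[kK NK].
have kK2 : (k < 2 ^ K)%N by apply: leq_ltn_trans kK (ltn_expl _ _).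
rewrite -(ler_pM2r sk0); apply: le_trans (dft_power_series ps s0 srho kK2) _.
by apply: HN; apply: leq_trans NK (ltnW (ltn_expl _ _)).
Qed.

(** Cauchy's estimate, inherited from the discrete coefficients, for which it is
    the triangle inequality. *)
Lemma power_series_coef_le rho B c g s M k : power_series rho B c g -> 0 < s -> s <= rho / 2 ->
  (forall z, modc z <= s -> modc (g z) <= M) -> modc (c k) * s ^+ k <= M.
Proof.
move=> ps s0 srho gM; have sk0 : 0 < s ^+ k by rewrite exprn_gt0.
rewrite -ler_pdivlMr //.
apply: (@clim_le R (fun K => dft g s K k) _ _ 0); last exact: clim_dft ps s0 srho.
by move=> K _; rewrite ler_pdivlMr //; exact: modc_dft_le.
Qed.

Lemma power_series_unique rho rho' B B' c c' g : 0 < rho -> 0 < rho' ->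
  power_series rho B c g -> power_series rho' B' c' g -> c = c'.
Proof.
move=> r0 r0' ps ps'; apply/funext => k.
pose s := Num.min (rho / 2) (rho' / 2).
have s0 : 0 < s by rewrite lt_min !divr_gt0.
apply: (@clim_unique R (fun K => dft g s K k)).
  by apply: clim_dft ps s0 _; rewrite ge_min lexx.
by apply: clim_dft ps' s0 _; rewrite ge_min lexx orbT.
Qed.

(** For a fixed number of nodes the discrete coefficients converge with the
    functions, and they are close to the true coefficients uniformly in [n] by
    the common bound [B]; so the coefficients form Cauchy sequences.  The tails
    are also uniformly small, which identifies the limit function with the sum of
    the limit series. *)
Lemma power_series_closed rho B (cn : nat -> nat -> R[i]) (gn : nat -> R[i] -> R[i]) g :
  0 < rho -> (forall n, power_series rho B (cn n) (gn n)) ->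
  (forall a, modc a < rho -> clim (fun n => gn n a) (g a)) ->
  exists2 c, power_series rho B c g & forall k, clim (fun n => cn n k) (c k).
Proof.
move=> r0 psn gl; pose s := rho / 2.
have s0 : 0 < s by rewrite divr_gt0.
have lim_c k : exists l, clim (fun n => cn n k) l.
  apply: cauchy_clim => e e0; have sk0 : 0 < s ^+ k by rewrite exprn_gt0.
  have [|||N0 HN] := @geometric_small 2^-1 (B * 2) (e / 4 * s ^+ k); [lra|lra|by rewrite mulr_gt0 ?divr_gt0|].
  pose K := maxn k N0.
  have kK2 : (k < 2 ^ K)%N by apply: leq_ltn_trans (leq_maxl k N0) (ltn_expl _ _).
  have close n : modc (dft (gn n) s K k - cn n k) <= e / 4.
    rewrite -(ler_pM2r sk0); apply: le_trans (dft_power_series (psn n) s0 (lexx _) kK2) _.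
    by apply: HN; apply: leq_trans (leq_maxr k N0) (ltnW (ltn_expl _ _)).
  have : clim (fun n => dft (gn n) s K k) (dft g s K k).
    apply: climZ; apply: clim_sum => i.
    apply: (@clim_eventually R (fun n => (node s K i ^+ k)^-1 * gn n (node s K i)) _ _ 0).
      by move=> n _; rewrite mulrC.
    rewrite mulrC; apply: climZ; apply: gl.
    by rewrite modc_node ?ltW // /s; lra.
  move=> /(_ (e / 4) (divr_gt0 e0 (ltr0n R 4))) [N1 HN1].
  exists N1 => m n /HN1 hm /HN1 hn; have cm := close m; have cn' := close n.
  have -> : cn m k - cn n k = (dft (gn m) s K k - dft g s K k) - (dft (gn n) s K k - dft g s K k)
     - (dft (gn m) s K k - cn m k) + (dft (gn n) s K k - cn n k) by ring.
  apply: le_trans (modcD _ _) _; apply: le_trans (lerD (modcB _ _) (lexx _)) _.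
  apply: le_trans (lerD (lerD (modcB _ _) (lexx _)) (lexx _)) _.
  clear - hm hn cm cn'; lra.
pose c k := sval (cid (lim_c k)).
have cl k : clim (fun n => cn n k) (c k) := svalP (cid (lim_c k)).
have psum_lim N a : clim (fun n => psum (cn n) N a) (psum c N a).
  apply: clim_sum => k.
  apply: (@clim_eventually R (fun n => a ^+ k * cn n k) _ _ 0); first by move=> n _; rewrite mulrC.
  by rewrite mulrC; apply: climZ.
exists c => //; split=> [k|a arho].
  have rk0 : 0 < rho ^+ k by rewrite exprn_gt0.
  rewrite -ler_pdivlMr //; apply: (@clim_le R (fun n => cn n k) _ _ 0) => // n _.
  by rewrite ler_pdivlMr //; case: (psn n).
have q1 : modc a / rho < 1 by rewrite ltr_pdivrMr // mul1r.
have q0 : 0 <= modc a / rho by rewrite divr_ge0 ?modc_ge0 // ltW.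
set q := modc a / rho in q0 q1.
apply: (@clim_squeeze R _ _ (fun N => B / (1 - q) * q ^+ N)) => [e e0|N].
  exact: geometric_small.
rewrite modcBC; apply: (@clim_le R (fun n => gn n a - psum (cn n) N a) _ _ 0); last first.
  by apply: climB; [exact: gl|exact: psum_lim].
move=> n _; apply: power_series_tail (psn n) _ _ _ _ => //.
by rewrite /q divfK // gt_eqF.
Qed.

(** The interpolating polynomials are power series with the common bound [M]. *)
Lemma cdiff_power_series g s M : (forall z, cdiff g z) -> 0 < s ->
  (forall z, modc z <= s -> modc (g z) <= M) -> exists c, power_series s M c g.
Proof.
move=> gd s0 gM.
pose cn K n := if (n < 2 ^ K)%N then dft g s K n else 0.
pose gn K a := psum (cn K) (2 ^ K) a.
have [||c ps _] := @power_series_closed s M cn gn g s0; last by exists c.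
  move=> K; split=> [k|a _].
    rewrite /cn; case: ifP => _; first exact: modc_dft_le.
    by rewrite modc0 mul0r; apply: le_trans (gM 0 _); rewrite ?modc_ge0 // modc0 ltW.
  apply: (@clim_eventually R (fun=> gn K a) _ _ (2 ^ K)); last exact: clim_cst.
  move=> N KN; rewrite /gn /psum -(subnKC KN) big_split_ord /= [X in _ = _ + X]big1 ?addr0 // => i _.
  by rewrite /cn ltnNge leq_addr mul0r.
move=> a as_; apply: (@clim_eventually R _ _ _ 0 _ (interpolation_cvg gd s0 as_)) => K _.
by apply: eq_bigr => n _; rewrite /cn ltn_ord.
Qed.

Definition entire_series c g := forall rho, 0 < rho -> exists B, power_series rho B c g.

Lemma entire_series_of_discs g :
  (forall rho, 0 < rho -> exists B, exists c, power_series rho B c g) ->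
  exists c, entire_series c g.
Proof.
move=> H; have [B [c ps]] := H 1 ltr01; exists c => rho r0.
have [B' [c' ps']] := H rho r0; exists B'.
by rewrite (power_series_unique ltr01 r0 ps ps').
Qed.

Lemma cdiff_entire_series g : (forall z, cdiff g z) ->
  (forall s, exists M, forall z, modc z <= s -> modc (g z) <= M) ->
  exists c, entire_series c g.
Proof.
move=> gd gM; apply: entire_series_of_discs => rho r0.
have [M HM] := gM rho; exists M; exact: cdiff_power_series.
Qed.

End PowerSeries.

(** * Separately holomorphic functions *)

Section SeriesClosure.
Variable R : realType.
Implicit Types (g h : R[i] -> R[i]) (c : nat -> R[i]) (M s rho : R).

Lemma entire_seriesD c c' g h : entire_series c g -> entire_series c' h ->
  entire_series (fun k => c k + c' k) (fun a => g a + h a).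
Proof.
move=> cg ch rho r0; have [B [cB gl]] := cg rho r0; have [B' [cB' hl]] := ch rho r0.
exists (B + B'); split=> [k|a arho].
  apply: le_trans (lerD (cB k) (cB' k)); rewrite -mulrDl.
  by rewrite ler_wpM2r ?modcD // exprn_ge0 // ltW.
apply: (clim_eventually (N0 := 0)) (climD (gl a arho) (hl a arho)) => N _.
by rewrite /psum -big_split; apply: eq_bigr => k _; rewrite mulrDl.
Qed.

Lemma entire_seriesZ (w : R[i]) c g : entire_series c g ->
  entire_series (fun k => w * c k) (fun a => w * g a).
Proof.
move=> cg rho r0; have [B [cB gl]] := cg rho r0.
exists (modc w * B); split=> [k|a arho].
  by rewrite modcM -mulrA ler_wpM2l ?modc_ge0.
apply: (clim_eventually (N0 := 0)) (climZ w (gl a arho)) => N _.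
by rewrite /psum mulr_sumr; apply: eq_bigr => k _; rewrite mulrA.
Qed.

Lemma entire_series_cst (v : R[i]) : entire_series (fun k => if k == 0%N then v else 0) (fun=> v).
Proof.
move=> rho r0; exists (modc v); split=> [[|k]|a arho].
- by rewrite expr0 mulr1.
- by rewrite modc0 mul0r modc_ge0.
apply: (@clim_eventually R (fun=> v) _ _ 1); last exact: clim_cst.
case=> // N _; rewrite /psum big_ord_recl expr0 mulr1 big1 ?addr0 // => k _.
by rewrite mul0r.
Qed.

Lemma eq_entire_series c g h : g =1 h -> entire_series c g -> entire_series c h.
Proof. by move=> /funext ->. Qed.

Lemma entire_series_sum (I : Type) (r : seq I) (w : I -> R[i]) (c : I -> nat -> R[i])
    (g : I -> R[i] -> R[i]) : (forall i, entire_series (c i) (g i)) ->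
  entire_series (fun k => \sum_(i <- r) w i * c i k) (fun a => \sum_(i <- r) w i * g i a).
Proof.
move=> cg; elim: r => [|i r IH].
  have -> : (fun k => \sum_(i <- [::]) w i * c i k) = (fun k => if k == 0%N then 0 else 0).
    by apply/funext => k; rewrite big_nil if_same.
  by apply: eq_entire_series (entire_series_cst 0) => a; rewrite big_nil.
have -> : (fun k => \sum_(j <- i :: r) w j * c j k) = (fun k => w i * c i k + \sum_(j <- r) w j * c j k).
  by apply/funext => k; rewrite big_cons.
apply: eq_entire_series (entire_seriesD (entire_seriesZ (w i) (cg i)) IH) => a.
by rewrite big_cons.
Qed.

Lemma entire_series_cauchy c g rho M : entire_series c g -> 0 < rho ->
  (forall z, modc z <= rho -> modc (g z) <= M) -> power_series rho M c g.
Proof.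
move=> cg r0 gM; have [|B ps] := cg (2 * rho); first exact: mulr_gt0.
split=> [k|a arho]; last by apply: ps.2; rewrite (lt_trans arho) // ltr_pMl // ltr1n.
by apply: power_series_coef_le ps r0 _ gM; rewrite mulrAC divff ?mul1r.
Qed.

Definition taylor g : nat -> R[i] := xget (fun=> 0) [set c | entire_series c g].

Lemma taylorP g : (exists c, entire_series c g) -> entire_series (taylor g) g.
Proof. by move=> [c cg]; rewrite /taylor; case: xgetP => [x _ //|/(_ c)]. Qed.

End SeriesClosure.

Section SeveralVariables.
Variables (R : realType) (d : nat).
Implicit Types (F : ('I_d -> R[i]) -> R[i]) (z : 'I_d -> R[i]) (i j : 'I_d) (s M : R).

Definition upd z j (t : R[i]) : 'I_d -> R[i] := fun i => if i == j then t else z i.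
Definition slice F z j : R[i] -> R[i] := fun t => F (upd z j t).

Lemma upd_id z j : upd z j (z j) = z.
Proof. by apply/funext => i; rewrite /upd; case: eqP => // ->. Qed.

Lemma upd_upd z j t u : upd (upd z j t) j u = upd z j u.
Proof. by apply/funext => i; rewrite /upd; case: eqP. Qed.

Lemma updC z i j t u : i != j -> upd (upd z i t) j u = upd (upd z j u) i t.
Proof.
move=> ij; apply/funext => k; rewrite /upd; case: (k =P j) => // ->.
by rewrite eq_sym (negbTE ij).
Qed.

Definition bounded_on F s M := forall z, (forall j, modc (z j) <= s) -> modc (F z) <= M.

(** Holomorphy of the slices is recorded as expansion in power series, and joint
    regularity as mere local boundedness: in this form the notion passes to the
    coefficient functions. *)
Definition separately_entire F :=
  (forall z j, exists c, entire_series c (slice F z j)) /\ (forall s, exists M, bounded_on F s M).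

Definition coef F j n : ('I_d -> R[i]) -> R[i] := fun z => taylor (slice F z j) n.

Lemma bounded_slice F s M z j t : bounded_on F s M -> (forall i, modc (z i) <= s) ->
  modc t <= s -> modc (slice F z j t) <= M.
Proof. by move=> FM zs ts; apply: FM => i; rewrite /upd; case: eqP. Qed.

Lemma coef_upd F j n z t : coef F j n (upd z j t) = coef F j n z.
Proof. by congr (taylor _ n); apply/funext => u; rewrite /slice upd_upd. Qed.

Lemma slice_cauchy F s M z j : separately_entire F -> 0 < s -> bounded_on F s M ->
  (forall i, modc (z i) <= s) -> power_series s M (coef F j ^~ z) (slice F z j).
Proof.
move=> [FS _] s0 FM zs; apply: entire_series_cauchy => //.
  exact: taylorP.
by move=> t; exact: bounded_slice.
Qed.

Lemma bounded_coef F s M j n : separately_entire F -> 0 < s -> bounded_on F s M ->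
  bounded_on (coef F j n) s (M / s ^+ n).
Proof.
move=> FS s0 FM z zs; rewrite ler_pdivlMr ?exprn_gt0 //.
exact: (slice_cauchy j FS s0 FM zs).1.
Qed.

(** A coefficient in the variable [j] is a pointwise limit of discrete
    coefficients, which are finite linear combinations of slices; as functions of
    another variable these are power series with a common bound, so the limit is
    one as well. *)
Lemma separately_entire_coef F j n : separately_entire F -> separately_entire (coef F j n).
Proof.
move=> FS; split; last first.
  move=> s; have [M FM] := FS.2 (Num.max s 1).
  have s0 : 0 < Num.max s 1 by rewrite lt_max ltr01 orbT.
  exists (M / Num.max s 1 ^+ n) => z zs; apply: (bounded_coef j n FS s0 FM) => i.
  by rewrite le_max zs.
move=> z i; have [->|ij] := eqVneq i j.
  exists (fun k => if k == 0%N then coef F j n z else 0).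
  by apply: eq_entire_series (entire_series_cst _) => t; rewrite /slice coef_upd.
apply: entire_series_of_discs => rho r0.
pose S := Num.max rho 1 + \sum_l modc (z l).
have zS l : modc (z l) <= S.
  rewrite /S (bigD1 l) //= addrCA lerDl addr_ge0 ?sumr_ge0 // => [|k _]; last exact: modc_ge0.
  by rewrite le_max ler01 orbT.
have rS : Num.max rho 1 <= S by rewrite lerDl sumr_ge0 // => l _; exact: modc_ge0.
have [M FM] := FS.2 S.
pose gn K t := dft (slice F (upd z i t) j) 1 K n.
pose cn K k := \sum_(l < 2 ^ K) ((2 ^ K)%:R^-1 / node 1 K l ^+ n) *
  taylor (slice F (upd z j (node 1 K l)) i) k.
have node1 K l : modc (node (1 : R) K l) <= S.
  by rewrite modc_node // (le_trans _ rS) // le_max lexx orbT.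
have updS t : modc t <= rho -> forall l, modc (upd z i t l) <= S.
  move=> tr l; rewrite /upd; case: eqP => // _; apply: le_trans rS.
  by rewrite le_max tr.
have gM K t : modc t <= rho -> modc (gn K t) <= M.
  move=> tr; have := @modc_dft_le R (slice F (upd z i t) j) 1 K n M ltr01.
  rewrite expr1n mulr1; apply=> u u1; apply: bounded_slice FM _ _.
    exact: updS.
  by apply: le_trans u1 (le_trans _ rS); rewrite le_max lexx orbT.
have [||c ps _] := @power_series_closed R rho M cn gn (slice (coef F j n) z i) r0; last by exists M, c.
  move=> K; apply: entire_series_cauchy => //; last by move=> t; exact: gM.
  have := @entire_series_sum R _ (index_enum 'I_(2 ^ K)) (fun l => (2 ^ K)%:R^-1 / node 1 K l ^+ n)
     _ _ (fun l => taylorP (FS.1 (upd z j (node 1 K l)) i)).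
  apply: eq_entire_series => t; rewrite /gn /dft mulr_sumr; apply: eq_bigr => l _.
  by rewrite /slice (updC z _ _ ij) mulrAC mulrA.
move=> t tr; have [B ps] := taylorP (FS.1 (upd z i t) j) (ltr0n R 2).
by apply: clim_dft ps _ _ => //; rewrite divff.
Qed.

Fixpoint nested_sum (js : seq 'I_d) F K z : R[i] :=
  if js is j :: js' then \sum_(n < K) z j ^+ n * nested_sum js' (coef F j n) K z
  else F z.

(** Replacing the function by its Taylor polynomial in one variable leaves a
    geometric tail; the errors of the coefficients in the other variables add up
    with weights [2 ^ - n], since the coefficient bound shrinks by [s ^ n]. *)
Lemma nested_sum_close js F K z s M : separately_entire F -> 0 < s -> bounded_on F s M ->
  (forall j, modc (z j) <= s / 2) ->
  modc (F z - nested_sum js F K z) <= M * (4 ^+ size js * 2 * 2^-1 ^+ K).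
Proof.
move=> + s0 + zs; elim: js F M => [|j js IH] F M FS FM /=.
  have M0 : 0 <= M.
    by apply: le_trans (FM (fun=> 0) _); rewrite ?modc_ge0 // => k; rewrite modc0 ltW.
  by rewrite subrr modc0 mulr_ge0.
have zs' i : modc (z i) <= s by apply: le_trans (zs i) _; lra.
have M0 : 0 <= M := le_trans (modc_ge0 _) (FM z zs').
pose T := \sum_(n < K) z j ^+ n * coef F j n z.
have tail : modc (F z - T) <= M * 2 * 2^-1 ^+ K.
  have := @power_series_tail R s M _ _ 2^-1 (z j) K (slice_cauchy j FS s0 FM zs').
  rewrite /slice upd_id /psum (_ : M / (1 - 2^-1) = M * 2); last by field.
  rewrite (eq_bigr (fun n : 'I_K => z j ^+ n * coef F j n z)) => [|n _]; last by rewrite mulrC.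
  by apply; [lra|lra|apply: le_lt_trans (zs j) _; lra|rewrite mulrC].
have rest : modc (T - \sum_(n < K) z j ^+ n * nested_sum js (coef F j n) K z) <=
    2 * (M * (4 ^+ size js * 2 * 2^-1 ^+ K)).
  set C := M * _; have C0 : 0 <= C by rewrite mulr_ge0 // mulr_ge0 ?mulr_ge0 ?exprn_ge0.
  rewrite -sumrB; apply: le_trans (modc_sum _ _ _) _.
  apply: (@le_trans _ _ (\sum_(n < K) 2^-1 ^+ n * C)).
    apply: ler_sum => n _; rewrite -mulrBr modcM modcX.
    have := IH _ _ (separately_entire_coef j n FS) (bounded_coef j n FS s0 FM).
    have -> : M / s ^+ n * (4 ^+ size js * 2 * 2^-1 ^+ K) = C / s ^+ n by rewrite mulrAC.
    move=> H; apply: (@le_trans _ _ ((s / 2) ^+ n * (C / s ^+ n))).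
      by rewrite ler_pM ?exprn_ge0 ?modc_ge0 // lerXn2r ?nnegrE ?modc_ge0 // divr_ge0 // ltW.
    rewrite exprMn mulrACA mulrC mulrA [X in _ <= X]mulrC.
    rewrite le_eqVlt; apply/orP; left; apply/eqP.
    have := expf_neq0 n (lt0r_neq0 s0); set sn := s ^+ n => sn0; field; exact: sn0.
  rewrite -mulr_suml ler_wpM2r //.
  by rewrite sum_half_powers ?pnatr_eq0 // ler_piMr // gerBl exprn_ge0.
apply: le_trans (modc_triangle _ T _) (le_trans (lerD tail rest) _).
have -> : M * 2 * 2^-1 ^+ K + 2 * (M * (4 ^+ size js * 2 * 2^-1 ^+ K)) =
   (M * 2^-1 ^+ K) * (2 + 4 ^+ size js * 4) by ring.
rewrite exprS.
have -> : M * (4 * 4 ^+ size js * 2 * 2^-1 ^+ K) = (M * 2^-1 ^+ K) * (4 ^+ size js * 8) by ring.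
rewrite ler_wpM2l ?mulr_ge0 ?exprn_ge0 //.
have : 1 <= 4 ^+ size js :> R by rewrite exprn_ege1 // ler1n.
clear; lra.
Qed.

End SeveralVariables.

(** * Taylor expansion in several variables *)

(** Multi-indices are plain sequences, and infinite sums over them are limits over
    boxes, because sums over boxes are nested sums in one variable. *)
Fixpoint box (l K : nat) : seq (seq nat) :=
  if l is l'.+1 then [seq n :: s | n <- iota 0 K, s <- box l' K] else [:: [::]].

Lemma size_box l K s : s \in box l K -> size s = l.
Proof.
elim: l s => [|l IH] s /=; first by rewrite inE => /eqP ->.
by move=> /allpairsP[[n t] /= [_ /IH <- ->]].
Qed.

Lemma mem_box l K s : (s \in box l K) = (size s == l) && all (ltn^~ K) s.
Proof.
elim: l s => [|l IH] [|n s] //=.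
  by apply/negbTE/negP => /allpairsP[[m t] /= [_ _]].
rewrite eqSS; apply/allpairsP/idP => [[[m t] /= [+ + [-> ->]]]|/and3P[sl nK sK]].
  by rewrite mem_iota add0n IH => /= -> /andP[-> ->].
by exists (n, s); rewrite mem_iota add0n IH sl nK sK.
Qed.

Lemma uniq_box l K : uniq (box l K).
Proof.
elim: l => [//|l IH] /=; apply: allpairs_uniq => //; first exact: iota_uniq.
by move=> [m s] [n t] _ _ /= [-> ->].
Qed.

Lemma sub_box l K K' s : (K <= K')%N -> s \in box l K -> s \in box l K'.
Proof.
move=> KK; rewrite !mem_box => /andP[-> /allP sK] /=.
by apply/allP => n /sK /= nK; exact: leq_trans KK.
Qed.

Lemma sum_box_geometric (R : realFieldType) l K :
  \sum_(s <- box l K) 2^-1 ^+ sumn s <= 2 ^+ l :> R.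
Proof.
elim: l => [|l IH]; first by rewrite big_seq1.
rewrite /= big_allpairs_dep /=.
have -> : \sum_(n <- iota 0 K) \sum_(s <- box l K) 2^-1 ^+ (n + sumn s) =
   (\sum_(n < K) 2^-1 ^+ n) * \sum_(s <- box l K) 2^-1 ^+ sumn s :> R.
  rewrite mulr_suml -(big_mkord predT (fun n => 2^-1 ^+ n * \sum_(s <- box l K) 2^-1 ^+ sumn s)).
  rewrite /index_iota subn0.
  by apply: eq_bigr => n _; rewrite mulr_sumr; apply: eq_bigr => s _; rewrite exprD.
have g : \sum_(n < K) 2^-1 ^+ n <= 2 :> R.
  by rewrite sum_half_powers ?pnatr_eq0 // ler_piMr // gerBl exprn_ge0.
rewrite exprS; apply: ler_pM => //; first by apply: sumr_ge0 => n _; rewrite exprn_ge0.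
by apply: sumr_ge0 => s _; rewrite exprn_ge0.
Qed.

Section BoxSums.
Variables (R : realType) (l : nat).

Lemma box_sum_diff (u : seq nat -> R[i]) K K' : (K <= K')%N ->
  \sum_(s <- box l K') u s - \sum_(s <- box l K) u s =
  \sum_(s <- box l K' | s \notin box l K) u s.
Proof.
move=> KK; rewrite (bigID (fun s => s \in box l K)) /= addrAC.
suff -> : \sum_(s <- box l K' | s \in box l K) u s = \sum_(s <- box l K) u s.
  by rewrite subrr add0r.
rewrite -big_filter; apply: perm_big; apply: uniq_perm; rewrite ?filter_uniq ?uniq_box //.
move=> s; rewrite mem_filter; case: (boolP (s \in box l K)) => //= sK.
by rewrite (sub_box KK).
Qed.

(** Of the decay [4 ^ - |s|], one factor [2 ^ - |s|] is summable and the other is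
    at most [2 ^ - K] off the box. *)
Lemma box_sum_cvg (u : seq nat -> R[i]) (B : R) : 0 <= B ->
  (forall s, size s = l -> modc (u s) <= B * 4^-1 ^+ sumn s) ->
  exists2 v, clim (fun K => \sum_(s <- box l K) u s) v & modc v <= B * 2 ^+ l.
Proof.
move=> B0 uB.
have four s : 4^-1 ^+ sumn s = 2^-1 ^+ sumn s * 2^-1 ^+ sumn s :> R.
  by rewrite -exprMn; congr (_ ^+ _); field.
have bound K (P : pred (seq nat)) (C : R) : 0 <= C ->
    (forall s, s \in box l K -> P s -> 2^-1 ^+ sumn s <= C) ->
    modc (\sum_(s <- box l K | P s) u s) <= B * C * 2 ^+ l.
  move=> C0 HP; apply: le_trans (modc_sum _ _ _) _.
  apply: (@le_trans _ _ (\sum_(s <- box l K | P s) (B * C) * 2^-1 ^+ sumn s)).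
    rewrite big_seq_cond [leRHS]big_seq_cond; apply: ler_sum => s /andP[sK Ps].
    apply: le_trans (uB s (size_box sK)) _; rewrite four -mulrA ler_wpM2l //.
    by rewrite ler_wpM2r ?exprn_ge0 // HP.
  rewrite -mulr_sumr ler_wpM2l ?mulr_ge0 //; apply: le_trans (sum_box_geometric R l K).
  rewrite [leRHS](bigID P) /= lerDl; apply: sumr_ge0 => s _; exact: exprn_ge0.
have half1 s : 2^-1 ^+ sumn s <= 1 :> R by rewrite exprn_ile1 //; lra.
have [|v uv] := @cauchy_clim R (fun K => \sum_(s <- box l K) u s).
  move=> e e0.
  have q1 : 2^-1 < 1 :> R by lra.
  have q0 : 0 <= 2^-1 :> R by lra.
  have [N HN] := @geometric_small R 2^-1 (B * 2 ^+ l) e q0 q1 e0.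
  have main m n : (N <= m)%N -> (m <= n)%N ->
      modc (\sum_(s <- box l n) u s - \sum_(s <- box l m) u s) <= e.
    move=> Nm mn; rewrite box_sum_diff //; apply: le_trans (HN m Nm).
    rewrite mulrAC; apply: bound; first exact: exprn_ge0.
    move=> s; rewrite mem_box => /andP[sl _]; rewrite mem_box sl /= => /allPn[k ks].
    rewrite -leqNgt => mk.
    have ksum : (k <= sumn s)%N.
      move: ks; clear; elim: s => //= a s IH; rewrite inE => /predU1P[->|/IH h].
        exact: leq_addr.
      exact: leq_trans h (leq_addl _ _).
    by rewrite ler_wiXn2l // ?(leq_trans mk) //; lra.
  exists N => m n Nm Nn; case/orP: (leq_total m n) => mn; last exact: main.
  by rewrite modcBC; exact: main.
exists v => //; apply: (@clim_le R _ _ _ 0) uv => K _.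
by rewrite -[B in leRHS]mulr1; apply: bound.
Qed.

End BoxSums.

Section TaylorExpansion.
Variables (R : realType) (d : nat).
Implicit Types (F : ('I_d -> R[i]) -> R[i]) (z : 'I_d -> R[i]).

Fixpoint monomial_of (js : seq 'I_d) (s : seq nat) z : R[i] :=
  match js, s with
  | j :: js', n :: s' => z j ^+ n * monomial_of js' s' z
  | _, _ => 1
  end.

Fixpoint coefs (js : seq 'I_d) (s : seq nat) F :=
  match js, s with
  | j :: js', n :: s' => coefs js' s' (coef F j n)
  | _, _ => F
  end.

Lemma nested_sum_box (js : seq 'I_d) F K z : nested_sum js F K z =
  \sum_(s <- box (size js) K) coefs js s F z * monomial_of js s z.
Proof.
elim: js F => [|j js IH] F /=; first by rewrite big_seq1 mulr1.
rewrite big_allpairs_dep /=.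
rewrite -(big_mkord predT (fun n => z j ^+ n * nested_sum js (coef F j n) K z)) /index_iota subn0.
apply: eq_bigr => n _; rewrite IH mulr_sumr; apply: eq_bigr => s _.
by rewrite mulrCA.
Qed.

Definition independent F j := forall z t, F (upd z j t) = F z.

Lemma independent_coef F j n i : independent F i -> independent (coef F j n) i.
Proof.
move=> Fi z t; have [->|ij] := eqVneq i j; first exact: coef_upd.
congr (taylor _ n); apply/funext => u; rewrite /slice (updC _ _ _ ij); exact: Fi.
Qed.

Lemma independent_coefs js s F i : size s = size js ->
  independent F i \/ i \in js -> independent (coefs js s F) i.
Proof.
elim: js s F => [|j js IH] [|n s] F //=; first by move=> _ [].
move=> [ss] H; apply: IH => //; case: H => [Fi|]; first by left; exact: independent_coef.
rewrite inE => /predU1P[->|ijs]; last by right.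
by left=> z t; exact: coef_upd.
Qed.

Lemma independent_all (js : seq 'I_d) F z z' : (forall i, i \in js -> independent F i) ->
  (forall i, i \notin js -> z i = z' i) -> F z = F z'.
Proof.
elim: js z => [|j js IH] z Fi zz; first by congr F; apply/funext => i; exact: zz.
rewrite -(Fi j (mem_head _ _) z (z' j)); apply: IH => i ijs.
  by apply: Fi; rewrite inE ijs orbT.
rewrite /upd; case: eqP => [->//|/eqP ij]; apply: zz.
by rewrite inE negb_or ij.
Qed.

Lemma bounded_coefs js s F t M : size s = size js -> separately_entire F -> 0 < t ->
  bounded_on F t M -> bounded_on (coefs js s F) t (M / t ^+ sumn s).
Proof.
move=> + + t0; elim: js s F M => [|j js IH] [|n s] F M //=.
  by move=> _ _ FM; rewrite expr0 divr1.
move=> [ss] FS FM; rewrite exprD invfM mulrA; apply: IH => //.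
  exact: separately_entire_coef.
exact: bounded_coef.
Qed.

(** Taking one coefficient in each variable leaves a constant, since a coefficient
    function no longer depends on its variable.  Cauchy's estimate in one variable
    is used once for each of them. *)
Lemma taylor_expansion F : separately_entire F ->
  exists c : seq nat -> R[i],
    (forall t M s, 0 < t -> bounded_on F t M -> size s = d ->
       modc (c s) * t ^+ sumn s <= M) /\
    forall z, clim (fun K => \sum_(s <- box d K) c s * monomial_of (enum 'I_d) s z) (F z).
Proof.
move=> FS; exists (fun s => coefs (enum 'I_d) s F (fun=> 0)); split.
  move=> t M s t0 FM sd; rewrite -ler_pdivlMr ?exprn_gt0 //.
  apply: bounded_coefs => //; first by rewrite size_enum_ord.
  by move=> j; rewrite modc0 ltW.
move=> z; pose t := 2 * (1 + \sum_j modc (z j)).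
have S0 : 0 <= \sum_j modc (z j) by apply: sumr_ge0 => j _; exact: modc_ge0.
have t0 : 0 < t by rewrite mulr_gt0 // ltr_pwDl.
have zt j : modc (z j) <= t / 2.
  rewrite /t mulrAC divff // mul1r (bigD1 j) //= addrCA lerDl addr_ge0 // sumr_ge0 // => i _.
  exact: modc_ge0.
have [M FM] := FS.2 t.
have E K : \sum_(s <- box d K) coefs (enum 'I_d) s F (fun=> 0) * monomial_of (enum 'I_d) s z =
    nested_sum (enum 'I_d) F K z.
  rewrite nested_sum_box size_enum_ord [LHS]big_seq [RHS]big_seq; apply: eq_bigr => s sK; congr (_ * _).
  have ss : size s = size (enum 'I_d) by rewrite size_enum_ord (size_box sK).
  apply: (@independent_all (enum 'I_d)) => i; last by rewrite mem_enum.
  by move=> ie; apply: independent_coefs => //; right.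
apply: (@clim_squeeze R _ _ (fun K => (M * (4 ^+ size (enum 'I_d) * 2)) * 2^-1 ^+ K)) => [e e0|K].
  by apply: geometric_small => //; lra.
by rewrite E modcBC -mulrA; exact: (nested_sum_close (enum 'I_d) K FS t0 FM zt).
Qed.

End TaylorExpansion.

(** * Restriction of an entire function to lines *)

Section Entire.
Variables (R : realType) (d : nat).

Lemma real_of_pos (e : R[i]) : 0 < e -> exists2 r : R, 0 < r & e = r%:C.
Proof.
move=> e0; exists (complex.Re e).
  by move: e0; case: e => a b; rewrite ltcE /= => /andP[].
by move: e0; case: e => a b; rewrite ltcE /= => /andP[/eqP -> _].
Qed.

Lemma entire_line (f : 'rV[R[i]]_d -> R[i]) (x v : 'rV[R[i]]_d) : entire f ->
  exists l : R[i], forall e : R, 0 < e -> exists2 dl : R, 0 < dl &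
    forall h, modc h <= dl -> modc (f (x + h *: v) - f x - l * h) <= e * modc h.
Proof.
move=> fe; have /diff_locallyP [_ /eqaddoP H] := fe x.
exists ('d f x v) => e e0.
have [nv nv0 Env] : exists2 r : R, 0 < r & `|v| + 1 = r%:C.
  by apply: real_of_pos; rewrite ltr_wpDl.
have eC : 0 < (e / nv)%:C :> R[i] by rewrite ltcR divr_gt0.
have /nbhs_normP[d0 /= /real_of_pos[r r0 ->] Hd] := H _ eC.
exists (r / nv / 2); first by rewrite !divr_gt0.
move=> h hd.
have vle : `|v| <= nv%:C by rewrite -Env lerDl.
have hv : `|h *: v| <= (modc h * nv)%:C.
  by rewrite normrZ normr_modc rmorphM ler_wpM2l // lecR modc_ge0.
have /Hd /= : `|0 - h *: v| < r%:C.
  rewrite sub0r normrN; apply: le_lt_trans hv _; rewrite ltcR.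
  apply: (@le_lt_trans _ _ (r / 2)); last by rewrite ltr_pdivrMr // mulr2n mulrDr mulr1 ltrDl.
  by rewrite -ler_pdivlMr // mulrAC.
move=> le; rewrite -lecR -normr_modc.
have E : 'd f x (h *: v) = h * 'd f x v by rewrite linearZ.
have -> : f (x + h *: v) - f x - 'd f x v * h =
    (f \o +%R^~ x - (cst (f x) + 'd f x)) (h *: v).
  rewrite -[RHS]/(f (h *: v + x) - (f x + 'd f x (h *: v))) E.
  by rewrite (addrC x) opprD addrA [h * _]mulrC.
apply: le_trans le _.
have -> : (e * modc h)%:C = (e / nv)%:C * (modc h * nv)%:C :> R[i].
  by rewrite -rmorphM; congr (_%:C); field; rewrite gt_eqF.
by rewrite ler_wpM2l // ltW.
Qed.

Definition as_fun (f : 'rV[R[i]]_d -> R[i]) (z : 'I_d -> R[i]) : R[i] := f (\row_j z j).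

Lemma separately_entire_of_entire (f : 'rV[R[i]]_d -> R[i]) : entire f ->
  (forall s, exists M, bounded_on (as_fun f) s M) -> separately_entire (as_fun f).
Proof.
move=> fe fb; split=> // z j; apply: cdiff_entire_series.
  move=> t; have [l H] := entire_line (\row_k upd z j t k) (delta_mx 0 j) fe.
  exists l => e /H[dl dl0 Hd]; exists dl => // h /Hd.
  rewrite /slice /as_fun.
  suff -> : \row_k upd z j (t + h) k = (\row_k upd z j t k) + h *: delta_mx 0 j by [].
  apply/rowP => k; rewrite !mxE eqxx /= /upd; case: eqP => _ /=; first by rewrite mulr1.
  by rewrite mulr0 addr0.
move=> s; have [M FM] := fb (Num.max s (\sum_k modc (z k))); exists M => t ts.
apply: FM => k; rewrite /upd le_max; case: eqP => _; first by rewrite ts.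
rewrite (bigD1 k) //= lerDl sumr_ge0 ?orbT // => i _; exact: modc_ge0.
Qed.

End Entire.

(** * Series of polynomials *)

Section FrechetFromRemainder.
Variables (R : realType) (d : nat).

Lemma row_coord_le (w : 'rV[R[i]]_d) j : `|w 0 j| <= `|w|.
Proof.
rewrite [leRHS]/Num.Def.normr /= mx_normE -[leLHS]nngE num_le.
exact: (le_bigmax _ (fun ij : 'I_1 * 'I_d => `|w ij.1 ij.2|%:nng) (0, j)).
Qed.

Definition row_pairing (g : 'I_d -> R[i]) (w : 'rV[R[i]]_d) : R[i] := \sum_j w 0 j * g j.

Fact row_pairing_is_linear g : linear (row_pairing g).
Proof.
move=> a u v; rewrite /row_pairing -[RHS]/(a * _ + _) mulr_sumr -big_split.
by apply: eq_bigr => j _ /=; rewrite !mxE mulrDl mulrA.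
Qed.
HB.instance Definition _ g :=
  GRing.isLinear.Build R[i] 'rV[R[i]]_d R[i] _ (row_pairing g) (row_pairing_is_linear g).

Lemma row_pairing_continuous g : continuous (row_pairing g).
Proof.
apply: continuous_big => [|j _ w]; first exact: add_continuous.
have H : (fun u : 'rV[R[i]]_d => u 0 j) @ w --> w 0 j by exact: (@coord_continuous R[i] 1 d 0 j w).
by apply: cvgM H _; exact: cvg_cst.
Qed.

(** A quadratic remainder is asked for on all scaled copies of one polydisc, the
    form in which majorants provide it; it is then [o(w)]. *)
Lemma differentiable_of_remainder (F : 'rV[R[i]]_d -> R[i]) (x : 'rV[R[i]]_d)
    (g : 'I_d -> R[i]) (r B : R) : 0 < r ->
  (forall (e : R) (w : 'rV[R[i]]_d), 0 <= e -> e <= 1 -> (forall j, modc (w 0 j) <= e * r) ->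
     modc (F (x + w) - F x - row_pairing g w) <= e ^+ 2 * B) ->
  differentiable F x /\ 'd F x = row_pairing g :> ('rV[R[i]]_d -> R[i]).
Proof.
move=> r0 H.
have E (e' : R[i]) : 0 < e' -> \forall w \near (0 : 'rV[R[i]]_d),
    `|F (w + x) - (F x + row_pairing g w)| <= e' * `|w|.
  move=> /real_of_pos[e e0 ->].
  have B1 : 0 < `|B| + 1 by rewrite ltr_wpDl.
  apply/nbhs_normP; exists (Num.min r (e * r ^+ 2 / (`|B| + 1)))%:C.
    by rewrite /= ltcR lt_min r0 divr_gt0 // mulr_gt0 // exprn_gt0.
  move=> w /=; rewrite sub0r normrN => ws.
  have [nw nw0 Ew] : exists2 t : R, 0 <= t & `|w| = t%:C.
    have [->|w0] := eqVneq w 0; first by exists 0; rewrite ?normr0.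
    have /real_of_pos[t t0 Et] : 0 < `|w| by rewrite normr_gt0.
    by exists t => //; exact: ltW.
  move: ws; rewrite Ew ltcR lt_min => /andP[wr we].
  have := H (nw / r) w; rewrite divr_ge0 ?(ltW r0) // ler_pdivrMr // mul1r (ltW wr).
  rewrite divfK ?gt_eqF // => /(_ isT isT) H'.
  have {}H' : modc (F (x + w) - F x - row_pairing g w) <= (nw / r) ^+ 2 * B.
    by apply: H' => j; rewrite -lecR -normr_modc -Ew row_coord_le.
  rewrite (addrC w) opprD addrA normr_modc -rmorphM lecR; apply: le_trans H' _.
  apply: (@le_trans _ _ ((nw / r) ^+ 2 * (`|B| + 1))).
    by rewrite ler_wpM2l ?sqr_ge0 // (le_trans (ler_norm B)) // lerDl.
  move: we; rewrite ltr_pdivlMr // => /ltW we.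
  rewrite expr_div_n mulrAC ler_pdivrMr ?exprn_gt0 // expr2 -mulrA mulrC.
  apply: le_trans (ler_wpM2r nw0 we) _.
  by rewrite mulrAC.
have D : 'd F x = row_pairing g :> ('rV[R[i]]_d -> R[i]).
  apply: diff_unique; first exact: row_pairing_continuous.
  by apply/eqaddoP => e' e0; exact: E.
split=> //; apply/diff_locallyP; rewrite D; split; first exact: row_pairing_continuous.
by apply/eqaddoP => e' e0; exact: E.
Qed.

Lemma partial_of_remainder (F : 'rV[R[i]]_d -> R[i]) (x : 'rV[R[i]]_d)
    (g : 'I_d -> R[i]) j :
  differentiable F x -> 'd F x = row_pairing g :> ('rV[R[i]]_d -> R[i]) ->
  partial j F x = g j.
Proof.
move=> Fd E; rewrite /partial deriveE // E /row_pairing (bigD1 j) //= big1 ?addr0.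
  by rewrite mxE !eqxx mul1r.
by move=> k kj; rewrite mxE (negbTE kj) mul0r.
Qed.

End FrechetFromRemainder.

Section PolynomialSeries.
Variables (R : realType) (d : nat).
Implicit Types (c : seq nat -> R[i]) (H : seq nat -> mpoly.mpoly d R).

(** Geometric decay at every radius survives differentiation of the polynomials,
    because the derivatives are bounded by the same majorants at twice the
    radius. *)
Definition summable_family c H := forall r : R, 1 <= r -> exists2 B, 0 <= B &
  forall s, size s = d -> modc (c s) * majorant r (H s) <= B * 4^-1 ^+ sumn s.

Definition series_sum c H (z : 'I_d -> R[i]) : R[i] :=
  xget 0 [set v | clim (fun K => \sum_(s <- box d K) c s * ceval z (H s)) v].

Lemma exists_radius (z : 'I_d -> R[i]) : exists2 r : R, 1 <= r & forall j, modc (z j) <= r.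
Proof.
have S0 : 0 <= \sum_j modc (z j) by apply: sumr_ge0 => j _; exact: modc_ge0.
exists (1 + \sum_j modc (z j)) => [|j]; first by rewrite lerDl.
rewrite (bigD1 j) //= addrCA lerDl addr_ge0 // sumr_ge0 // => i _; exact: modc_ge0.
Qed.

Lemma ceval_family_le c H z (r B : R) s : 1 <= r -> (forall j, modc (z j) <= r) ->
  modc (c s) * majorant r (H s) <= B -> modc (c s * ceval z (H s)) <= B.
Proof.
move=> r1 zr; apply: le_trans; rewrite modcM ler_wpM2l ?modc_ge0 //.
by apply: ceval_le zr; apply: lt_le_trans r1.
Qed.

Lemma series_sumP c H z : summable_family c H ->
  clim (fun K => \sum_(s <- box d K) c s * ceval z (H s)) (series_sum c H z).
Proof.
move=> cH; have [r r1 zr] := exists_radius z; have [B B0 HB] := cH r r1.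
have [|v uv _] := @box_sum_cvg R d (fun s => c s * ceval z (H s)) B B0.
  by move=> s /HB; exact: ceval_family_le.
rewrite /series_sum; case: xgetP => [x _ //|/(_ v) H']; case: (H' uv).
Qed.

Lemma series_sum_le c H z (r B : R) : summable_family c H -> 1 <= r -> 0 <= B ->
  (forall j, modc (z j) <= r) ->
  (forall s, size s = d -> modc (c s) * majorant r (H s) <= B * 4^-1 ^+ sumn s) ->
  modc (series_sum c H z) <= B * 2 ^+ d.
Proof.
move=> cH r1 B0 zr HB.
have [|v uv] := @box_sum_cvg R d (fun s => c s * ceval z (H s)) B B0.
  by move=> s /HB; exact: ceval_family_le.
by rewrite (clim_unique uv (series_sumP z cH)).
Qed.

Lemma summable_mderiv c H j : summable_family c H ->
  summable_family c (fun s => mpoly.mderiv j (H s)).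
Proof.
move=> cH r r1; have [|B B0 HB] := cH (2 * r).
  by rewrite mulr_ege1 // ler1n.
exists B => // s /HB; apply: le_trans; rewrite ler_wpM2l ?modc_ge0 //.
exact: majorant_mderiv.
Qed.

(** The termwise second order remainders are dominated by the majorants at twice
    the radius, uniformly in the direction. *)
Lemma series_sum_remainder c H z (r : R) : summable_family c H -> 1 <= r ->
  (forall j, modc (z j) <= r) ->
  exists B : R, forall (e : R) (w : 'I_d -> R[i]), 0 <= e -> e <= 1 -> (forall j, modc (w j) <= e * r) ->
    modc (series_sum c H (fun j => z j + w j) - series_sum c H z
      - \sum_j w j * series_sum c (fun s => mpoly.mderiv j (H s)) z) <= e ^+ 2 * B.
Proof.
move=> cH r1 zr; have [|B B0 HB] := cH (2 * r).
  by rewrite mulr_ege1 // ler1n.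
exists (B * 2 ^+ d) => e w e0 e1 wr.
have [|v uv] := @box_sum_cvg R d (fun s => c s * cremainder z w (H s)) (e ^+ 2 * B) (mulr_ge0 (sqr_ge0 e) B0).
  move=> s /HB {}HB; rewrite modcM -mulrA; apply: le_trans (ler_wpM2l (sqr_ge0 e) HB).
  rewrite mulrCA ler_wpM2l ?modc_ge0 //; apply: cremainder_le => //.
  exact: lt_le_trans r1.
rewrite mulrA; congr (modc _ <= _); apply: (clim_unique uv).
have lim : clim (fun K => \sum_(s <- box d K) c s * ceval (fun j => z j + w j) (H s)
    - \sum_(s <- box d K) c s * ceval z (H s)
    - \sum_j w j * \sum_(s <- box d K) c s * ceval z (mpoly.mderiv j (H s)))
  (series_sum c H (fun j => z j + w j) - series_sum c H z
      - \sum_j w j * series_sum c (fun s => mpoly.mderiv j (H s)) z).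
  apply: climB; first by apply: climB; exact: series_sumP.
  by apply: clim_sum => j; apply: climZ; apply: series_sumP; exact: summable_mderiv.
apply: (clim_eventually (N0 := 0)) lim => K _.
have -> : \sum_j w j * \sum_(s <- box d K) c s * ceval z (mpoly.mderiv j (H s)) =
    \sum_(s <- box d K) \sum_j w j * (c s * ceval z (mpoly.mderiv j (H s))).
  by rewrite exchange_big; apply: eq_bigr => j _; rewrite mulr_sumr.
rewrite -!sumrB; apply: eq_bigr => s _ /=.
rewrite /cremainder /cdiffl !mulrBr; congr (_ - _).
by rewrite [RHS]mulr_sumr; apply: eq_bigr => j _; rewrite mulrCA.
Qed.

Definition series_fun c H (x : 'rV[R[i]]_d) : R[i] := series_sum c H (fun j => x 0 j).

Lemma series_fun_diff c H x : summable_family c H ->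
  differentiable (series_fun c H) x /\
  forall j, partial j (series_fun c H) x = series_fun c (fun s => mpoly.mderiv j (H s)) x.
Proof.
move=> cH; have [r r1 xr] := exists_radius (fun j => x 0 j).
have [B HB] := series_sum_remainder cH r1 xr.
have [|D E] := @differentiable_of_remainder R d (series_fun c H) x
  (fun j => series_fun c (fun s => mpoly.mderiv j (H s)) x) r B (lt_le_trans ltr01 r1).
  move=> e w e0 e1 wr.
  have -> : series_fun c H (x + w) = series_sum c H (fun j => x 0 j + w 0 j).
    by rewrite /series_fun; congr series_sum; apply/funext => j; rewrite mxE.
  exact: (HB e (fun j => w 0 j) e0 e1 wr).
by split=> // j; exact: partial_of_remainder D E.
Qed.

Lemma series_fun_entire c H : summable_family c H -> entire (series_fun c H).
Proof. by move=> cH x; case: (series_fun_diff x cH). Qed.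

Lemma series_fun_harmonic c H : summable_family c H ->
  (forall s, size s = d -> harmonic_poly (H s)) -> harmonic_fun (series_fun c H).
Proof.
move=> cH H0 x.
have E j : partial j (partial j (series_fun c H)) x =
    series_fun c (fun s => mpoly.mderiv j (mpoly.mderiv j (H s))) x.
  have -> : partial j (series_fun c H) = series_fun c (fun s => mpoly.mderiv j (H s)).
    by apply/funext => y; case: (series_fun_diff y cH).
  by case: (series_fun_diff x (summable_mderiv j cH)).
rewrite /laplacian (eq_bigr _ (fun j _ => E j)).
have lim : clim (fun K => \sum_j \sum_(s <- box d K) c s * ceval (fun j => x 0 j)
     (mpoly.mderiv j (mpoly.mderiv j (H s))))
   (\sum_j series_fun c (fun s => mpoly.mderiv j (mpoly.mderiv j (H s))) x).
  by apply: clim_sum => j; apply: series_sumP; do 2!apply: summable_mderiv.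
apply: (clim_unique lim); apply: (clim_eventually (N0 := 0)) (clim_cst 0) => K _.
rewrite exchange_big /= big_seq big1 // => s /size_box sd.
by rewrite -mulr_sumr ceval_harmonic ?mulr0 //; exact: H0.
Qed.

End PolynomialSeries.

(** * Growth and order *)

Section MultiIndex.
Variables (R : realType) (n : nat).

Lemma sumn_nth s : size s = n -> sumn s = (\sum_(i < n) nth 0 s i)%N.
Proof. by move=> <-; rewrite sumnE (big_nth 0%N) big_mkord. Qed.

Lemma monomial_ofE s (z : 'I_n -> R[i]) : size s = n ->
  monomial_of (enum 'I_n) s z = \prod_i z i ^+ nth 0%N s i.
Proof.
case: n z s => [|m] z s; first by move=> sn0; rewrite big_ord0 (size0nil sn0) {sn0}; case: (enum _).
move=> sm.
have gen (js : seq 'I_m.+1) t : size t = size js -> monomial_of js t z =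
    \prod_(k < size js) z (nth ord0 js k) ^+ nth 0%N t k.
  elim: js t => [|j js IH] [|k t] //=; first by rewrite big_ord0.
  by move=> [/IH ->]; rewrite big_ord_recl.
rewrite gen ?size_enum_ord //; apply: eq_bigr => i _.
by rewrite nth_ord_enum.
Qed.

End MultiIndex.

Section Growth.
Variable R : realType.
Implicit Types (r t tau A D kap : R).

(** Below [X = kap `^ (s' - s)^-1] the left hand side is bounded, above it the
    constant [kap] is at most [x `^ (s' - s)]. *)
Lemma powR_absorb kap s s' : 0 <= kap -> 0 <= s -> s < s' ->
  exists2 C : R, 0 <= C & forall x, 0 <= x -> kap * x `^ s <= x `^ s' + C.
Proof.
move=> k0 s0 ss; have ds : 0 < s' - s by rewrite subr_gt0.
pose X := kap `^ (s' - s)^-1; exists (kap * X `^ s).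
  by rewrite mulr_ge0 ?powR_ge0.
move=> x x0; have [xX|Xx] := leP x X.
  apply: (@le_trans _ _ (kap * X `^ s)); last by rewrite lerDr powR_ge0.
  by rewrite ler_wpM2l // ge0_ler_powR ?nnegrE ?powR_ge0.
have xp : 0 < x by apply: le_lt_trans Xx; exact: powR_ge0.
rewrite -[s' in leRHS](subrK s) powRD; last by rewrite (gt_eqF xp) implybT.
apply: (@le_trans _ _ (x `^ (s' - s) * x `^ s)); last first.
  by rewrite lerDl mulr_ge0 ?powR_ge0.
rewrite ler_wpM2r ?powR_ge0 //.
have -> : kap = X `^ (s' - s) by rewrite /X -powRrM mulVf ?gt_eqF // powRr1.
by rewrite ge0_ler_powR ?nnegrE ?powR_ge0 ?ltW.
Qed.

(** Cauchy's estimate is used at the radius [L * max (r, N ^ e)] with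
    [L = 4 D exp 1], so that the geometric factor becomes [4 ^ - N * exp (- N)].
    The exponential pays for [exp (kap N `^ (e tau))], since [e tau < 1]. *)
Lemma growth_bound (d e : nat) D tau A : 1 <= D -> 0 <= tau -> e%:R * tau < 1 -> 0 <= A ->
  exists A' kap : R, [/\ 0 <= A', 0 <= kap & forall r (N : nat) (cs mj : R),
    1 <= r -> 0 <= cs ->
    (forall t, 0 < t -> cs * t ^+ N <= A * expR ((d%:R * t) `^ tau)) ->
    mj <= (D * Num.max r (N ^ e)%:R) ^+ N ->
    cs * mj <= A' * expR (kap * r `^ tau) * 4^-1 ^+ N].
Proof.
move=> D1 t0 et A0; have D0 : 0 < D by apply: lt_le_trans D1.
pose L := 4 * D * expR 1; pose kap := (d%:R * L) `^ tau.
have L0 : 0 < L by rewrite !mulr_gt0 ?expR_gt0.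
have [C C0 HC] := @powR_absorb kap (e%:R * tau) 1 (powR_ge0 _ _) (mulr_ge0 (ler0n _ _) t0) et.
exists (A * expR C), kap; split; rewrite ?mulr_ge0 ?expR_ge0 ?powR_ge0 //.
move=> r N cs mj r1 cs0 cst mjR; pose R0 := Num.max r (N ^ e)%:R.
have R00 : 0 < R0 by rewrite lt_max (lt_le_trans ltr01 r1).
apply: le_trans (ler_wpM2l cs0 mjR) _; rewrite -/R0.
have -> : cs * (D * R0) ^+ N = cs * (L * R0) ^+ N * (4^-1 ^+ N * expR (- N%:R)).
  rewrite expRN -[N%:R]mulr1 expRM_natl -exprVn -!exprMn -mulrA -exprMn.
  by congr (_ * _ ^+ _); rewrite /L; field; rewrite gt_eqF ?expR_gt0.
have w0 : 0 <= 4^-1 ^+ N * expR (- N%:R) :> R by rewrite mulr_ge0 ?expR_ge0 // exprn_ge0.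
apply: le_trans (ler_wpM2r w0 (cst _ (mulr_gt0 L0 R00))) _.
rewrite (mulrA d%:R) (powRM _ (mulr_ge0 (ler0n R d) (ltW L0)) (ltW R00)) -/kap mulrCA [leRHS]mulrC.
rewrite ler_wpM2l ?exprn_ge0 // -!mulrA ler_wpM2l // -!expRD ler_expR lerBlDr.
have R0le : R0 `^ tau <= r `^ tau + N%:R `^ (e%:R * tau).
  rewrite powRrM powR_mulrn ?ler0n // -natrX /R0.
  have [_|_] := leP r (N ^ e)%:R; first by rewrite lerDr powR_ge0.
  by rewrite lerDl powR_ge0.
apply: le_trans (ler_wpM2l (powR_ge0 _ _) R0le) _; rewrite mulrDr addrC addrAC lerD2r.
by rewrite addrC; have := HC N%:R (ler0n _ _); rewrite powRr1.
Qed.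

Lemma euclid_norm_le d (z : 'I_d -> R[i]) t : 0 <= t -> (forall j, modc (z j) <= t) ->
  euclid_norm (\row_j z j) <= d%:R * t.
Proof.
move=> t0 zt; have dt : 0 <= d%:R * t by rewrite mulr_ge0.
rewrite -[leRHS]ger0_norm // -sqrtr_sqr ler_wsqrtr // exprMn.
apply: (@le_trans _ _ (\sum_(j < d) t ^+ 2)).
  by apply: ler_sum => j _; rewrite mxE lerXn2r ?nnegrE ?modc_ge0.
rewrite sumr_const card_ord -[leLHS]mulr_natl ler_wpM2r ?sqr_ge0 // -natrX ler_nat.
by case: (d) => // k; rewrite expnS leq_pmulr // expn_gt0.
Qed.

Lemma euclid_norm_ge d (x : 'rV[R[i]]_d) j : modc (x 0 j) <= euclid_norm x.
Proof.
rewrite -[leLHS]ger0_norm ?modc_ge0 // -sqrtr_sqr ler_wsqrtr // (bigD1 j) //= lerDl.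
by apply: sumr_ge0 => k _; rewrite sqr_ge0.
Qed.

Definition growth_at_most d (f : 'rV[R[i]]_d -> R[i]) (tau : R) :=
  0 <= tau /\ exists2 A : R, 0 < A & forall z, modc (f z) <= A * expR (euclid_norm z `^ tau).

Lemma growth_bounded_on d (f : 'rV[R[i]]_d -> R[i]) tau A t : 0 <= tau -> 0 <= A ->
  (forall z, modc (f z) <= A * expR (euclid_norm z `^ tau)) -> 0 <= t ->
  bounded_on (as_fun f) t (A * expR ((d%:R * t) `^ tau)).
Proof.
move=> tau0 A0 fA t0 z zt; apply: le_trans (fA _) _.
rewrite ler_wpM2l // ler_expR ge0_ler_powR ?nnegrE ?sqrtr_ge0 ?mulr_ge0 //.
exact: euclid_norm_le.
Qed.

Lemma growth_below d (f : 'rV[R[i]]_d -> R[i]) (rho theta : R) :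
  entire_order f = rho%:E -> rho < theta -> exists2 tau, tau < theta & growth_at_most f tau.
Proof.
move=> fr rt; have : (entire_order f < theta%:E)%E by rewrite fr lte_fin.
by move=> /ereal_inf_lt[_ [tau H <-]]; rewrite lte_fin => tt; exists tau.
Qed.

Lemma entire_order_le d (f : 'rV[R[i]]_d -> R[i]) (rho : R) :
  (forall theta, rho < theta -> growth_at_most f theta) -> (entire_order f <= rho%:E)%E.
Proof.
move=> H; apply/lee_addgt0Pr => e e0; apply: ereal_inf_lbound.
by exists (rho + e); rewrite ?EFinD //; apply: H; rewrite ltrDl.
Qed.

End Growth.

(** The critical exponent [1 - beta / 2] is [1 / e].  There are exponents
    [tau < 1 / e] arbitrarily close to [rho], or below it, that bound the growth
    of [f]; up to constants they also bound that of the series, and hence its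
    order. *)
Lemma harmonic_interpolation (R : realType) (n : nat) (a b : 'rV[R]_n.+1) (c rho : R) (e : nat)
    (f : 'rV[R[i]]_n.+1 -> R[i]) :
  (exists j, a 0 j != 0) -> e = 2%N \/ (e = 1%N /\ forall j, b 0 j = 0) ->
  entire f -> entire_order f = rho%:E -> e%:R * rho < 1 ->
  exists h : 'rV[R[i]]_n.+1 -> R[i],
    [/\ entire h, harmonic_fun h, (entire_order h <= rho%:E)%E &
        forall x : 'rV[R]_n.+1, quadratic a b c x = 0 -> h (real_point x) = f (real_point x)].
Proof.
set d := n.+1 => a0 eb fE fr er.
have e0 : (0 < e)%N by case: eb => [->|[-> _]].
have e0R : 0 < e%:R :> R by rewrite ltr0n.
have belowE (tau : R) : (tau < e%:R^-1) = (e%:R * tau < 1).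
  by rewrite -(ltr_pdivlMl _ _ e0R) mulr1.
have rhoe : rho < e%:R^-1 by rewrite belowE.
have fb s : exists M, bounded_on (as_fun f) s M.
  have [tau _ [tau0 [A A0 fA]]] := growth_below fr rhoe.
  have m0 : 0 <= Num.max s 0 by rewrite le_max lexx orbT.
  eexists => z zs; apply: (growth_bounded_on tau0 (ltW A0) fA m0).
  by move=> j; rewrite le_max zs.
have [cf [cfle cflim]] := taylor_expansion (separately_entire_of_entire fE fb).
have [D D1 HD] := @harmonic_substitute n R (fun i => a 0 i) (fun i => b 0 i) c e a0 eb.
have [H HP] := choice (fun s : seq nat => HD (fun i => nth 0%N s i)).
have growth (tau : R) : tau < e%:R^-1 -> growth_at_most f tau ->
    exists A kap : R, [/\ 0 <= A, 0 <= kap & forall r s, 1 <= r -> size s = d ->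
      modc (cf s) * majorant r (H s) <= A * expR (kap * r `^ tau) * 4^-1 ^+ sumn s].
  move=> taue [tau0 [A A0 fA]].
  have [A' [kap [A'0 kap0 HA]]] := growth_bound d D1 tau0 (etrans (esym (belowE tau)) taue) (ltW A0).
  exists A', kap; split=> // r s r1 sd; apply: HA => //; first exact: modc_ge0.
    move=> t t0; apply: (cfle _ _ _ t0 _ sd).
    exact: growth_bounded_on tau0 (ltW A0) fA (ltW t0).
  have [_ _ Hm] := HP s; have := Hm r (Num.max r (sumn s ^ e)%:R).
  rewrite -(sumn_nth sd); apply; rewrite ?le_max ?lexx ?r1 ?orbT //.
  exact: le_trans r1.
have sumH : summable_family cf H.
  move=> r r1; have [tau taue ft] := growth_below fr rhoe.
  have [A [kap [A0 kap0 HA]]] := growth tau taue ft.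
  exists (A * expR (kap * r `^ tau)); first by rewrite mulr_ge0 ?expR_ge0.
  by move=> s sd; exact: HA.
exists (series_fun cf H); split.
- exact: series_fun_entire.
- by apply: series_fun_harmonic => // s _; case: (HP s).
- apply: entire_order_le => theta rt.
  have [|tau] := @growth_below R d f rho (Num.min theta e%:R^-1) fr; first by rewrite lt_min rt.
  rewrite lt_min => /andP[taut taue] ft; have tau0 := ft.1.
  have [A [kap [A0 kap0 HA]]] := growth tau taue ft.
  have [C C0 HC] := powR_absorb kap0 tau0 taut.
  split; first exact: le_trans (ltW taut).
  exists (A * 2 ^+ d * expR (kap + C) + 1); first by rewrite ltr_wpDl // !mulr_ge0 ?expR_ge0 ?exprn_ge0.
  move=> z; pose r := Num.max 1 (euclid_norm z).
  have r1 : 1 <= r by rewrite le_max lexx.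
  have zr j : modc (z 0 j) <= r by rewrite le_max euclid_norm_ge orbT.
  apply: le_trans (series_sum_le sumH r1 _ zr (fun s => HA r s r1)) _.
    by rewrite mulr_ge0 ?expR_ge0.
  apply: (@le_trans _ _ (A * 2 ^+ d * expR (kap + C) * expR (euclid_norm z `^ theta))); last first.
    by rewrite ler_wpM2r ?expR_ge0 // lerDl.
  rewrite mulrAC -!mulrA -expRD !ler_wpM2l ?exprn_ge0 // ler_expR.
  have z0 : 0 <= euclid_norm z by exact: sqrtr_ge0.
  have := HC _ z0; have := powR_ge0 (euclid_norm z) theta.
  by rewrite /r; have [_|_] := leP 1 (euclid_norm z); rewrite ?powR1; lra.
- move=> x qx; apply: (clim_unique (series_sumP _ sumH)).
  have -> : f (real_point x) = as_fun f (fun j => (x 0 j)%:C) by [].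
  apply: (clim_eventually (N0 := 0)) (cflim _) => K _.
  rewrite [LHS]big_seq [RHS]big_seq; apply: eq_bigr => s /size_box sd.
  rewrite (monomial_ofE _ sd); congr (_ * _); have [_ HE _] := HP s.
  rewrite -(HE (fun i => x 0 i) qx); congr (ceval _ _).
  by apply/funext => j; rewrite mxE.
Qed.

Theorem theorem2 (R : realType) (d : nat) (a b : 'rV[R]_d) (c : R) (beta rho : R)
    (f : 'rV[R[i]]_d -> R[i]) :
  (2 <= d)%N ->
  (exists j : 'I_d, a 0 j != 0) ->
  beta = (if [exists j : 'I_d, b 0 j != 0] then 1 else 0) ->
  entire f ->
  entire_order f = rho%:E ->
  rho < 1 - beta / 2 ->
  exists h : 'rV[R[i]]_d -> R[i],
    [/\ entire h,
        harmonic_fun h,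
        (entire_order h <= rho%:E)%E &
        forall x : 'rV[R]_d, quadratic a b c x = 0 ->
          h (real_point x) = f (real_point x)].
Proof.
case: d a b f => [//|n] a b f _ a0 betaE fE fr rb.
pose e := if [exists j : 'I_n.+1, b 0 j != 0] then 2%N else 1%N.
apply: (@harmonic_interpolation R n a b c rho e f) => //; rewrite {}betaE in rb; move: rb; rewrite /e.
  case: ifP => [_|/existsPn b0] _; [by left|right; split=> // j].
  by apply/eqP; exact: negbNE (b0 j).
by case: ifP => _ ?; lra.
Qed.
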